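(* Suppose that the following statement holds: for every non-trivial pure braid $\sigma\in B_4$ which is not equal to $\Delta^k$ for any $k\in\mathbb{N}$ and which acts non-trivially on the segment $T_4$, there exist $l_0\in\mathbb{N}$ and $m_0\in\mathbb{N}$ (depending on $\sigma$) such that for all $m>m_0$ and all $l\ge l_0$ the Laurent polynomials $\rho_{11}(a^m\sigma a^{-l})$ and $\rho_{31}(a^m\sigma a^{-l})$ are both non-zero and $$\deg_{\min}\bigl(\rho_{11}(a^m\sigma a^{-l})\bigr)-\deg_{\min}\bigl(\rho_{31}(a^m\sigma a^{-l})\bigr)=-1.$$ Then the reduced Burau representation $\rho:B_4\to GL(3,\mathbb{Z}[t,t^{-1}])$ is faithful (i.e. injective).
   Context: $B_4=\langle \sigma_1,\sigma_2,\sigma_3\mid \sigma_1\sigma_2\sigma_1=\sigma_2\sigma_1\sigma_2,\ \sigma_3\sigma_2\sigma_3=\sigma_2\sigma_3\sigma_2,\ \sigma_3\sigma_1=\sigma_1\sigma_3\rangle$ is the braid group on four strands. A braid is pure if it lies in the kernel of the homomorphism from $B_4$ to the symmetric group on $\{1,2,3,4\}$ sending $\sigma_i$ to the transposition $(i\ i{+}1)$. $\Delta=\sigma_1\sigma_2\sigma_3\sigma_1\sigma_2\sigma_1$ is the half twist. $\rho:B_4\to GL(3,\mathbb{Z}[t,t^{-1}])$ is the reduced Burau representation (the action of $B_4$ on the first homology of the infinite cyclic cover of the 4-punctured disc, a free $\mathbb{Z}[t,t^{-1}]$-module of rank 3). Concretely, it is the group homomorphism given by $$\rho(\sigma_1)=\begin{pmatrix}-t^{-1}&0&0\\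 t^{-1}&1&0\\ 0&0&1\end{pmatrix},\quad \rho(\sigma_2)=\begin{pmatrix}1&1&0\\ 0&-t^{-1}&0\\ 0&t^{-1}&1\end{pmatrix},\quad \rho(\sigma_3)=\begin{pmatrix}1&0&0\\ 0&1&1\\ 0&0&-t^{-1}\end{pmatrix}.$$ $\rho_{ij}(\sigma)$ denotes the $(i,j)$ entry of $\rho(\sigma)$, and $a=\sigma_1\sigma_2\sigma_1^{-1}\sigma_3\sigma_2^{-1}\sigma_1^{-1}\in B_4$. For a non-zero Laurent polynomial $f\in\mathbb{Z}[t,t^{-1}]$, $\deg_{\min}(f)$ is the exponent of its lowest-degree term. Geometric action: let $D_4$ be the closed unit disc with four punctures $p_1=(-\frac12,\frac12)$, $p_2=(\frac12,\frac12)$, $p_3=(\frac12,-\frac12)$, $p_4=(-\frac12,-\frac12)$. $B_4$ is identified with the group of isotopy classes (relative to $\partial D_4$) of orientation-preserving homeomorphisms of $D_4$ fixing $\partial D_4$ pointwise, acting on the right on isotopy classes of arcs (in a product $\sigma\tau$, $\sigma$ is applied first). Let $T_i$ be the straight segment joining $p_i$ to $p_{i+1}$ for $i=1,2,3$, and let $T_4$ be the straight segment joining $p_4$ and $p_1$. The generator $\sigma_i$ is the counterclockwise half-twist along $T_i$ exchanging $p_i$ and $p_{i+1}$ $(i=1,2,3)$; with these conventions the counterclockwise half-twist along $T_4$ is $\sigma_1\sigma_2\sigma_3\sigma_2^{-1}\sigma_1^{-1}$. A braid $\sigma$ acts non-trivially on $T_4$ if the image of $T_4$ under $\sigma$ is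 not isotopic to $T_4$ in the disc relative to the punctures. *)

(* Defs.v *)
From HB Require Import structures.
From mathcomp Require Import all_boot all_order all_algebra all_fingroup.
From mathcomp Require Import all_classical all_reals all_analysis.

Set Implicit Arguments.
Unset Strict Implicit.
Unset Printing Implicit Defensive.

Import Order.TTheory GRing.Theory Num.Theory.
Import numFieldNormedType.Exports.

Local Open Scope classical_set_scope.
Local Open Scope ring_scope.
Local Open Scope quotient_scope.

(* [fingroup.repr] shadows the representative function of quotient types. *)
Local Notation repr := generic_quotient.repr.

(** * The braid group B_4 *)

(* The letter [(i, b)] is the generator sigma_(i+1) if [b = false], and its
   inverse if [b = true]. *)
Definition letter : Type := ('I_3 * bool)%type.
Definition word := seq letter.

Definition i1 : 'I_3 := @Ordinal 3 0 isT.
Definition i2 : 'I_3 := @Ordinal 3 1 isT.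
Definition i3 : 'I_3 := @Ordinal 3 2 isT.

Definition gen_word (i : 'I_3) : word := [:: (i, false)].
Definition inv_word (w : word) : word := rev [seq (l.1, ~~ l.2) | l <- w].

Inductive braid_eq : word -> word -> Prop :=
| braid_refl u : braid_eq u u
| braid_sym u v : braid_eq u v -> braid_eq v u
| braid_trans v u w : braid_eq u v -> braid_eq v w -> braid_eq u w
| braid_cat u u' v v' :
    braid_eq u u' -> braid_eq v v' -> braid_eq (u ++ v) (u' ++ v')
| braid_cancel i b : braid_eq [:: (i, b); (i, ~~ b)] [::]
| braid_121 : braid_eq (gen_word i1 ++ gen_word i2 ++ gen_word i1)
                       (gen_word i2 ++ gen_word i1 ++ gen_word i2)
| braid_323 : braid_eq (gen_word i3 ++ gen_word i2 ++ gen_word i3)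
                       (gen_word i2 ++ gen_word i3 ++ gen_word i2)
| braid_31 : braid_eq (gen_word i3 ++ gen_word i1) (gen_word i1 ++ gen_word i3).

Definition braid_eqb (u v : word) : bool := `[< braid_eq u v >].

Lemma braid_eqb_refl : reflexive braid_eqb.
Proof. by move=> u; apply/asboolP; exact: braid_refl. Qed.

Lemma braid_eqb_sym : symmetric braid_eqb.
Proof. by move=> u v; apply/asboolP/asboolP; exact: braid_sym. Qed.

Lemma braid_eqb_trans : transitive braid_eqb.
Proof.
by move=> v u w /asboolP uv /asboolP vw; apply/asboolP; exact: braid_trans vw.
Qed.

Canonical braid_equiv : equiv_rel word :=
  EquivRel braid_eqb braid_eqb_refl braid_eqb_sym braid_eqb_trans.

Definition B4 : Type := {eq_quot braid_equiv}.
HB.instance Definition _ : EqQuotient _ braid_equiv B4 := EqQuotient.on B4.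
HB.instance Definition _ := Choice.on B4.

Definition braid (w : word) : B4 := \pi_B4 w.

Lemma braidP u v : braid u = braid v <-> braid_eq u v.
Proof.
split=> [/eqmodP /asboolP //|uv]; by apply/eqmodP/asboolP.
Qed.

Lemma braid_repr (x : B4) : braid (repr x) = x.
Proof. exact: reprK. Qed.

Definition B4_one : B4 := braid [::].
Definition B4_mul (x y : B4) : B4 := braid (repr x ++ repr y).
Definition B4_inv (x : B4) : B4 := braid (inv_word (repr x)).

Lemma B4_mulE u v : B4_mul (braid u) (braid v) = braid (u ++ v).
Proof. by apply/braidP/braid_cat; apply/braidP; rewrite braid_repr. Qed.

Lemma inv_wordK : involutive inv_word.
Proof.
move=> w; rewrite /inv_word map_rev revK -map_comp -[RHS]map_id.
by apply: eq_map => -[i b] /=; rewrite negbK.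
Qed.

Lemma braid_eq_mulVw w : braid_eq (inv_word w ++ w) [::].
Proof.
elim: w => [|[i b] w IH]; first exact: braid_refl.
rewrite /inv_word /= rev_cons cat_rcons -/(inv_word w).
apply: (braid_trans _ IH).
apply: braid_cat (braid_refl _) _; rewrite -[X in braid_eq _ X]cat0s.
rewrite -[(i, ~~ b) :: _]/([:: (i, ~~ b); (i, b)] ++ w).
apply: braid_cat (braid_refl _).
by rewrite -{2}[b]negbK; exact: braid_cancel.
Qed.

Lemma B4_mulA : associative B4_mul.
Proof.
move=> x y z; rewrite -(braid_repr x) -(braid_repr y) -(braid_repr z).
by rewrite !B4_mulE catA.
Qed.

Lemma B4_mul1 : left_id B4_one B4_mul.
Proof. by move=> x; rewrite -(braid_repr x) B4_mulE. Qed.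

Lemma B4_mulr1 : right_id B4_one B4_mul.
Proof. by move=> x; rewrite -(braid_repr x) B4_mulE cats0. Qed.

Lemma B4_mulV : left_inverse B4_one B4_inv B4_mul.
Proof.
move=> x; rewrite -{2}(braid_repr x) B4_mulE.
by apply/braidP; exact: braid_eq_mulVw.
Qed.

Lemma B4_mulrV : right_inverse B4_one B4_inv B4_mul.
Proof.
move=> x; rewrite -{1}(braid_repr x) B4_mulE.
by apply/braidP; rewrite -{1}(inv_wordK (repr x)); exact: braid_eq_mulVw.
Qed.

HB.instance Definition _ :=
  isGroup.Build B4 B4_mulA B4_mul1 B4_mulr1 B4_mulV B4_mulrV.

Definition sigma (i : 'I_3) : B4 := braid (gen_word i).

Definition Delta : B4 :=
  (sigma i1 * sigma i2 * sigma i3 * sigma i1 * sigma i2 * sigma i1)%g.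

Definition braid_a : B4 :=
  (sigma i1 * sigma i2 * (sigma i1)^-1 * sigma i3
   * (sigma i2)^-1 * (sigma i1)^-1)%g.

(** ** Universal property *)

Definition eval_letter (G : groupType) (g : 'I_3 -> G) (l : letter) : G :=
  if l.2 then ((g l.1)^-1)%g else g l.1.

Definition eval_word (G : groupType) (g : 'I_3 -> G) (w : word) : G :=
  (\prod_(l <- w) eval_letter g l)%g.

Definition braid_relations (G : groupType) (g : 'I_3 -> G) : Prop :=
  [/\ (g i1 * g i2 * g i1 = g i2 * g i1 * g i2)%g,
      (g i3 * g i2 * g i3 = g i2 * g i3 * g i2)%g
    & (g i3 * g i1 = g i1 * g i3)%g].

Lemma eval_word_eq (G : groupType) (g : 'I_3 -> G) :
  braid_relations g ->
  forall u v, braid_eq u v -> eval_word g u = eval_word g v.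
Proof.
move=> [r121 r323 r31] u v; rewrite /eval_word.
elim=> {u v} [//|u v _ -> //|v u w _ -> _ -> //|u u' v v' _ IHu _ IHv|i b|||].
- by rewrite !big_cat IHu IHv.
- rewrite !big_cons big_nil mulg1 /eval_letter /=.
  by case: b => /=; rewrite ?mulVg ?mulgV.
- by rewrite !big_cons !big_nil /= !mulg1 !mulgA.
- by rewrite !big_cons !big_nil /= !mulg1 !mulgA.
- by rewrite !big_cons !big_nil /= !mulg1.
Qed.

Definition braid_lift (G : groupType) (g : 'I_3 -> G) (x : B4) : G :=
  eval_word g (repr x).

Lemma braid_liftE (G : groupType) (g : 'I_3 -> G) :
  braid_relations g -> forall w, braid_lift g (braid w) = eval_word g w.
Proof.
by move=> rg w; apply: eval_word_eq => //; apply/braidP; rewrite braid_repr.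
Qed.

Lemma braid_lift_sigma (G : groupType) (g : 'I_3 -> G) :
  braid_relations g -> forall i, braid_lift g (sigma i) = g i.
Proof.
by move=> rg i; rewrite braid_liftE // /eval_word big_cons big_nil mulg1.
Qed.

Lemma braid_liftM (G : groupType) (g : 'I_3 -> G) :
  braid_relations g -> {morph braid_lift g : x y / (x * y)%g}.
Proof.
move=> rg x y; rewrite -(braid_repr x) -(braid_repr y).
rewrite -[X in braid_lift g X]/(B4_mul _ _) B4_mulE !braid_liftE //.
by rewrite /eval_word big_cat.
Qed.

(** ** Pure braids *)

Definition transposition (i : 'I_3) : {perm 'I_4} :=
  tperm (inord i) (inord i.+1).

Lemma transposition_relations : braid_relations transposition.
Proof.
have inordE k (lt_k4 : (k < 4)%N) : inord k = Ordinal lt_k4 :> 'I_4.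
  by apply/val_inj; rewrite /= inordK.
by split; apply/permP => x; rewrite /transposition /= !inordE !permM !permE /=;
  case: x => [[|[|[|[|//]]]]] ?; rewrite ?permE /= ?permE /=; apply/val_inj.
Qed.

Definition braid_perm : B4 -> {perm 'I_4} := braid_lift transposition.

Definition pure (x : B4) : Prop := braid_perm x = 1%g.

(** * Laurent polynomials over the integers *)

Notation ZtFrac := {fraction {poly int}}.
Notation tofracZt := (@FracField.tofrac {poly int}).

(* Z[t, t^-1] is built as the subring of fractions p / t^n of Frac Z[t]. *)
Definition is_laurent : {pred ZtFrac} := fun f =>
  `[< exists (n : nat) (p : {poly int}), f * tofracZt 'X ^+ n = tofracZt p >].

Lemma is_laurentP f :
  reflect (exists (n : nat) (p : {poly int}), f * tofracZt 'X ^+ n = tofracZt p)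
          (f \in is_laurent).
Proof. exact: asboolP. Qed.

Lemma is_laurent_subring : subring_closed is_laurent.
Proof.
split.
- by apply/is_laurentP; exists 0%N, 1; rewrite expr0 mulr1 tofrac1.
- move=> f g /is_laurentP[n [p fE]] /is_laurentP[m [q gE]].
  apply/is_laurentP; exists (n + m)%N, (p * 'X^m - q * 'X^n).
  rewrite tofracB !tofracM !tofracXn -fE -gE mulrBl exprD mulrA; congr (_ - _).
  by rewrite mulrA mulrAC.
- move=> f g /is_laurentP[n [p fE]] /is_laurentP[m [q gE]].
  apply/is_laurentP; exists (n + m)%N, (p * q).
  by rewrite tofracM -fE -gE exprD mulrACA.
Qed.

HB.instance Definition _ :=
  GRing.isSubringClosed.Build ZtFrac is_laurent is_laurent_subring.

Record laurent := Laurent { laurent_val :> ZtFrac; _ : laurent_val \in is_laurent }.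

HB.instance Definition _ := [isSub for laurent_val].
HB.instance Definition _ := [Choice of laurent by <:].
HB.instance Definition _ := [SubChoice_isSubComNzRing of laurent by <:].

Definition laurent_unit : {pred laurent} := fun f => `[< exists g, g * f = 1 >].

Definition laurent_inv (f : laurent) : laurent :=
  if pselect (exists g, g * f = 1) is left ex_inv
  then projT1 (cid ex_inv) else f.

Lemma laurent_mulVx : {in laurent_unit, left_inverse 1 laurent_inv *%R}.
Proof.
move=> f /asboolP ex_inv; rewrite /laurent_inv; case: pselect => // h.
exact: projT2 (cid h).
Qed.

Lemma laurent_unitPl f g : g * f = 1 -> laurent_unit f.
Proof. by move=> gf1; apply/asboolP; exists g. Qed.

Lemma laurent_invr_out : {in [predC laurent_unit], laurent_inv =1 id}.
Proof.
by move=> f /asboolPn no_inv; rewrite /laurent_inv; case: pselect.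
Qed.

HB.instance Definition _ := GRing.ComNzRing_hasMulInverse.Build laurent
  laurent_mulVx laurent_unitPl laurent_invr_out.

Lemma laurent_idomain : GRing.integral_domain_axiom laurent.
Proof.
move=> f g fg0; rewrite -!val_eqE /= -mulf_eq0.
by rewrite -[X in X == _](rmorphM val) fg0.
Qed.

HB.instance Definition _ :=
  GRing.ComUnitRing_isIntegral.Build laurent laurent_idomain.

Lemma poly_is_laurent (p : {poly int}) : tofracZt p \in is_laurent.
Proof. by apply/is_laurentP; exists 0%N, p; rewrite expr0 mulr1. Qed.

Definition laurent_poly (p : {poly int}) : laurent := Laurent (poly_is_laurent p).

Definition laurent_t : laurent := laurent_poly 'X.

Lemma laurent_poly_eq0 p : (laurent_poly p == 0) = (p == 0).
Proof. by rewrite -val_eqE /= tofrac_eq0. Qed.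

Lemma laurent_polyM : {morph laurent_poly : p q / p * q}.
Proof. by move=> p q; apply/val_inj; rewrite rmorphM /= tofracM. Qed.

Lemma laurent_polyXn n : laurent_poly 'X^n = laurent_t ^+ n.
Proof. by apply/val_inj; rewrite rmorphXn /= tofracXn. Qed.

Lemma laurent_poly_inj : injective laurent_poly.
Proof. by move=> p q /(congr1 val) /= /eqP; rewrite tofrac_eq => /eqP. Qed.

Lemma tofracX_neq0 : tofracZt 'X != 0.
Proof. by rewrite tofrac_eq0 polyX_eq0. Qed.

Lemma laurent_t_unit : laurent_t \is a GRing.unit.
Proof.
have inv_laurent : (tofracZt 'X)^-1 \in is_laurent.
  apply/is_laurentP; exists 1%N, 1.
  by rewrite expr1 tofrac1 mulVf // tofracX_neq0.
apply: (@laurent_unitPl _ (Laurent inv_laurent)).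
by apply/val_inj; rewrite rmorphM rmorph1 /= mulVf // tofracX_neq0.
Qed.

Lemma laurent_t_neq0 : laurent_t != 0.
Proof. by rewrite laurent_poly_eq0 polyX_eq0. Qed.

(* The lowest exponent occurring in a non-zero f is the d such that
   f = t^d p(t) with p a polynomial and p(0) <> 0; the value at f = 0 is the
   junk value 0. *)
Definition deg_min (f : laurent) : int :=
  xget 0 [set d : int | exists p : {poly int},
                          p`_0 != 0 /\ f = laurent_t ^ d * laurent_poly p].

Lemma deg_min_unique (p q : {poly int}) (d e : int) :
  p`_0 != 0 -> q`_0 != 0 ->
  laurent_t ^ d * laurent_poly p = laurent_t ^ e * laurent_poly q -> d = e.
Proof.
wlog le_de : p q d e / d <= e => [wlog_de p0 q0 pq|p0 q0].
  have [le_de|/ltW le_ed] := leP d e; first exact: (wlog_de p q).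
  exact/esym/(wlog_de q p).
rewrite -[e](subrK d) addrC exprzDr ?laurent_t_unit // -mulrA.
have -> : e - d = `|e - d|%N :> int by rewrite gez0_abs // subr_ge0.
rewrite -exprnP -laurent_polyXn -laurent_polyM.
move=> /(mulrI (unitrXz d laurent_t_unit)) /laurent_poly_inj pE.
move: p0; rewrite pE coefXnM; case: (`|e - d|%N) => [|k]; last by rewrite eqxx.
by rewrite addr0.
Qed.

Lemma deg_minE (p : {poly int}) (d : int) :
  p`_0 != 0 -> deg_min (laurent_t ^ d * laurent_poly p) = d.
Proof.
move=> p0; rewrite /deg_min; case: xgetP => [e _ [q [q0]]|/(_ d)[]].
  by move=> /(deg_min_unique p0 q0).
by exists p.
Qed.

(** * The reduced Burau representation *)


Record GL3 := GL3_of { GL3_val :> 'M[laurent]_3; _ : GL3_val \in unitmx }.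

HB.instance Definition _ := [isSub for GL3_val].
HB.instance Definition _ := [Choice of GL3 by <:].

Lemma GL3_unit (A : GL3) : GL3_val A \in unitmx.
Proof. exact: valP. Qed.

Lemma GL3_mul_proof (A B : GL3) : GL3_val A *m GL3_val B \in unitmx.
Proof. by rewrite unitmx_mul !GL3_unit. Qed.

Lemma GL3_inv_proof (A : GL3) : invmx (GL3_val A) \in unitmx.
Proof. by rewrite unitmx_inv GL3_unit. Qed.

Definition GL3_one : GL3 := GL3_of (unitmx1 laurent 3).
Definition GL3_mul (A B : GL3) : GL3 := GL3_of (GL3_mul_proof A B).
Definition GL3_inv (A : GL3) : GL3 := GL3_of (GL3_inv_proof A).

Lemma GL3_mulA : associative GL3_mul.
Proof. by move=> A B C; apply/val_inj; rewrite /= mulmxA. Qed.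

Lemma GL3_mul1 : left_id GL3_one GL3_mul.
Proof. by move=> A; apply/val_inj; rewrite /= mul1mx. Qed.

Lemma GL3_mulr1 : right_id GL3_one GL3_mul.
Proof. by move=> A; apply/val_inj; rewrite /= mulmx1. Qed.

Lemma GL3_mulV : left_inverse GL3_one GL3_inv GL3_mul.
Proof. by move=> A; apply/val_inj; rewrite /= mulVmx ?GL3_unit. Qed.

Lemma GL3_mulrV : right_inverse GL3_one GL3_inv GL3_mul.
Proof. by move=> A; apply/val_inj; rewrite /= mulmxV ?GL3_unit. Qed.

HB.instance Definition _ :=
  isGroup.Build GL3 GL3_mulA GL3_mul1 GL3_mulr1 GL3_mulV GL3_mulrV.

Definition mx3 (K : nmodType) (rows : seq (seq K)) : 'M[K]_3 :=
  \matrix_(i, j) (nth [::] rows i)`_j.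

Local Notation t := laurent_t.

Definition burau_mx (i : 'I_3) : 'M[laurent]_3 :=
  match val i with
  | 0 => mx3 [:: [:: - t^-1; 0; 0];
                 [::   t^-1; 1; 0];
                 [::      0; 0; 1]]
  | 1 => mx3 [:: [:: 1;      1; 0];
                 [:: 0; - t^-1; 0];
                 [:: 0;   t^-1; 1]]
  | _ => mx3 [:: [:: 1; 0;      0];
                 [:: 0; 1;      1];
                 [:: 0; 0; - t^-1]]
  end.

Lemma mx3M (K : pzRingType) (a b c d e f g h k a' b' c' d' e' f' g' h' k' : K) :
  mx3 [:: [:: a; b; c]; [:: d; e; f]; [:: g; h; k]] *m
  mx3 [:: [:: a'; b'; c']; [:: d'; e'; f']; [:: g'; h'; k']] =
  mx3 [:: [:: a * a' + b * d' + c * g'; a * b' + b * e' + c * h';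
              a * c' + b * f' + c * k'];
          [:: d * a' + e * d' + f * g'; d * b' + e * e' + f * h';
              d * c' + e * f' + f * k'];
          [:: g * a' + h * d' + k * g'; g * b' + h * e' + k * h';
              g * c' + h * f' + k * k']].
Proof.
apply/matrixP => -[[|[|[|//]]] ?] [[|[|[|//]]] ?];
  by rewrite !(mxE, big_ord_recl, big_ord0) /= addr0 addrA.
Qed.

Lemma mx3_1 (K : pzRingType) :
  1%:M = mx3 [:: [:: 1; 0; 0]; [:: 0; 1; 0]; [:: 0; 0; 1]] :> 'M[K]_3.
Proof.
by apply/matrixP => -[[|[|[|//]]] ?] [[|[|[|//]]] ?]; rewrite !mxE.
Qed.

Lemma burau_mx_unit i : burau_mx i \in unitmx.
Proof.
have tV : t * t^-1 = 1 by rewrite divrr ?laurent_t_unit.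
have Vt : t^-1 * t = 1 by rewrite mulrC.
pose B : 'M[laurent]_3 := match val i with
  | 0 => mx3 [:: [:: - t; 0; 0]; [:: 1; 1; 0]; [:: 0; 0; 1]]
  | 1 => mx3 [:: [:: 1; t; 0]; [:: 0; - t; 0]; [:: 0; 1; 1]]
  | _ => mx3 [:: [:: 1; 0; 0]; [:: 0; 1; t]; [:: 0; 0; - t]]
  end.
suff /mulmx1_unit[] : burau_mx i *m B = 1%:M by [].
rewrite /B /burau_mx mx3_1 {B}; case: i => [[|[|[|//]]] ?] /=;
  rewrite mx3M !(mul0r, mulr0, mul1r, mulr1, add0r, addr0, mulNr, mulrN);
  by rewrite ?opprK ?Vt ?(addrN, addNr).
Qed.

Definition burau_gen (i : 'I_3) : GL3 := GL3_of (burau_mx_unit i).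

Lemma burau_relations : braid_relations burau_gen.
Proof.
have mx3_relations (K : comPzRingType) (s : K) :
    let A := mx3 [:: [:: - s; 0; 0]; [:: s; 1; 0]; [:: 0; 0; 1]] in
    let B := mx3 [:: [:: 1; 1; 0]; [:: 0; - s; 0]; [:: 0; s; 1]] in
    let C := mx3 [:: [:: 1; 0; 0]; [:: 0; 1; 1]; [:: 0; 0; - s]] in
    [/\ A *m B *m A = B *m A *m B, C *m B *m C = B *m C *m B
      & C *m A = A *m C].
  split; rewrite !mx3M;
    rewrite !(mul0r, mulr0, mul1r, mulr1, add0r, addr0, mulNr, mulrN);
    by rewrite ?(subrK, opprK, mul0r, add0r, addr0, subr0, addNr, subrr).
by have [? ? ?] := mx3_relations _ t^-1; split; apply/val_inj.
Qed.

Definition rho : B4 -> GL3 := braid_lift burau_gen.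

Lemma rhoM : {morph rho : x y / (x * y)%g}.
Proof. exact/braid_liftM/burau_relations. Qed.

Lemma rho_sigma i : rho (sigma i) = burau_gen i.
Proof. exact/braid_lift_sigma/burau_relations. Qed.

(** * The four-punctured disc *)

Section PuncturedDisc.
Variable R : realType.
Implicit Types (z : R * R) (f g : R * R -> R * R) (A B : set (R * R)).

Definition disc : set (R * R) := [set z | z.1 ^+ 2 + z.2 ^+ 2 <= 1].
Definition disc_boundary : set (R * R) := [set z | z.1 ^+ 2 + z.2 ^+ 2 = 1].

Definition p1 : R * R := (- 2^-1, 2^-1).
Definition p2 : R * R := (2^-1, 2^-1).
Definition p3 : R * R := (2^-1, - 2^-1).
Definition p4 : R * R := (- 2^-1, - 2^-1).
Definition punctures : set (R * R) := [set p1; p2; p3; p4].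

Definition segment (a b : R * R) : set (R * R) :=
  [set ((1 - s) * a.1 + s * b.1, (1 - s) * a.2 + s * b.2) | s in `[0, 1]].

Definition T4 : set (R * R) := segment p4 p1.

(* The rotation by the angle [pi * e * w] about [c], written in the coordinates
   u = a (x - c.1), v = b (y - c.2), where w = 1 for u^2 + v^2 <= 1/4, w = 0 for
   u^2 + v^2 >= 1/2, and w is affine in u^2 + v^2 in between. *)
Definition elliptic_twist (c : R * R) (a b e : R) (z : R * R) : R * R :=
  let u := a * (z.1 - c.1) in
  let v := b * (z.2 - c.2) in
  let w := Num.min 1 (Num.max 0 (2 - 4 * (u ^+ 2 + v ^+ 2))) in
  let th := pi * e * w in
  (c.1 + (cos th * u - sin th * v) / a, c.2 + (sin th * u + cos th * v) / b).

(* The half twist along T_i (counterclockwise for [e = 1], clockwise for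
   [e = -1]), where T_1, T_2, T_3 are the top, right and bottom sides of the
   square of punctures.  Its support is the elliptic disc u^2 + v^2 <= 1/2
   centred at the midpoint of T_i, whose half-axis orthogonal to T_i is halved:
   it lies in the interior of the unit disc and contains no other puncture,
   and T_i is the diameter u^2 <= 1/4, v = 0 (for T_2, u = 0, v^2 <= 1/4). *)
Definition half_twist (i : 'I_3) (e : R) : R * R -> R * R :=
  match val i with
  | 0 => elliptic_twist (0, 2^-1) 1 2 e
  | 1 => elliptic_twist (2^-1, 0) 2 1 e
  | _ => elliptic_twist (0, - 2^-1) 1 2 e
  end.

Definition letter_map (l : letter) : R * R -> R * R :=
  half_twist l.1 (if l.2 then -1 else 1).

(* Braids act on the right: the first letter of a word is applied first. *)
Definition word_map (w : word) (z : R * R) : R * R :=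
  foldl (fun y l => letter_map l y) z w.

(* Homeomorphisms of the pair (disc, punctures) fixing the boundary pointwise;
   a continuous bijection of the compact disc has a continuous inverse, and
   fixing the boundary forces f to preserve the orientation.  Only the values
   of f on the disc are relevant. *)
Definition disc_homeo f : Prop :=
  [/\ set_bij disc disc f, {within disc, continuous f},
      (forall z, disc_boundary z -> f z = z) & f @` punctures = punctures].

Definition isotopic_homeo f g : Prop :=
  exists F : R * (R * R) -> R * R,
    [/\ {within `[0, 1] `*` disc, continuous F},
        (forall s, `[0, 1]%classic s -> disc_homeo (fun z => F (s, z))),
        (forall z, disc z -> F (0, z) = f z)
      & (forall z, disc z -> F (1, z) = g z)].

(* [f] belongs to the isotopy class that the braid [x] is identified with. *)
Definition mapping_class (x : B4) f : Prop :=
  exists2 w : word, braid w = x & isotopic_homeo (word_map w) f.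

Definition is_arc (c : R -> R * R) : Prop :=
  [/\ {within `[0, 1], continuous c}, set_inj `[0, 1] c,
      (forall s, `[0, 1]%classic s -> disc (c s))
    & (forall s, `[0, 1]%classic s -> punctures (c s) <-> s = 0 \/ s = 1)].

(* The end points of the arcs H (s, -) do not depend on s, since H is
   continuous and the set of punctures is discrete. *)
Definition isotopic_arcs A B : Prop :=
  exists H : R * R -> R * R,
    [/\ {within `[0, 1] `*` `[0, 1], continuous H},
        (forall s, `[0, 1]%classic s -> is_arc (fun r => H (s, r))),
        (fun r => H (0, r)) @` `[0, 1] = A
      & (fun r => H (1, r)) @` `[0, 1] = B].

Definition acts_nontrivially_on_T4 (x : B4) : Prop :=
  forall f, mapping_class x f -> ~ isotopic_arcs (f @` T4) T4.

End PuncturedDisc.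

Arguments acts_nontrivially_on_T4 : clear implicits.

(* Main.v *)
Require Import Defs.
From HB Require Import structures.
From mathcomp Require Import all_boot all_order all_algebra all_fingroup.
From mathcomp Require Import all_classical all_reals all_analysis.
From mathcomp Require Import ring lra zify.
Set Implicit Arguments.
Unset Strict Implicit.
Unset Printing Implicit Defensive.
Import Order.TTheory GRing.Theory Num.Theory.
Import numFieldNormedType.Exports.
Local Open Scope ring_scope.

(** Let [x] be a non-trivial element of the kernel of rho.  All conjugates [y]
of [x] lie in the kernel, hence are pure (specialize t to 1) and, by the
determinant, are not powers of Delta; if [y] moved T4, the hypothesis with
m = l would make an off-diagonal entry of rho (1) non-zero.  So every conjugate
of [x] fixes T4 and therefore commutes with the half twist along T4; as the
conjugates of this half twist generate B_4, [x] is central.  Now B_4 is the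
product of a normal free subgroup of rank 2, on which rho has determinant 1,
and of the copy of B_3 generated by sigma_1 and sigma_2.  If [x = f b] is
central, then [b] acts trivially on the abelianization of the free subgroup, so
[b] is a power of the full twist of B_3; the determinant gives [b = 1], and then
[f] is central in a free group, so [f = 1].

That a braid fixing T4 commutes with its half twist is proved with a holonomy:
a path of configurations of four points in the plane is assigned the braid that
records how the points, listed by increasing abscissa, exchange their places.
It is invariant under homotopies of paths, and a homeomorphism in the class of
a braid conjugates holonomies by this braid.  If an isotopy brings the image of
T4 back to T4, the point p1 can be pushed along T4 to a neighbourhood of p4,
where the only possible holonomies are powers of the half twist. *)

(** * Free groups *)

(** The obstacle is to pass from isotopies of the disc, which the hypothesis speaks of, to words in
    generators. This is done by an invariant with values in B_4: a cocycle defined on pairs of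
    neighbouring configurations and integrated along paths. The delicate point is a pair of points
    on a common vertical line, which occurs already among the punctures; an order in a tilted
    direction then decides which point passes below the other. From left to right, with ties broken
    by ordinate, p4 and p1 come first, so in terms of holonomies the half twist along T4 is sigma_1.
    The passage back to the given generators is conjugation by [position_braid]: the half twist
    sigma_1 sigma_2 sigma_3 sigma_2^-1 sigma_1^-1 along T4 equals [position_braid^-1 * sigma i1 *
    position_braid]. On the algebraic side, freeness of the normal subgroup is not read off a
    presentation. B_4 is first made to act on an abstract free group by explicit automorphisms, and
    the embedding of this free group into B_4 is then seen to be injective because the group has
    trivial centre. *)

Section FreeGroup.
Variable A : choiceType.
Implicit Types (l m : A * bool) (w v : seq (A * bool)).

Definition inv_letter l := (l.1, ~~ l.2).

Lemma inv_letterK : involutive inv_letter.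
Proof. by case=> a b; rewrite /inv_letter /= negbK. Qed.

Definition reduced w := sorted (fun l m => m != inv_letter l) w.

Record free_group := FreeGroup { free_word :> seq (A * bool); _ : reduced free_word }.

HB.instance Definition _ := [isSub for free_word].
HB.instance Definition _ := [Choice of free_group by <:].

(** Left multiplication by one letter. Every letter acts bijectively on the reduced words and a
    product is an iterated push (van der Waerden's construction), so associativity comes down to
    [foldr_push] and no confluence argument arises. *)
Definition push l w :=
  if w is m :: w' then if m == inv_letter l then w' else l :: w else [:: l].

Lemma push_reduced l w : reduced w -> reduced (push l w).
Proof.
case: w => [//|m w] /= mw; case: ifP => [_|/negbT ml].
  exact: path_sorted mw.
by rewrite /= ml.
Qed.

Lemma pushK l w : reduced w -> push (inv_letter l) (push l w) = w.
Proof.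
case: w => [|m w] /= mw; first by rewrite inv_letterK eqxx.
case: eqP => [ml|_ /=]; last by rewrite inv_letterK eqxx.
rewrite -{}ml; case: w mw => [//|n w] /= /andP[nm _].
by rewrite (negbTE nm).
Qed.

Lemma pushVK l w : reduced w -> push l (push (inv_letter l) w) = w.
Proof. by rewrite -{1}[l]inv_letterK; exact: pushK. Qed.

Lemma foldr_push_reduced w v : reduced w -> reduced (foldr push w v).
Proof. by move=> rw; elim: v => //= l v; exact: push_reduced. Qed.

Lemma foldr_push l w v : reduced w ->
  foldr push w (push l v) = push l (foldr push w v).
Proof.
move=> rw; case: v => [//|m v] /=; case: eqP => [->|//].
by rewrite pushVK ?foldr_push_reduced.
Qed.

Lemma foldr_push_id w : reduced w -> foldr push [::] w = w.
Proof.
elim: w => //= l w IH lw; have rw : reduced w := path_sorted lw.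
rewrite IH //; by case: w lw {IH rw} => //= m w /andP[/negbTE->].
Qed.

Definition free_one := @FreeGroup [::] isT.
Definition free_mul (x y : free_group) : free_group :=
  FreeGroup (foldr_push_reduced x (valP y)).
Definition free_inv_word w := rev (map inv_letter w).

Lemma free_inv_reduced (x : free_group) : reduced (free_inv_word x).
Proof.
rewrite /reduced rev_sorted sorted_map; apply: sub_sorted (valP x) => l m /=.
by rewrite inv_letterK; apply: contraNneq => ->.
Qed.

Definition free_inv (x : free_group) : free_group := FreeGroup (free_inv_reduced x).

Lemma free_mulA : associative free_mul.
Proof.
move=> x y z; apply/val_inj => /=.
have rz := valP z; elim: (free_word x) => //= l v ->.
by rewrite foldr_push.
Qed.

Lemma free_mul1 : left_id free_one free_mul.
Proof. by move=> x; apply/val_inj. Qed.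

Lemma free_mulr1 : right_id free_one free_mul.
Proof. by move=> x; apply/val_inj/foldr_push_id/valP. Qed.

Lemma foldr_pushV w v : reduced w ->
  foldr push (foldr push w v) (free_inv_word v) = w.
Proof.
elim: v w => //= l v IH w rw; rewrite /free_inv_word /= rev_cons foldr_rcons.
by rewrite pushK ?foldr_push_reduced ?IH.
Qed.

Lemma free_mulV : left_inverse free_one free_inv free_mul.
Proof.
move=> x; apply/val_inj => /=.
by have := @foldr_pushV [::] x isT; rewrite foldr_push_id ?(valP x).
Qed.

Lemma free_inv_wordK : involutive free_inv_word.
Proof.
by move=> w; rewrite /free_inv_word map_rev revK -map_comp map_id_in // => l _ /=;
  rewrite inv_letterK.
Qed.

Lemma free_mulrV : right_inverse free_one free_inv free_mul.
Proof.
move=> x; have := free_mulV (free_inv x).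
by congr (free_mul _ _ = _); apply/val_inj; rewrite /= free_inv_wordK.
Qed.

HB.instance Definition _ :=
  isGroup.Build free_group free_mulA free_mul1 free_mulr1 free_mulV free_mulrV.

Definition free_gen (a : A) : free_group := @FreeGroup [:: (a, false)] isT.

Section Lift.
Variables (G : groupType) (g : A -> G).

Definition free_lift (x : free_group) : G :=
  (\prod_(l <- free_word x) (if l.2 then (g l.1)^-1 else g l.1))%g.

Lemma free_lift_gen a : free_lift (free_gen a) = g a.
Proof. by rewrite /free_lift /= big_seq1. Qed.

Lemma free_liftM : {morph free_lift : x y / (x * y)%g}.
Proof.
move=> x y; rewrite /free_lift /=; elim: (free_word x) => [|l w IH] /=.
  by rewrite big_nil mul1g.
rewrite big_cons -mulgA -{}IH /=; case: foldr => [|m v] /=.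
  by rewrite big_seq1 big_nil mulg1.
case: eqP => [->|_]; last by rewrite !big_cons.
rewrite big_cons mulgA; case: l => a [] /=; by rewrite ?mulVg ?mulgV mul1g.
Qed.

End Lift.

Lemma free_ind (P : free_group -> Prop) :
  P 1%g -> (forall a x, P x -> P (free_gen a * x)%g) ->
  (forall a x, P x -> P ((free_gen a)^-1 * x)%g) -> forall x, P x.
Proof.
move=> P1 PM PV x; suff: forall w (rw : reduced w), P (FreeGroup rw).
  by case: x => w rw; apply.
elim=> [|[a b] w IH] rw.
  by rewrite (_ : FreeGroup rw = 1%g) //; exact/val_inj.
have rw' : reduced w by exact: path_sorted rw.
have pushE : push (a, b) w = (a, b) :: w.
  by case: w rw {IH rw'} => //= m w /andP[/negbTE->].
case: b rw pushE => rw pushE.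
  rewrite (_ : FreeGroup rw = ((free_gen a)^-1 * FreeGroup rw')%g); first exact/PV/IH.
  exact/val_inj.
rewrite (_ : FreeGroup rw = (free_gen a * FreeGroup rw')%g); first exact/PM/IH.
exact/val_inj.
Qed.

End FreeGroup.

Lemma morphV (G H : groupType) (f : G -> H) :
  {morph f : x y / (x * y)%g} -> {morph f : x / (x^-1)%g}.
Proof.
move=> fM x; have f1 : f 1%g = 1%g by apply: (mulgI (f 1%g)); rewrite -fM !mulg1.
by apply: (mulgI (f x)); rewrite -fM !mulgV.
Qed.

Lemma free_ext (A : choiceType) (G : groupType) (f g : free_group A -> G) :
  {morph f : x y / (x * y)%g} -> {morph g : x y / (x * y)%g} ->
  (forall a, f (free_gen a) = g (free_gen a)) -> f =1 g.
Proof.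
move=> fM gM fg; apply: free_ind => [|a x IH|a x IH].
- by rewrite -[1%g](mulgV (1%g : free_group A)) fM gM !(morphV fM, morphV gM) !mulgV.
- by rewrite fM gM fg IH.
- by rewrite fM gM (morphV fM) (morphV gM) fg IH.
Qed.

(* If [x] starts with the letter [a^±1], then [b x] is reduced while [x b]
   starts with [a^±1] or is shorter. *)
Lemma free_center (A : choiceType) (a b : A) (x : free_group A) : a != b ->
  (forall c, x * free_gen c = free_gen c * x)%g -> x = 1%g.
Proof.
move=> ab xC; apply/val_inj => /=.
have rx : reduced (free_word x) := valP x.
case wE: (free_word x) rx => [//|[c s] w] rx.
have [d dc] : exists d, d != c.
  by have [<-|ca] := eqVneq a c; [exists b; rewrite eq_sym|exists a].
have := congr1 (fun y : free_group A => (y : seq _)) (xC d).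
have bE y : (free_gen d * y)%g = push (d, false) y :> seq _ by [].
rewrite bE /= wE /= {bE xC wE}.
have -> : ((c, s) == inv_letter (d, false)) = false.
  by apply/negbTE; apply: contra dc => /eqP[->].
have size_push (l : A * bool) v : (size (push l v) <= (size v).+1)%N.
  by case: v => //= m v; case: ifP => //= _; lia.
(* Right multiplication by [d] either cancels a letter or appends one. Compared with [d x], which is
   one letter longer than [x] and starts with [d], the first case contradicts the length and the
   second the initial letter. *)
have E u : reduced u -> (size (foldr (@push A) [:: (d, false)] u) < size u)%N \/
    foldr (@push A) [:: (d, false)] u = rcons u (d, false).
  elim: u => [|l [|m v] IH] ru; first by right.
    by rewrite /= ; case: ifP => _; [left|right].
  have [lt_v|eq_v] := IH (path_sorted ru); [left|right].
    rewrite -[foldr _ _ _]/(push l (foldr (@push A) [:: (d, false)] (m :: v))).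
    exact: leq_ltn_trans (size_push _ _) _.
  rewrite -[LHS]/(push l (foldr (@push A) [:: (d, false)] (m :: v))) eq_v /=.
  by case/andP: ru => /negbTE->.
move=> eq_w; have [] := E _ rx; rewrite /= eq_w /=; first by lia.
by case=> cd _; rewrite cd eqxx in dc.
Qed.

(** * Computing in B_4 *)

Lemma braid_cat_mul u v : braid (u ++ v) = (braid u * braid v)%g.
Proof. by rewrite -[RHS]/(B4_mul _ _) B4_mulE. Qed.

Lemma braid_letter i b :
  braid [:: (i, b)] = if b then ((sigma i)^-1)%g else sigma i.
Proof.
case: b => //; symmetry; apply: mulg1_eq; rewrite -braid_cat_mul.
exact/braidP/braid_cancel.
Qed.

Lemma braid_cons i b w :
  braid ((i, b) :: w) = ((if b then ((sigma i)^-1)%g else sigma i) * braid w)%g.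
Proof. by rewrite -cat1s braid_cat_mul braid_letter. Qed.

Lemma sigma_relations : braid_relations sigma.
Proof.
by split; [have := braid_121|have := braid_323|have := braid_31];
  move/braidP; rewrite !braid_cat_mul ?mulgA.
Qed.

Lemma braid_ind (P : B4 -> Prop) : P 1%g ->
  (forall i x, P x -> P (x * sigma i)%g) ->
  (forall i x, P x -> P (x * (sigma i)^-1)%g) -> forall x, P x.
Proof.
move=> P1 PM PV x; rewrite -(braid_repr x); elim/last_ind: (generic_quotient.repr x) => //.
move=> w [i b] IH; rewrite -cats1 braid_cat_mul braid_letter.
by case: b; [exact: PV|exact: PM].
Qed.

Lemma braidV w : braid (inv_word w) = ((braid w)^-1)%g.
Proof.
symmetry; apply: mulg1_eq; transitivity (braid (w ++ inv_word w)).
  by rewrite braid_cat_mul.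
by apply/braidP; rewrite -{1}(inv_wordK w); exact: braid_eq_mulVw.
Qed.

Lemma sigmaE i : sigma i = braid [:: (i, false)].
Proof. by []. Qed.

Lemma ord3P (i : 'I_3) : [\/ i = i1, i = i2 | i = i3].
Proof.
by case: i => [[|[|[|//]]] ?]; [constructor 1|constructor 2|constructor 3]; exact/val_inj.
Qed.

(** The rules never lengthen a word, so a search with them stays finite; in particular inverse pairs
    are cancelled but not inserted. The mixed-sign forms of the braid relation stand in for such
    insertions. *)
Definition braid_pair_rules (i j : 'I_3) : seq (word * word) :=
  [seq ([:: (i, b); (j, b); (i, b)], [:: (j, b); (i, b); (j, b)]) | b <- [:: true; false]] ++
  [seq ([:: (i, false); (j, b); (i, true)], [:: (j, true); (i, b); (j, false)]) | b <- [:: true;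
    false]] ++
  [seq ([:: (j, true); (i, b); (j, false)], [:: (i, false); (j, b); (i, true)]) | b <- [:: true;
    false]].

Definition commutation_rules (i j : 'I_3) : seq (word * word) :=
  [seq ([:: (i, b); (j, b')], [:: (j, b'); (i, b)]) | b <- [:: true; false], b' <- [:: true;
    false]].

Definition braid_rules : seq (word * word) :=
  braid_pair_rules i1 i2 ++ braid_pair_rules i2 i1 ++
  braid_pair_rules i2 i3 ++ braid_pair_rules i3 i2 ++
  commutation_rules i1 i3 ++ commutation_rules i3 i1 ++
  [seq ([:: (i, b); (i, ~~ b)], [::]) | i <- [:: i1; i2; i3], b <- [:: true; false]].

Definition sound_rules (R : seq (word * word)) : Prop :=
  forall r, r \in R -> braid r.1 = braid r.2.

Lemma sound_rules_cat R S : sound_rules R -> sound_rules S -> sound_rules (R ++ S).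
Proof. by move=> sR sS r; rewrite mem_cat => /orP[/sR|/sS]. Qed.

Definition head_rewrites (p q w : word) : seq word :=
  if take (size p) w == p then [:: q ++ drop (size p) w] else [::].

Fixpoint rewrites (p q w : word) : seq word :=
  head_rewrites p q w ++
  (if w is l :: w' then map (cons l) (rewrites p q w') else [::]).

Definition expand (ws : seq word) : seq word :=
  undup (ws ++ flatten [seq rewrites r.1 r.2 w | w <- ws, r <- braid_rules]).

(** A breadth-first search from both ends for a common word. It serves only as a certificate of
    equality: a failed search proves nothing. *)
Definition braid_check (n : nat) (u v : word) : bool :=
  has [in iter n expand [:: u]] (iter n expand [:: v]).

Lemma braid_pair_rules_sound i j : (sigma i * sigma j * sigma i = sigma j * sigma i * sigma j)%g ->
  sound_rules (braid_pair_rules i j).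
Proof.
move=> ij r; rewrite !inE ?orbF .
have nil1 : braid [::] = 1%g by [].
have ji : ((sigma j)^-1 * sigma i * sigma j = sigma i * sigma j * (sigma i)^-1)%g.
  by apply: (mulIg (sigma i)); rewrite !gnorm; apply: (mulgI (sigma j)); rewrite !gnorm ij.
have ji' : ((sigma j)^-1 * (sigma i)^-1 * sigma j = sigma i * (sigma j)^-1 * (sigma i)^-1)%g.
  by apply: invg_inj; rewrite !gnorm.
do ?case/orP; move/eqP=> -> /=; rewrite !braid_cons nil1 !mulg1 ?mulgA //.
by apply: (@invg_inj B4); rewrite !invgM !invgK !mulgA.
Qed.

Lemma commutation_rules_sound i j : (sigma i * sigma j = sigma j * sigma i)%g ->
  sound_rules (commutation_rules i j).
Proof.
move=> ij r; rewrite !inE ?orbF .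
have nil1 : braid [::] = 1%g by [].
have cij : commute (sigma i) (sigma j) by [].
have cji := commute_sym cij.
by do ?case/orP; move/eqP=> -> /=; rewrite !braid_cons nil1 !mulg1;
  [exact/commuteV/commute_sym/commuteV|exact/commute_sym/commuteV|exact: commuteV|exact: cij].
Qed.

Lemma braid_rules_sound : sound_rules braid_rules.
Proof.
have [r121 r323 r31] := sigma_relations.
apply: sound_rules_cat; first exact: braid_pair_rules_sound r121.
apply: sound_rules_cat; first exact: braid_pair_rules_sound (esym r121).
apply: sound_rules_cat; first exact: braid_pair_rules_sound (esym r323).
apply: sound_rules_cat; first exact: braid_pair_rules_sound r323.
apply: sound_rules_cat; first exact: commutation_rules_sound (esym r31).
apply: sound_rules_cat; first exact: commutation_rules_sound r31.
by move=> r /allpairsP[[i b] [_ _ ->]] /=; exact/braidP/braid_cancel.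
Qed.

Lemma rewrites_sound p q w v :
  braid p = braid q -> v \in rewrites p q w -> braid v = braid w.
Proof.
move=> pq; have here v' w' : v' \in head_rewrites p q w' -> braid v' = braid w'.
  rewrite /head_rewrites; case: eqP => // pE; rewrite inE => /eqP ->.
  by rewrite -[in RHS](cat_take_drop (size p) w') pE !braid_cat_mul pq.
elim: w v => [|l w IH] v; rewrite [rewrites _ _ _]/= mem_cat => /orP[/here //|] //.
case/mapP => v' /IH v'w ->.
by rewrite -cat1s -[in RHS]cat1s !braid_cat_mul v'w.
Qed.

Lemma braid_checkP n u v : braid_check n u v -> braid u = braid v.
Proof.
have sound w : {in iter n expand [:: w], forall w', braid w' = braid w}.
  elim: n => [|n IH] w' /=; first by rewrite inE => /eqP->.
  rewrite mem_undup mem_cat => /orP[/IH //|/flattenP[ws /allpairsP[[w2 r] /= [w2in rin ->]]]].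
  by move/(rewrites_sound (braid_rules_sound rin)) => ->; exact: IH.
by case/hasP => w /sound wv /sound <-.
Qed.

(** * Words acting on a set *)

Section WordAction.
Variables (T : Type) (f : letter -> T -> T).

Definition word_act (w : word) (t : T) : T := foldr f t w.

Lemma word_act_cons l w t : word_act (l :: w) t = f l (word_act w t).
Proof. by []. Qed.

Lemma word_act_cat u v t : word_act (u ++ v) t = word_act u (word_act v t).
Proof. exact: foldr_cat. Qed.

Definition braid_action : Prop :=
  [/\ forall i b t, f (i, b) (f (i, ~~ b) t) = t,
      forall t, word_act [:: (i1, false); (i2, false); (i1, false)] t =
        word_act [:: (i2, false); (i1, false); (i2, false)] t,
      forall t, word_act [:: (i3, false); (i2, false); (i3, false)] t =
        word_act [:: (i2, false); (i3, false); (i2, false)] t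
    & forall t, word_act [:: (i3, false); (i1, false)] t =
        word_act [:: (i1, false); (i3, false)] t].

Hypothesis f_action : braid_action.

Lemma word_act_eq u v : braid_eq u v -> word_act u =1 word_act v.
Proof.
have [fV f121 f323 f31] := f_action.
elim=> {u v} [//|u v _ uv|u v w _ uv _ vw|u u' v v' _ uu _ vv|i b|||] t.
- by rewrite uv.
- by rewrite uv.
- by rewrite !word_act_cat uu vv.
- exact: fV.
- exact: f121.
- exact: f323.
- exact: f31.
Qed.

Definition braid_act (x : B4) : T -> T := word_act (generic_quotient.repr x).

Lemma braid_actE w t : braid_act (braid w) t = word_act w t.
Proof. by apply: word_act_eq; apply/braidP; rewrite braid_repr. Qed.

Lemma braid_actM x y t : braid_act (x * y)%g t = braid_act x (braid_act y t).
Proof.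
rewrite -{1}(braid_repr x) -{1}(braid_repr y).
by rewrite -(braid_cat_mul (generic_quotient.repr x)) braid_actE word_act_cat.
Qed.

Lemma braid_act1 t : braid_act 1%g t = t.
Proof. exact: braid_actE. Qed.

Lemma braid_act_sigma i t : braid_act (sigma i) t = f (i, false) t.
Proof. exact: braid_actE. Qed.

Lemma braid_act_sigmaV i t : braid_act (sigma i)^-1%g t = f (i, true) t.
Proof. by rewrite -(braid_letter i true) braid_actE. Qed.

End WordAction.

Ltac braid_word x :=
  match x with
  | (?a * ?b)%g => let u := braid_word a in let v := braid_word b in constr:(u ++ v)
  | (?a^-1)%g => let u := braid_word a in constr:(inv_word u)
  | sigma ?i => constr:(gen_word i)
  | braid ?u => constr:(u)
  end.

Ltac braid_decide n :=
  match goal with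
  | |- ?x = ?y =>
    let u := braid_word x in let v := braid_word y in
    transitivity (braid u); [by rewrite ?(braid_cat_mul, braidV)|];
    transitivity (braid v); [|by rewrite ?(braid_cat_mul, braidV)];
    apply: (@braid_checkP n); vm_compute; reflexivity
  end.

(** * The free normal subgroup of B_4 *)

Local Notation free2 := (free_group bool).
Local Notation gc := (free_gen false : free2).
Local Notation gd := (free_gen true : free2).

(* Generators of the kernel of the morphism from B_4 to B_3 that sends sigma_1
   and sigma_3 to the same generator. *)
Definition fiber_gen (x : bool) : B4 :=
  if x then braid [:: (i2, false); (i3, false); (i1, true); (i2, true)]
  else braid [:: (i3, false); (i1, true)].

Definition fiber : free2 -> B4 := free_lift fiber_gen.

Lemma fiberM : {morph fiber : x y / (x * y)%g}.
Proof. exact: free_liftM. Qed.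

(** With c = sigma_3 sigma_1^-1 and d = sigma_2 c sigma_2^-1, these are the words for the conjugates
    of c and d by the letter. They are prescribed on the abstract free group, before it is known to
    embed in B_4; [conj_fiber_gen] checks that they match. *)
Definition twist_gen (l : letter) (x : bool) : free2 :=
  match val l.1, l.2, x with
  | 1, false, false => gd
  | 1, false, true => (gd * gc^-1 * gd)%g
  | 1, true, false => (gc * gd^-1 * gc)%g
  | 1, true, true => gc
  | 0, false, true => (gc^-1 * gd)%g
  | 0, true, true => (gc * gd)%g
  | _, false, true => (gd * gc^-1)%g
  | _, true, true => (gd * gc)%g
  | _, _, false => gc
  end.

Definition twist (l : letter) : free2 -> free2 := free_lift (twist_gen l).

Lemma twistM l : {morph twist l : x y / (x * y)%g}.
Proof. exact: free_liftM. Qed.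

Lemma twistV l : {morph twist l : x / (x^-1)%g}.
Proof. exact/morphV/twistM. Qed.

Lemma word_twistM w : {morph word_act twist w : x y / (x * y)%g}.
Proof. by elim: w => [//|l w IH] x y; rewrite !word_act_cons IH twistM. Qed.

Lemma twist_free_gen l a : twist l (free_gen a) = twist_gen l a.
Proof. exact: free_lift_gen. Qed.

Definition twistE := (twist_free_gen, twistM, twistV).

Lemma twistK i b x : twist (i, b) (twist (i, ~~ b) x) = x.
Proof.
move: x; apply: free_ext => [x y|//|]; first by rewrite !twistM.
by case: i b => [[|[|[|//]]] ?] [] [] /=;
  do 2! (rewrite ?twistE /twist_gen /=); rewrite ?gnorm.
Qed.

Lemma twist_action : braid_action twist.
Proof.
split; first exact: twistK.
all: apply: free_ext; [exact: word_twistM|exact: word_twistM|].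
all: by case; rewrite /word_act /=; do 3! (rewrite ?twistE /twist_gen /=); rewrite ?gnorm.
Qed.

Lemma conj_fiber_gen i x : (sigma i * fiber x = fiber (twist (i, false) x) * sigma i)%g.
Proof.
suff : (fun x => sigma i * fiber x * (sigma i)^-1)%g =1 fiber \o twist (i, false).
  by move=> /(_ x) /= <-; rewrite gnorm.
apply: free_ext => [y z|y z|a]; rewrite /= ?fiberM ?twistM ?fiberM ?gnorm //.
have fiberV := morphV fiberM.
have fiber_genE b : fiber (free_gen b) = fiber_gen b by exact: free_lift_gen.
rewrite twist_free_gen fiber_genE /fiber_gen.
have [->|->|->] := ord3P i; case: a; rewrite /twist_gen /= ?(fiberM, fiberV) !fiber_genE /=;
  first [braid_decide 4%N | braid_decide 7%N | braid_decide 8%N].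
Qed.

Local Notation act := (braid_act twist).

Lemma actM x : {morph act x : y z / (y * z)%g}.
Proof. exact: word_twistM. Qed.

Lemma fiber_conj x xi : (x * fiber xi * x^-1 = fiber (act x xi))%g.
Proof.
have twa := twist_action.
apply: (canLR (mulgK x)); move: x xi; apply: braid_ind => [|i x IH|i x IH] xi.
- by rewrite (braid_act1 twa) mulg1 mul1g.
- rewrite -mulgA conj_fiber_gen mulgA IH !mulgA.
  by rewrite (braid_actM twa) (braid_act_sigma twa).
- have E : ((sigma i)^-1 * fiber xi = fiber (twist (i, true) xi) * (sigma i)^-1)%g.
    by apply: (mulgI (sigma i)); rewrite mulVKg mulgA conj_fiber_gen (twistK i false) mulgK.
  by rewrite -mulgA E mulgA IH -mulgA (braid_actM twa) (braid_act_sigmaV twa).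
Qed.

Lemma act_fiber xi eta : act (fiber xi) eta = (xi * eta * xi^-1)%g.
Proof.
have twa := twist_action.
have fiberV := morphV fiberM.
have actg a eta' : act (fiber (free_gen a)) eta' = (free_gen a * eta' * (free_gen a)^-1)%g.
  rewrite [fiber _]free_lift_gen; move: eta'; apply: free_ext.
  - exact: actM.
  - by move=> x y; rewrite !gnorm.
  - case: a => b; rewrite /fiber_gen (braid_actE twa) /word_act /=;
    case: b; do 4! (rewrite ?twistE /twist_gen /=); by rewrite ?gnorm.
move: xi eta; apply: free_ind => [|a x IH|a x IH] eta.
- rewrite (_ : fiber 1%g = 1%g); last by rewrite /fiber /free_lift /= big_nil.
  by rewrite (braid_act1 twa) invg1 mulg1 mul1g.
- by rewrite fiberM (braid_actM twa) IH actg invgM !mulgA.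
- rewrite fiberM (braid_actM twa) IH.
  have -> : (x * eta * x^-1 = act (fiber (free_gen a))
      ((free_gen a)^-1 * x * eta * ((free_gen a)^-1 * x)^-1))%g.
    by rewrite actg !gnorm.
  by rewrite -(braid_actM twa) fiberV mulVg (braid_act1 twa).
Qed.

(** Two elements with the same image act in the same way on the free group, but the action of an
    image is the inner automorphism; hence their quotient is central, and a free group of rank 2 has
    trivial centre. *)
Lemma fiber_inj : injective fiber.
Proof.
have fiberV := morphV fiberM.
move=> x y xy; apply: divg1_eq; apply: (@free_center _ false true) => // c.
have := act_fiber (x * y^-1)%g (free_gen c).
rewrite fiberM fiberV xy mulgV (braid_act1 twist_action) => cE.
by rewrite [in RHS]cE mulgVK.
Qed.

(** * Central braids in the kernel *)

(** Every generator is sent to [- t^-1], of infinite order, so this is the exponent sum of a braid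
    in multiplicative form. *)
Definition rho_det (x : B4) : laurent := \det (GL3_val (rho x)).

Lemma rho1 : rho 1%g = 1%g.
Proof. by apply: (mulgI (rho 1%g)); rewrite -rhoM !mulg1. Qed.

Lemma rho_det1 : rho_det 1%g = 1.
Proof. by rewrite /rho_det rho1 det1. Qed.

Lemma rho_detM : {morph rho_det : x y / (x * y)%g >-> x * y}.
Proof. by move=> x y; rewrite /rho_det rhoM det_mulmx. Qed.

Lemma rho_detV x : rho_det (x^-1)%g * rho_det x = 1.
Proof. by rewrite -rho_detM mulVg rho_det1. Qed.

Lemma rho_detX x n : rho_det (x ^+ n)%g = rho_det x ^+ n.
Proof.
elim: n => [|n IH]; first by rewrite expg0 expr0 rho_det1.
by rewrite expgS exprS rho_detM IH.
Qed.

Lemma rho_det_sigma i : rho_det (sigma i) = - laurent_t^-1.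
Proof.
rewrite /rho_det rho_sigma /= /burau_mx /mx3.
rewrite (expand_det_row _ ord0) !big_ord_recl big_ord0 /cofactor.
rewrite !(expand_det_row _ ord0) !big_ord_recl !big_ord0 /cofactor !det_mx11 !mxE /=.
case: i => [[|[|[|//]]] ?] /=; rewrite ?mxE /=; ring.
Qed.

Lemma laurent_t_exp_inj (m n : nat) : laurent_t ^- m = laurent_t ^- n -> m = n.
Proof.
move=> /(congr1 GRing.inv); rewrite !invrK => mn.
have [//] : m%:Z = n%:Z.
apply: (@deg_min_unique 1 1); rewrite ?coef1 //.
by rewrite -!exprnP mn.
Qed.

(* The additive group Z^2, written multiplicatively. *)
Definition lattice : Type := (int * int)%type.
HB.instance Definition _ := Choice.on lattice.

Definition lattice_add (x y : lattice) : lattice := (x.1 + y.1, x.2 + y.2).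
Definition lattice_opp (x : lattice) : lattice := (- x.1, - x.2).

Lemma lattice_addA : associative lattice_add.
Proof. by move=> x y z; rewrite /lattice_add /= !addrA. Qed.
Lemma lattice_add0 : left_id (0, 0) lattice_add.
Proof. by case=> p q; rewrite /lattice_add /= !add0r. Qed.
Lemma lattice_addr0 : right_id (0, 0) lattice_add.
Proof. by case=> p q; rewrite /lattice_add /= !addr0. Qed.
Lemma lattice_addN : left_inverse (0, 0) lattice_opp lattice_add.
Proof. by case=> p q; rewrite /lattice_add /= !addNr. Qed.
Lemma lattice_addrN : right_inverse (0, 0) lattice_opp lattice_add.
Proof. by case=> p q; rewrite /lattice_add /= !addrN. Qed.

HB.instance Definition _ := isGroup.Build lattice
  lattice_addA lattice_add0 lattice_addr0 lattice_addN lattice_addrN.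

Lemma lattice_mulE (x y : lattice) : (x * y)%g = (x.1 + y.1, x.2 + y.2) :> lattice.
Proof. by []. Qed.

Lemma lattice_invE (x : lattice) : (x^-1)%g = (- x.1, - x.2) :> lattice.
Proof. by []. Qed.

(** The effect of [twist] on the abelianized free group, in the basis given by the classes of c and
    c^-1 d. There sigma_1 and sigma_3 act alike, and sigma_2 and sigma_1^-1 act by the two
    elementary matrices with non-negative entries. *)
Definition shear (l : letter) (x : lattice) : lattice :=
  match val l.1, l.2 with
  | 1, false => (x.1, x.2 + x.1)
  | 1, true => (x.1, x.2 - x.1)
  | _, false => (x.1 - x.2, x.2)
  | _, true => (x.1 + x.2, x.2)
  end.

Lemma shear_action : braid_action shear.
Proof.
split=> [i b x|x|x|x]; rewrite /word_act /shear /=.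
- by case: x i b => p q [[|[|[|//]]] ?] [] /=; congr (_, _); ring.
- by congr (_, _); ring.
- by congr (_, _); ring.
- by congr (_, _); ring.
Qed.

Lemma shearM l : {morph shear l : x y / (x * y)%g}.
Proof.
by move=> x y; rewrite /shear !lattice_mulE; case: l => [[[|[|[|//]]] ?] []] /=;
  congr (_, _); ring.
Qed.

Definition abel : free2 -> lattice :=
  free_lift (fun a => if a then (1, 1) : lattice else (1, 0)).

Lemma abelM : {morph abel : x y / (x * y)%g}.
Proof. exact: free_liftM. Qed.

Lemma abel_gen a : abel (free_gen a) = (1, a%:R).
Proof. by rewrite [LHS]free_lift_gen; case: a. Qed.

Lemma abel_conj x y : abel (x * y * x^-1)%g = abel y.
Proof.
rewrite !abelM (morphV abelM) !lattice_mulE lattice_invE /=.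
by case: (abel y) => p q /=; congr (_, _); ring.
Qed.

Lemma abel_twist l x : abel (twist l x) = shear l (abel x).
Proof.
move: x; apply: free_ext => [x y|x y|a]; rewrite ?twistM ?abelM ?shearM //.
rewrite twist_free_gen abel_gen; case: l a => [[[|[|[|//]]] ?] []] [];
  by rewrite /twist_gen /shear /= ?(abelM, morphV abelM) !abel_gen ?lattice_mulE ?lattice_invE.
Qed.

Lemma abel_act x y : abel (braid_act twist x y) = braid_act shear x (abel y).
Proof.
rewrite /braid_act; elim: (generic_quotient.repr x) => [//|l w IH].
by rewrite !word_act_cons abel_twist IH.
Qed.

(** * Normal forms in B_3 *)

Section NormalForm.
Variables (G : groupType) (u v z : G).

(** For the half twist u and the rotation v of B_3, the blocks u v^-1 and u^-1 v are sigma_2 and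
    sigma_1^-1, which act on the lattice by non-negative matrices. The block u^-1 v replaces u v,
    from which it differs by the central factor z. *)
Definition positive_word (w : seq bool) : G :=
  (\prod_(c <- w) (if c then u * v^-1 else u^-1 * v))%g.

(* If [u^2 = v^3 = z], then modulo [z] the elements [u] and [v] generate a
   quotient of the free product of Z/2 and Z/3, whose elements are alternating
   products of [u] and [v^±1], grouped here in blocks [u v^±1]. *)
Definition normal_form (b : G) : Prop :=
  exists (k n i : nat) (w : seq bool) (j : bool), (i < 3)%N /\
    (b * z ^+ n = z ^+ k * v ^+ i * positive_word w * u ^+ j)%g.

Hypotheses (uuz : (u * u)%g = z) (vvvz : (v * v * v)%g = z).

Let zu : commute z u.
Proof. by rewrite /commute -uuz mulgA. Qed.

Let zv : commute z v.
Proof. by rewrite /commute -vvvz !mulgA. Qed.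

Let zX n x : commute z x -> commute (z ^+ n)%g x.
Proof. by move=> zx; apply/commute_sym/commuteX/commute_sym. Qed.

Let uv_s1 : (u * v = z * (u^-1 * v))%g.
Proof. by rewrite -uuz !mulgA mulgK. Qed.

Let s1V_v : (u^-1 * v * v = u * v^-1)%g.
Proof. by apply: (mulgI u); apply: (mulIg v); rewrite !mulgA mulgV mul1g mulgVK vvvz uuz. Qed.

Let s2_v : (u * v^-1 * v = u)%g.
Proof. by rewrite mulgVK. Qed.

Let zpos w : commute z (positive_word w).
Proof.
rewrite /positive_word; elim: w => [|b w IH]; first by rewrite big_nil; exact: commute1.
by rewrite big_cons; apply: commuteM => //; case: b; apply: commuteM => //; exact: commuteV.
Qed.

Lemma positive_word_rcons w b :
  positive_word (rcons w b) = (positive_word w * (if b then u * v^-1 else u^-1 * v))%g.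
Proof. by rewrite /positive_word -cats1 big_cat big_seq1. Qed.

Lemma normal_formM b x : commute z x ->
  (exists (k n i : nat) (w : seq bool) (j : bool), (i < 3)%N /\
    (b * z ^+ n * x = z ^+ k * v ^+ i * positive_word w * u ^+ j)%g) ->
  normal_form (b * x)%g.
Proof.
move=> zx [k [n [i [w [j [i3 bE]]]]]]; exists k, n, i, w, j; split=> //.
by rewrite -bE -!mulgA (zX n zx).
Qed.

Let zvX m : commute z (v ^+ m)%g.
Proof. exact: commuteX. Qed.

Let zshift k i w :
  (z ^+ k * v ^+ i * positive_word w * z = z ^+ k.+1 * v ^+ i * positive_word w)%g.
Proof.
by rewrite expgSr -!mulgA; congr (_ * _)%g; rewrite -(zpos w) !mulgA (zvX i).
Qed.

Lemma normal_form_u b : normal_form b -> normal_form (b * u)%g.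
Proof.
move=> [k [n [i [w [[] [i3 bE]]]]]]; apply: (normal_formM zu).
  exists k.+1, n, i, w, false; split=> //.
  by rewrite bE expg0 mulg1 expg1 -mulgA uuz zshift.
by exists k, n, i, w, true; rewrite bE expg0 mulg1.
Qed.

(** The last factor decides: after u the new v completes a block; after u v^-1 it cancels; after
    u^-1 v the square of v is v^-1 up to z; when only a power of v is present, its exponent grows
    modulo 3. *)
Lemma normal_form_v b : normal_form b -> normal_form (b * v)%g.
Proof.
move=> [k [n [i [w [j [i3 bE]]]]]]; apply: (normal_formM zv).
case: j bE => bE.
  exists k.+1, n, i, (rcons w false), false; split=> //.
  by rewrite bE expg0 mulg1 expg1 -mulgA uv_s1 positive_word_rcons !mulgA zshift.
rewrite expg0 mulg1 in bE.
case/lastP: w bE => [|w c] bE; last first.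
  rewrite positive_word_rcons in bE; case: c bE => bE.
    exists k, n, i, w, true; split=> //.
    by rewrite bE -[LHS]mulgA -(mulgA (positive_word w)) s2_v mulgA expg1.
  exists k, n, i, (rcons w true), false; split=> //.
  by rewrite bE positive_word_rcons expg0 mulg1 -[LHS]mulgA -(mulgA (positive_word w)) s1V_v.
rewrite /positive_word big_nil mulg1 in bE.
have [i2|] := ltnP i 2.
  exists k, n, i.+1, [::], false; split=> //.
  by rewrite bE /positive_word big_nil expg0 !mulg1 -mulgA -expgSr.
move=> i2; rewrite (_ : i = 2%N) ?expg2 in bE; last by lia.
exists k.+1, n, 0%N, [::], false; split=> //.
by rewrite bE /positive_word big_nil !expg0 !mulg1 -mulgA vvvz -expgSr.
Qed.

Lemma normal_form_zV b : normal_form b -> normal_form (b * z^-1)%g.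
Proof.
move=> [k [n [i [w [j [i3 bE]]]]]]; exists k, n.+1, i, w, j; split=> //.
by rewrite -bE expgS -!mulgA mulKg.
Qed.

Lemma normal_form_vV b : normal_form b -> normal_form (b * v^-1)%g.
Proof.
move=> nb; have -> : (v^-1 = v * v * z^-1)%g by rewrite -vvvz !gnorm.
by rewrite !mulgA; apply/normal_form_zV/normal_form_v/normal_form_v.
Qed.

Lemma normal_form_uV b : normal_form b -> normal_form (b * u^-1)%g.
Proof.
move=> nb; have -> : (u^-1 = u * z^-1)%g by rewrite -uuz !gnorm.
by rewrite !mulgA; apply/normal_form_zV/normal_form_u.
Qed.

Lemma normal_form1 : normal_form 1%g.
Proof.
exists 0%N, 0%N, 0%N, [::], false; split=> //.
by rewrite /positive_word big_nil !expg0 !mulg1.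
Qed.

End NormalForm.

Definition half_twist3 : B4 := (sigma i1 * sigma i2 * sigma i1)%g.
Definition rotation3 : B4 := (sigma i1 * sigma i2)%g.
Definition full_twist3 : B4 := (half_twist3 * half_twist3)%g.

Local Notation u3 := half_twist3.
Local Notation v3 := rotation3.
Local Notation nf3 := (normal_form half_twist3 rotation3 full_twist3).

Lemma rotation3_cube : (rotation3 * rotation3 * rotation3)%g = full_twist3.
Proof.
have [r121 _ _] := sigma_relations.
by rewrite /full_twist3 /half_twist3 {2}r121 /rotation3 !mulgA.
Qed.

Lemma nf3_s1 b : nf3 b -> nf3 (b * sigma i1)%g /\ nf3 (b * (sigma i1)^-1)%g.
Proof.
have uu : (u3 * u3)%g = full_twist3 by [].
move=> nb; have -> : (sigma i1 = v3^-1 * u3)%g by rewrite /half_twist3 /rotation3 mulKg.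
rewrite (invgM (v3^-1)%g u3) (invgK v3) (mulgA b (v3^-1)%g u3) (mulgA b (u3^-1)%g v3).
split.
  exact (normal_form_u uu rotation3_cube (normal_form_vV uu rotation3_cube nb)).
exact (normal_form_v uu rotation3_cube (normal_form_uV uu rotation3_cube nb)).
Qed.

Lemma nf3_s2 b : nf3 b -> nf3 (b * sigma i2)%g /\ nf3 (b * (sigma i2)^-1)%g.
Proof.
have uu : (u3 * u3)%g = full_twist3 by [].
have [r121 _ _] := sigma_relations.
move=> nb; have -> : (sigma i2 = u3 * v3^-1)%g.
  by rewrite /half_twist3 /rotation3 r121 -(mulgA (sigma i2)) mulgK.
rewrite (invgM u3 (v3^-1)%g) (invgK v3) (mulgA b u3 (v3^-1)%g) (mulgA b v3 (u3^-1)%g).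
split.
  exact (normal_form_vV uu rotation3_cube (normal_form_u uu rotation3_cube nb)).
exact (normal_form_uV uu rotation3_cube (normal_form_v uu rotation3_cube nb)).
Qed.

(** A right factor sigma_3 equals c sigma_1 with c in the free subgroup. As this subgroup is normal,
    c can be moved to the left of [b], which then receives sigma_1. *)
Lemma fiber_decomposition x : exists xi b, nf3 b /\ x = (fiber xi * b)%g.
Proof.
have fiber_b b xi : (b * fiber xi = fiber (braid_act twist b xi) * b)%g.
  by rewrite -fiber_conj mulgVK.
have c_s3 : (fiber gc = sigma i3 * (sigma i1)^-1)%g.
  by rewrite [fiber _]free_lift_gen /fiber_gen (braid_cons i3 false) braid_letter.
have s13 : commute (sigma i1) (sigma i3) by have [_ _ r31] := sigma_relations; exact: esym.
move: x; apply: braid_ind => [|i x [xi [b [nb ->]]]|i x [xi [b [nb ->]]]].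
- exists 1%g, 1%g; split; first exact: normal_form1.
  by rewrite mulg1 /fiber /free_lift big_nil.
- have [->|->|->] := ord3P i.
  + by exists xi, (b * sigma i1)%g; rewrite mulgA; split=> //; have [] := nf3_s1 nb.
  + by exists xi, (b * sigma i2)%g; rewrite mulgA; split=> //; have [] := nf3_s2 nb.
  exists (xi * braid_act twist b gc)%g, (b * sigma i1)%g; split.
    by have [] := nf3_s1 nb.
  by rewrite fiberM -!mulgA [(fiber (braid_act _ _ _) * _)%g]mulgA -fiber_b c_s3 !gnorm.
- have [->|->|->] := ord3P i.
  + by exists xi, (b * (sigma i1)^-1)%g; rewrite mulgA; split=> //; have [] := nf3_s1 nb.
  + by exists xi, (b * (sigma i2)^-1)%g; rewrite mulgA; split=> //; have [] := nf3_s2 nb.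
  exists (xi * braid_act twist b gc^-1)%g, (b * (sigma i1)^-1)%g; split.
    by have [] := nf3_s1 nb.
  rewrite fiberM -!mulgA [(fiber (braid_act _ _ _) * _)%g]mulgA -fiber_b.
  rewrite (morphV fiberM) c_s3 !gnorm -[(_ * sigma i1 * _)%g]mulgA (commuteV s13).
  by rewrite !gnorm.
Qed.

Lemma rho_det_fiber xi : rho_det (fiber xi) = 1.
Proof.
have dV i : rho_det (sigma i)^-1%g = - laurent_t.
  apply: (mulIr laurent_t_unit); have := rho_detV (sigma i).
  rewrite rho_det_sigma => /(congr1 (fun y => y * - (laurent_t * laurent_t))).
  rewrite mulrN mulrN mulNr opprK mul1r mulNr => <-.
  by rewrite -!mulrA (mulrA laurent_t^-1) mulVr ?laurent_t_unit // mul1r.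
have dd i j : rho_det (sigma i) * rho_det (sigma j)^-1%g = 1.
  by rewrite rho_det_sigma dV mulrNN mulVr ?laurent_t_unit.
have dgen a : rho_det (fiber (free_gen a)) = 1.
  rewrite [fiber _]free_lift_gen; case: a; rewrite /fiber_gen !braid_cons !rho_detM.
    rewrite [rho_det (braid [::])]rho_det1 mulr1 /= (mulrC (rho_det (sigma i1)^-1)%g) mulrA.
    by rewrite mulrACA !dd mul1r.
  by rewrite [rho_det (braid [::])]rho_det1 mulr1 dd.
move: xi; apply: free_ind => [|a x IH|a x IH].
- by rewrite (_ : fiber 1%g = 1%g) ?rho_det1 // /fiber /free_lift big_nil.
- by rewrite fiberM rho_detM IH dgen mulr1.
- rewrite fiberM rho_detM IH (morphV fiberM) mulr1.
  by have := rho_detV (fiber (free_gen a)); rewrite dgen mulr1.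
Qed.

Lemma rho_det_full_twist3 : rho_det full_twist3 = laurent_t ^- 6.
Proof. by rewrite !rho_detM !rho_det_sigma -!exprVn; ring. Qed.

(** * Braids of B_3 acting trivially on the lattice *)

Local Notation shear_act := (braid_act shear).

(** Products of (1 1; 0 1) and (1 0; 1 1). Non-negative entries and determinant 1 force a positive
    diagonal, so each further factor makes an off-diagonal entry positive and a non-empty product is
    never diagonal. *)
Lemma shear_positive_word w :
  exists a b c d : int, [/\ [/\ 0 <= a, 0 <= b, 0 <= c & 0 <= d],
    a * d - b * c = 1, (w != [::] -> 0 < b + c)
    & forall p q, shear_act (positive_word half_twist3 rotation3 w) (p, q) =
        (a * p + b * q, c * p + d * q)].
Proof.
have sha := shear_action.
have [r121 _ _] := sigma_relations.
have AE : (half_twist3^-1 * rotation3 = (sigma i1)^-1)%g.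
  by rewrite -[half_twist3]/(rotation3 * sigma i1)%g (invgM rotation3 (sigma i1)) mulgVK.
have BE : (half_twist3 * rotation3^-1 = sigma i2)%g.
  by rewrite /half_twist3 /rotation3 r121 -(mulgA (sigma i2)) mulgK.
rewrite /positive_word AE BE; elim: w => [|s w [a [b [c [d [[a0 b0 c0 d0] det _ IH]]]]]].
  exists 1, 0, 0, 1; split=> // p q; rewrite big_nil (braid_act1 sha).
  by congr (_, _); ring.
have ad0 : (0 < a) /\ (0 < d) by split; nia.
case: s.
  exists a, b, (a + c), (b + d); split=> [||_|p q]; [by split; lia|by nia|by lia|].
  rewrite big_cons (braid_actM sha) IH (braid_act_sigma sha) /shear /=.
  by congr (_, _); ring.
exists (a + c), (b + d), c, d; split=> [||_|p q]; [by split; lia|by nia|by lia|].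
rewrite big_cons (braid_actM sha) IH (braid_act_sigmaV sha) /shear /=.
by congr (_, _); ring.
Qed.

Lemma shear_half_twist3 p q : shear_act half_twist3 (p, q) = (- q, p).
Proof.
have sha := shear_action.
rewrite !(braid_actM sha) !(braid_act_sigma sha) /shear /=.
by congr (_, _); ring.
Qed.

Lemma shear_rotation3 p q : shear_act rotation3 (p, q) = (- q, p + q).
Proof.
have sha := shear_action.
rewrite !(braid_actM sha) !(braid_act_sigma sha) /shear /=.
by congr (_, _); ring.
Qed.

Lemma shear_actX x n t : shear_act (x ^+ n)%g t = iter n (shear_act x) t.
Proof.
have sha := shear_action; elim: n => [|n IH]; first by rewrite expg0 (braid_act1 sha).
by rewrite expgS (braid_actM sha) IH.
Qed.

Lemma shear_full_twist3X n p q :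
  shear_act (full_twist3 ^+ n)%g (p, q) = ((-1) ^+ n * p, (-1) ^+ n * q).
Proof.
have sha := shear_action.
elim: n => [|n IH]; first by rewrite expg0 (braid_act1 sha) !mul1r.
rewrite expgS (braid_actM sha) IH (braid_actM sha) !shear_half_twist3.
by congr (_, _); rewrite exprS; ring.
Qed.

(** The full twist acts by -1, so the remaining factor v^i P u^j acts by 1 or -1. Here u and v act
    with orders 4 and 6, and P by a non-negative matrix; comparing signs leaves only i = j = 0 and P
    empty. The premise includes the opposite basis vectors because the power of the full twist
    introduces a sign. *)
Lemma normal_form_shear b : normal_form half_twist3 rotation3 full_twist3 b ->
  (forall s : bool, shear_act b ((-1) ^+ s, 0) = ((-1) ^+ s, 0) /\
    shear_act b (0, (-1) ^+ s) = (0, (-1) ^+ s)) ->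
  exists k n : nat, (b * full_twist3 ^+ n = full_twist3 ^+ k)%g.
Proof.
have sha := shear_action.
move=> [k [n [i [w [j [i3 bE]]]]]] b1; exists k, n.
have [a [b' [c [d [[a0 b0 c0 d0] det ne wE]]]]] := shear_positive_word w.
have E p q : (p, q) \in [:: (1, 0); (0, 1)] ->
    shear_act (rotation3 ^+ i * positive_word half_twist3 rotation3 w *
    half_twist3 ^+ j)%g (p, q) = ((-1) ^+ (k + n) * p, (-1) ^+ (k + n) * q).
  move=> pq; have : shear_act b (shear_act (full_twist3 ^+ n)%g (p, q)) =
      shear_act (full_twist3 ^+ n)%g (p, q).
    move: pq; rewrite !inE shear_full_twist3X -signr_odd.
    by case/orP => /eqP[-> ->]; rewrite mulr0 mulr1; case: (b1 (odd n)).
  rewrite -(braid_actM sha) bE -!(mulgA (full_twist3 ^+ k)%g) (braid_actM sha).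
  move=> /(congr1 (shear_act (full_twist3 ^+ k)%g)).
  case: (shear_act (rotation3 ^+ i * _ * _)%g _) => p' q';
    rewrite !shear_full_twist3X !mulrA -!exprD.
  by rewrite addnn -mul2n exprM sqrrN !expr1n !mul1r.
have [s2|s2] : (-1) ^+ (k + n) = 1 :> int \/ (-1) ^+ (k + n) = -1 :> int.
- by rewrite -signr_odd; case: odd; [right|left].
all: move: E; rewrite s2 => E; have := E 1 0 isT; have {E} := E 0 1 isT.
all: rewrite !(braid_actM sha _ (half_twist3 ^+ j)%g) !(braid_actM sha (rotation3 ^+ i)%g).
all: rewrite !shear_actX.
all: move: (shear_act half_twist3) (shear_act rotation3) shear_half_twist3 shear_rotation3.
all: move: (shear_act _) wE => fw wE fu fv fuE fvE.
all: case: i i3 bE => [|[|[|//]]] _; case: j => bE; rewrite /= ?fuE !wE ?fvE.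
all: move=> [E1 E2] [E3 E4].
all: try (exfalso; nia).
all: case: w ne bE {wE} => [_|x w ne] bE.
all: try (have := ne isT; lia).
all: by rewrite bE /positive_word big_nil !mulg1.
Qed.

Lemma central_kernel_trivial x :
  (forall y, commute x y) -> rho_det x = 1 -> x = 1%g.
Proof.
move=> xC dx; have [xi [b [nb xE]]] := fiber_decomposition x.
have fiberV := morphV fiberM.
(* As [b] is the product of [(fiber xi)^-1] and a central element, it acts as conjugation by the
   inverse of [xi], hence trivially on the abelianization. *)
have actb eta : braid_act twist b eta = (xi^-1 * eta * xi)%g.
  apply: fiber_inj; rewrite -fiber_conj !fiberM fiberV.
  have -> : b = ((fiber xi)^-1 * x)%g by rewrite xE mulKg.
  by rewrite invgM invgK !mulgA -(mulgA _ x) xC mulgA mulgK.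
have abelE eta : shear_act b (abel eta) = abel eta.
  by rewrite -abel_act actb -{2}[xi]invgK abel_conj.
have shb (s : bool) : shear_act b ((-1) ^+ s, 0) = ((-1) ^+ s, 0) /\
    shear_act b (0, (-1) ^+ s) = (0, (-1) ^+ s).
  have e1 : abel (free_gen false) = (1, 0) by rewrite abel_gen.
  have e2 : abel ((free_gen false)^-1 * free_gen true)%g = (0, 1).
    by rewrite abelM (morphV abelM) !abel_gen.
  case: s; last by rewrite -e1 -e2 !abelE.
  have -> : ((-1) ^+ true, 0) = abel (free_gen false)^-1%g by rewrite (morphV abelM) e1.
  have -> : (0, (-1) ^+ true) = abel ((free_gen false)^-1 * free_gen true)^-1%g.
    by rewrite (morphV abelM) e2.
  by rewrite !abelE.
have [k [n bz]] := normal_form_shear nb shb.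
have kn : k = n.
  have db : rho_det b = 1 by rewrite -dx xE rho_detM rho_det_fiber mul1r.
  apply/eqP; rewrite -(eqn_pmul2l (isT : (0 < 6)%N)); apply/eqP/laurent_t_exp_inj.
  rewrite !exprM -!(exprVn (laurent_t ^+ 6)) -rho_det_full_twist3 -!rho_detX -bz.
  by rewrite rho_detM db mul1r.
have b1 : b = 1%g by apply: (mulIg (full_twist3 ^+ n)%g); rewrite bz kn mul1g.
have xi1 : xi = 1%g.
  apply: (@free_center _ false true) => // c.
  have := actb (free_gen c); rewrite b1 (braid_act1 twist_action) => {1}->.
  by rewrite !mulgA mulgV mul1g.
by rewrite xE b1 mulg1 xi1 /fiber /free_lift big_nil.
Qed.

(** * Kernel braids are pure *)

Lemma laurent_form (f : laurent) : exists (n : nat) (p : {poly int}),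
  f * laurent_t ^+ n = laurent_poly p.
Proof.
have /is_laurentP[n [p fE]] := valP f; exists n, p.
by apply/val_inj; rewrite rmorphM rmorphXn.
Qed.

(** Evaluation at t = 1. A Laurent polynomial is a fraction over a power of t, so any numerator
    gives the value; [laurent_form] ensures that the default 0 is never taken. *)
Definition laurent_at1 (f : laurent) : int :=
  xget 0 [set a | exists (n : nat) (p : {poly int}),
    f * laurent_t ^+ n = laurent_poly p /\ a = p.[1]]%classic.

Lemma laurent_at1E f n p : f * laurent_t ^+ n = laurent_poly p -> laurent_at1 f = p.[1].
Proof.
move=> fp; rewrite /laurent_at1; case: xgetP => [a _ [m [q [fq ->]]]|/(_ p.[1])[]].
  have: laurent_poly (q * 'X^n) = laurent_poly (p * 'X^m).
    by rewrite !laurent_polyM -fp -fq !laurent_polyXn mulrAC.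
  move/laurent_poly_inj/(congr1 (horner^~ 1)).
  by rewrite !hornerM !hornerXn !expr1n !mulr1.
by exists n, p.
Qed.

Lemma laurent_polyB : {morph laurent_poly : p q / p - q}.
Proof. by move=> p q; apply/val_inj; rewrite rmorphB /= tofracB. Qed.

Lemma laurent_poly1 : laurent_poly 1 = 1.
Proof. by apply/val_inj; rewrite /= tofrac1. Qed.

Lemma laurent_at1_zmod : zmod_morphism laurent_at1.
Proof.
move=> f g; have [n [p fp]] := laurent_form f; have [m [q gq]] := laurent_form g.
rewrite (laurent_at1E fp) (laurent_at1E gq).
rewrite (@laurent_at1E _ (n + m) (p * 'X^m - q * 'X^n)).
  by rewrite hornerD hornerN !hornerM !hornerXn !expr1n !mulr1.
by rewrite laurent_polyB !laurent_polyM -fp -gq !laurent_polyXn exprD; ring.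
Qed.

Lemma laurent_at1_monoid : monoid_morphism laurent_at1.
Proof.
split; first by rewrite (@laurent_at1E _ 0 1) ?hornerC // laurent_poly1 expr0 mulr1.
move=> f g; have [n [p fp]] := laurent_form f; have [m [q gq]] := laurent_form g.
rewrite (laurent_at1E fp) (laurent_at1E gq) (@laurent_at1E _ (n + m) (p * q)) ?hornerM //.
by rewrite laurent_polyM -fp -gq exprD; ring.
Qed.

HB.instance Definition _ := GRing.isZmodMorphism.Build laurent int laurent_at1 laurent_at1_zmod.
HB.instance Definition _ := GRing.isMonoidMorphism.Build laurent int laurent_at1 laurent_at1_monoid.

(** The rows are the simple roots e_i - e_(i+1). At t = 1 the reduced Burau representation is the
    reflection representation of S_4 on the root lattice, and this matrix embeds it into the
    permutation representation. *)
Definition root_mx : 'M[int]_(3, 4) := \matrix_(i, j) ((j == i :> nat)%:R - (j == i.+1 :> nat)%:R).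

Lemma laurent_at1_tV : laurent_at1 laurent_t^-1 = 1.
Proof.
by rewrite (@laurent_at1E _ 1 1) ?hornerC // laurent_poly1 expr1 mulVr ?laurent_t_unit.
Qed.

Lemma mulmx_perm m n (A : 'M[int]_(m, n)) (s : 'S_n) k j : (A *m perm_mx s) k j = A k ((s^-1)%g j).
Proof. by rewrite -{1}[s]invgK -col_permE mxE. Qed.

Lemma root_mx_sigma i : map_mx laurent_at1 (GL3_val (rho (sigma i))) *m root_mx =
  root_mx *m perm_mx (transposition i).
Proof.
have inordE k (lt_k4 : (k < 4)%N) : inord k = Ordinal lt_k4 :> 'I_4.
  by apply/val_inj; rewrite /= inordK.
apply/matrixP => k j; rewrite rho_sigma mulmx_perm /transposition tpermV.
rewrite !mxE !big_ord_recl big_ord0 !mxE /burau_mx /mx3 /=.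
case: i k j => [[|[|[|//]]] ?] [[|[|[|//]]] ?] [[|[|[|[|//]]]] ?];
  rewrite /= !inordE !permE /= !mxE /= ?rmorphN ?rmorph0 ?rmorph1 ?laurent_at1_tV /=.
all: by rewrite ?laurent_at1_tV.
Qed.

Lemma kernel_pure x : rho x = 1%g -> pure x.
Proof.
pose C y := map_mx laurent_at1 (GL3_val (rho y)).
have CM y z : C (y * z)%g = C y *m C z by rewrite /C rhoM /= map_mxM.
have C1 : C 1%g = 1%:M by rewrite /C rho1 /= map_mx1.
have trM := braid_liftM transposition_relations.
have E y : C y *m root_mx = root_mx *m perm_mx (braid_perm y).
  move: y; apply: braid_ind => [|i y IH|i y IH].
  - rewrite C1 mul1mx (_ : braid_perm 1%g = 1%g) ?perm_mx1 ?mulmx1 //.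
    by rewrite [LHS](braid_liftE transposition_relations) /eval_word big_nil.
  - rewrite CM -mulmxA root_mx_sigma mulmxA IH -mulmxA -perm_mxM.
    by rewrite [braid_perm (y * _)%g]trM (braid_lift_sigma transposition_relations).
  - rewrite CM [braid_perm (y * _)%g]trM (morphV trM) perm_mxM mulmxA -IH -!mulmxA.
    congr (_ *m _); rewrite (braid_lift_sigma transposition_relations).
    rewrite -[root_mx in RHS]mul1mx -C1 -(mulVg (sigma i)) CM -mulmxA -mulmxA.
    by rewrite (mulmxA (C (sigma i))) root_mx_sigma -!mulmxA -perm_mxM mulgV perm_mx1 mulmx1.
move=> rx; have {E} := E x; rewrite /C rx /= map_mx1 mul1mx => E.
apply/permP => j; rewrite perm1; apply: (@perm_inj _ (braid_perm x)^-1%g); rewrite permK.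
have {}E k l : root_mx k l = root_mx k ((braid_perm x)^-1%g l) by rewrite {1}E mulmx_perm.
move: (_^-1%g) E => s E; apply/val_inj.
(* For j < 3, column j is the only one where row j has the entry 1; the last column is the only one
   where the last row has the entry -1, which is why that row occurs twice. *)
case: j => [[|[|[|[|//]]]] ltj];
  [have := E i1 (Ordinal ltj)|have := E i2 (Ordinal ltj)|
   have := E i3 (Ordinal ltj)|have := E i3 (Ordinal ltj)];
  by rewrite !mxE /=; case: (s _) => [[|[|[|[|//]]]] ?].
Qed.

Lemma rho_det_Delta : rho_det Delta = laurent_t ^- 6.
Proof. by rewrite !rho_detM !rho_det_sigma -!exprVn; ring. Qed.

Lemma kernel_Delta x k : rho x = 1%g -> x = (Delta ^+ k)%g -> x = 1%g.
Proof.
move=> rx xE; have: rho_det x = laurent_t ^- (6 * k).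
  by rewrite xE rho_detX rho_det_Delta exprM -(exprVn (laurent_t ^+ 6)).
rewrite /rho_det rx det1 => /esym; rewrite -[1]invr1 -(expr0 laurent_t).
by move/laurent_t_exp_inj => k0; rewrite xE (_ : k = 0%N) //; lia.
Qed.

(** * Positive permutation braids *)

Definition swap_values (m : nat) (l : seq nat) : seq nat :=
  [seq if x == m then m.+1 else if x == m.+1 then m else x | x <- l].

Definition inverted (m : nat) (l : seq nat) : bool := (index m.+1 l < index m l)%N.

Definition nat_gen (m : nat) : 'I_3 := nth i1 [:: i1; i2; i3] m.

(** Each step undoes one inversion between the consecutive values m and m + 1, with m as small as
    possible, so with enough fuel the letters spell a reduced positive word of the permutation. *)
Fixpoint sorting_word (n : nat) (l : seq nat) : word :=
  if n is n'.+1 then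
    if [seq m <- iota 0 3 | inverted m l] is m :: _ then
      rcons (sorting_word n' (swap_values m l)) (nat_gen m, false)
    else [::]
  else [::].

Definition perm_values (s : {perm 'I_4}) : seq nat :=
  [seq nat_of_ord (s i) | i <- [:: inord 0; inord 1; inord 2; inord 3]].

(* A reduced word of [s] in S_4 has length at most 6. *)
HB.lock Definition perm_braid (s : {perm 'I_4}) : B4 :=
  braid (sorting_word 6 (perm_values s)).

(** The braid does not depend on which inversion is undone (Matsumoto's theorem for S_4), which is
    checked by computation on the 24 permutations. *)
Lemma sorting_word_step l m : l \in permutations (iota 0 4) -> (m < 3)%N -> ~~ inverted m l ->
  braid (sorting_word 6 (swap_values m l)) = (braid (sorting_word 6 l) * sigma (nat_gen m))%g.
Proof.
move=> lP m3 ninv; rewrite sigmaE -braid_cat_mul; apply: (@braid_checkP 5).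
have : all (fun l => all (fun m => ~~ inverted m l ==>
    braid_check 5 (sorting_word 6 (swap_values m l)) (sorting_word 6 l ++ [:: (nat_gen m, false)]))
  (iota 0 3)) (permutations (iota 0 4)) by vm_compute.
move/allP/(_ _ lP)/allP/(_ m); rewrite mem_iota => /(_ m3) /implyP; exact.
Qed.

Lemma inord4E : [/\ inord 0 = Ordinal (isT : 0 < 4)%N :> 'I_4, inord 1 = Ordinal (isT : 1 < 4)%N
  :> 'I_4,
  inord 2 = Ordinal (isT : 2 < 4)%N :> 'I_4 & inord 3 = Ordinal (isT : 3 < 4)%N :> 'I_4].
Proof. by split; apply/val_inj; rewrite /= inordK. Qed.

Lemma perm_valuesE s (k : 'I_4) : nth 0%N (perm_values s) k = s k.
Proof.
have [e0 e1 e2 e3] := inord4E; rewrite /perm_values e0 e1 e2 e3.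
by case: k => [[|[|[|[|//]]]] ?]; congr (nat_of_ord (s _)); apply/val_inj.
Qed.

Lemma perm_values_uniq s : uniq (perm_values s).
Proof.
apply/(uniqP 0%N) => i j; rewrite !inE !size_map /= => i4 j4.
have := perm_valuesE s (Ordinal i4); have := perm_valuesE s (Ordinal j4).
by move=> /= -> -> /val_inj /perm_inj [].
Qed.

Lemma perm_values_perm s : perm_values s \in permutations (iota 0 4).
Proof.
rewrite mem_permutations; apply: uniq_perm; rewrite ?iota_uniq ?perm_values_uniq //.
have sub : {subset perm_values s <= iota 0 4}.
  by move=> k /mapP[i _ ->]; rewrite mem_iota ltn_ord.
by have [] := uniq_min_size (perm_values_uniq s) sub isT.
Qed.

Lemma index_perm_values (s : {perm 'I_4}) (k : 'I_4) : index (nat_of_ord (s k)) (perm_values s) = k.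
Proof. by rewrite -perm_valuesE index_uniq ?perm_values_uniq ?size_map. Qed.

Lemma nat_gen_ord (m : 'I_3) : nat_gen m = m.
Proof. by case: m => [[|[|[|//]]] ?]; apply/val_inj. Qed.

Lemma inord_ord3 (m : 'I_3) : (inord m : 'I_4) = m :> nat /\ (inord m.+1 : 'I_4) = m.+1 :> nat.
Proof. by split; rewrite inordK //; have := ltn_ord m; lia. Qed.

Lemma transpositionE (m : 'I_3) (y : 'I_4) : transposition m y =
  (if y == m :> nat then m.+1 else if y == m.+1 :> nat then m : nat else y) :> nat.
Proof.
have [m0 m1] := inord_ord3 m.
rewrite /transposition permE /= -!val_eqE /= m0 m1.
by case: ifP => _; [|case: ifP => _].
Qed.

Lemma perm_braid_step (s : {perm 'I_4}) (m : 'I_3) (a b : 'I_4) :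
  s a = m :> nat -> s b = m.+1 :> nat -> (a < b)%N ->
  perm_braid (s * transposition m)%g = (perm_braid s * sigma m)%g.
Proof.
move=> sa sb ab; rewrite perm_braid.unlock -{2}[m]nat_gen_ord -sorting_word_step
  ?perm_values_perm //.
  congr (braid (sorting_word _ _)); rewrite /perm_values /swap_values -map_comp.
  by apply: eq_map => k /=; rewrite permM transpositionE.
by rewrite /inverted -sb -sa !index_perm_values -leqNgt ltnW.
Qed.

Lemma increasing_perm (q : {perm 'I_4}) :
  (forall m : 'I_3, q (inord m) < q (inord m.+1))%N -> q = 1%g.
Proof.
move=> q_inc; have := q_inc i1; have := q_inc i2; have := q_inc i3 => /=.
have [e0 e1 e2 e3] := inord4E; rewrite e0 e1 e2 e3 => q23 q12 q01.
have := ltn_ord (q (Ordinal (isT : 3 < 4)%N)) => q3.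
apply/permP => k; rewrite perm1; apply/val_inj.
case: k => [[|[|[|[|//]]]] lk]; rewrite /= (bool_irrelevance lk isT); lia.
Qed.

Lemma same_order_perm (s s' : {perm 'I_4}) :
  (forall i j, (s i < s j) = (s' i < s' j))%N -> s = s'.
Proof.
move=> ss'; have : (s^-1 * s')%g = 1%g; last by move/(canRL (mulKVg _)); rewrite mulg1.
by apply: increasing_perm => m; rewrite !permM -ss' !permKV; have [-> ->] := inord_ord3 m.
Qed.

Lemma descent (s s' : {perm 'I_4}) : s != s' ->
  exists (m : 'I_3) (a b : 'I_4), [/\ s a = m :> nat, s b = m.+1 :> nat & (s' b < s' a)%N].
Proof.
move=> ss'; suff /existsP[m] : [exists m : 'I_3,
    (s' ((s^-1)%g (inord m.+1)) < s' ((s^-1)%g (inord m)))%N].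
  have [m0 m1] := inord_ord3 m.
  by exists m, ((s^-1)%g (inord m)), ((s^-1)%g (inord m.+1)); rewrite !permKV.
apply: contraNT ss' => /existsPn ninv; apply/eqP.
have : (s^-1 * s')%g = 1%g; last by move/(canRL (mulKVg _)); rewrite mulg1.
apply: increasing_perm => m; rewrite !permM ltn_neqAle leqNgt ninv andbT.
rewrite (inj_eq val_inj) (inj_eq perm_inj) (inj_eq perm_inj) -val_eqE /=.
by have [-> ->] := inord_ord3 m; rewrite neq_ltn ltnSn.
Qed.

Lemma swap_order (s : {perm 'I_4}) (m : 'I_3) (a b i j : 'I_4) :
  s a = m :> nat -> s b = m.+1 :> nat ->
  (s i < s j)%N != ((s * transposition m)%g i < (s * transposition m)%g j)%N ->
  (i = a /\ j = b) \/ (i = b /\ j = a).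
Proof.
move=> sa sb; rewrite !permM !transpositionE => d.
have eqs k l : s k = s l :> nat -> k = l by move=> /val_inj/perm_inj.
have [dE|dE] : (s i = s a :> nat /\ s j = s b :> nat) \/ (s i = s b :> nat /\ s j = s a :> nat).
- by move: d; rewrite sa sb; do 2 case: ltnP => //; do ?case: eqP; lia.
- by left; split; apply: eqs; case: dE.
- by right; split; apply: eqs; case: dE.
Qed.

(** The braid that takes the left-to-right order [s] to [s'], where [o] decides the sign of every
    crossing: an exchange is positive when the point that was on the left comes first in [o].
    Written as a quotient of positive lifts, it telescopes for fixed [o]. *)
Definition perm_step (o s s' : {perm 'I_4}) : B4 :=
  ((perm_braid (o^-1 * s))^-1 * perm_braid (o^-1 * s'))%g.

Lemma perm_step1 o s : perm_step o s s = 1%g.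
Proof. exact: mulVg. Qed.

Lemma perm_stepM o s s' s'' : (perm_step o s s' * perm_step o s' s'' = perm_step o s s'')%g.
Proof. by rewrite /perm_step mulgA mulgK. Qed.

Lemma perm_step_transposition (o s : {perm 'I_4}) (m : 'I_3) (a b : 'I_4) :
  s a = m :> nat -> s b = m.+1 :> nat ->
  perm_step o s (s * transposition m)%g = if (o a < o b)%N then sigma m else ((sigma m)^-1)%g.
Proof.
have tt : (transposition m * transposition m = 1)%g by rewrite /transposition tperm2.
move=> sa sb; rewrite /perm_step mulgA; case: ifP => [oab|/negbT oab].
  by rewrite (@perm_braid_step _ m (o a) (o b)) ?permM ?permK // mulKg.
have oba : (o b < o a)%N.
  rewrite ltn_neqAle leqNgt oab andbT (inj_eq val_inj) (inj_eq perm_inj).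
  by apply: contra_eq_neq sb => ->; rewrite sa neq_ltn ltnSn.
rewrite -[in X in (X^-1 * _)%g](mulg1 (o^-1 * s)%g) -tt !mulgA.
rewrite (@perm_braid_step _ m (o b) (o a)) ?invgM ?mulgVK //.
  by rewrite !permM permK transpositionE sb eqxx (gtn_eqF (ltnSn m)).
by rewrite !permM permK transpositionE sa eqxx.
Qed.

Lemma perm_step_adjacent (o o' s : {perm 'I_4}) (m : 'I_3) (a b : 'I_4) :
  s a = m :> nat -> s b = m.+1 :> nat -> (o a < o b)%N = (o' a < o' b)%N ->
  perm_step o s (s * transposition m)%g = perm_step o' s (s * transposition m)%g.
Proof. by move=> sa sb oab; rewrite !(perm_step_transposition _ sa sb) oab. Qed.

(* The path from [s] to [s'] by adjacent transpositions that remove inversions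
   only exchanges pairs on which [o] and [o'] agree. *)
Lemma perm_step_eq (o o' s s' : {perm 'I_4}) :
  (forall i j, (o i < o j)%N != (o' i < o' j)%N -> (s i < s j)%N = (s' i < s' j)%N) ->
  perm_step o s s' = perm_step o' s s'.
Proof.
have [N NE] : exists N : {perm 'I_4} -> nat, forall s, N s =
    #|[set ij : 'I_4 * 'I_4 | (s ij.1 < s ij.2)%N && (s' ij.2 < s' ij.1)%N]| by eexists.
have [n] := ubnP (N s); elim: n s => [s|n IH s Ns oo']; first by rewrite ltn0.
have [->|ss'] := eqVneq s s'; first by rewrite !perm_step1.
have [m [a [b [sa sb s'ba]]]] := descent ss'.
have sab : (s a < s b)%N by rewrite sa sb.
have oab : (o a < o b)%N = (o' a < o' b)%N.
  by apply: contraTeq s'ba => /oo'; rewrite sab => /esym; rewrite -leqNgt => /ltnW.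
have oba : (o b < o a)%N = (o' b < o' a)%N.
  apply: contraTeq s'ba => /oo'; rewrite ltnNge (ltnW sab) /= => /esym/negbT.
  by rewrite -leqNgt.
pose s1 := (s * transposition m)%g.
have s1ba : (s1 b < s1 a)%N.
  by rewrite !permM !transpositionE sa sb !eqxx (gtn_eqF (ltnSn m)).
have swap i j := @swap_order s m a b i j sa sb.
have step1 : perm_step o s s1 = perm_step o' s s1 := perm_step_adjacent sa sb oab.
suff step2 : perm_step o s1 s' = perm_step o' s1 s'.
  exact (etrans (esym (perm_stepM o s s1 s'))
    (etrans (f_equal2 (fun x y => x * y)%g step1 step2) (perm_stepM o' s s1 s'))).
apply: IH; last first.
  move=> i j oij; rewrite -(oo' _ _ oij).
  have [->//|/swap] := eqVneq (s i < s j)%N (s1 i < s1 j)%N.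
  by case=> -[ia jb]; move: oij; rewrite ia jb ?oab ?oba eqxx.
rewrite ltnS in Ns; apply: (leq_trans _ Ns) => {Ns}; rewrite !NE; apply: proper_card;
  apply/properP; split.
  apply/fintype.subsetP => -[i j]; rewrite !inE /= => /andP[s1ij s'ji]; rewrite s'ji andbT.
  have [//|sji] := ltnP (s i) (s j).
  have /swap [] : (s i < s j)%N != (s1 i < s1 j)%N by rewrite s1ij ltnNge sji.
    by case=> ia jb; rewrite ia jb leqNgt sab in sji.
  by case=> ib ja; rewrite ib ja ltnNge (ltnW s'ba) in s'ji.
exists (a, b); rewrite !inE /= ?sab ?s'ba //.
by rewrite ltnNge (ltnW s1ba).
Qed.

(** * The braid cocycle on the configuration space *)

Section RankPerm.
Variable r : rel 'I_4.

Definition rank_perm : {perm 'I_4} :=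
  odflt 1%g [pick s : {perm 'I_4} | [forall i, forall j, (s i < s j)%N == r i j]].

Lemma rank_permP : irreflexive r -> transitive r -> (forall i j, i != j -> r i j || r j i) ->
  forall i j, (rank_perm i < rank_perm j)%N = r i j.
Proof.
move=> r_irr r_trans r_total.
have card4 i : (#|[set k | r k i]| < 4)%N.
  rewrite -[X in (_ < X)%N](card_ord 4) -cardsT; apply: proper_card; apply/properP.
  by split; [exact: finset.subsetT|exists i; rewrite !inE ?r_irr].
pose q i : 'I_4 := Ordinal (card4 i).
have q_mono i j : r i j -> (q i < q j)%N.
  move=> ij; apply: proper_card; apply/properP; split.
    by apply/fintype.subsetP => k; rewrite !inE => /r_trans; exact.
  by exists i; rewrite !inE ?r_irr.
have qE i j : (q i < q j)%N = r i j.
  apply/idP/idP => [qij|]; last exact: q_mono.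
  have [ij|ij] := eqVneq i j; first by rewrite ij ltnn in qij.
  by case/orP: (r_total _ _ ij) => // /q_mono; rewrite ltnNge (ltnW qij).
have q_inj : injective q.
  move=> i j qij; apply/eqP; apply/negPn/negP => /r_total; rewrite -!qE qij.
  by rewrite ltnn.
move=> i j; rewrite /rank_perm; case: pickP => [s /forallP/(_ i)/forallP/(_ j)/eqP //|].
move/(_ (perm q_inj))/negbT/forallPn => [k /forallPn[l]].
by rewrite !permE qE eqxx.
Qed.

End RankPerm.

Section Config.
Variable R : realType.
Implicit Types (P Q S : 'I_4 -> R * R) (o : {perm 'I_4}) (e : R).

(** The punctures lie in pairs on two vertical lines, so an order by abscissa alone would not even
    separate them. *)
Definition lex_lt (z w : R * R) : bool := (z.1 < w.1) || (z.1 == w.1) && (z.2 < w.2).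

Lemma lex_lt_irr : irreflexive lex_lt.
Proof. by move=> z; rewrite /lex_lt !ltxx andbF. Qed.

Lemma lex_lt_trans : transitive lex_lt.
Proof.
move=> w z v /orP[zw|/andP[/eqP zw zw2]] /orP[wv|/andP[/eqP wv wv2]]; rewrite /lex_lt.
- by rewrite (lt_trans zw wv).
- by rewrite -wv zw.
- by rewrite zw wv.
- by rewrite zw wv eqxx (lt_trans zw2 wv2) orbT.
Qed.

Lemma lex_lt_total z w : z != w -> lex_lt z w || lex_lt w z.
Proof.
case: z w => [z1 z2] [w1 w2]; rewrite /lex_lt xpair_eqE /=.
by case: (ltgtP z1 w1) => //= _; rewrite neq_lt.
Qed.

Definition x_rank P : {perm 'I_4} := rank_perm (fun i j => lex_lt (P i) (P j)).

(** Ordering by this map means ordering by x + y first. A point with smaller x + y is to the left of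
    or below the other, and by [chart_tilt_rank] this survives small displacements of separated
    points. *)
Definition tilt (z : R * R) : R * R := (z.1 + z.2, z.1).

Definition tilt_rank P : {perm 'I_4} := x_rank (tilt \o P).

Lemma x_rankE P : injective P -> forall i j, (x_rank P i < x_rank P j)%N = lex_lt (P i) (P j).
Proof.
move=> P_inj; apply: rank_permP => [i|j i k|i j ij].
- exact: lex_lt_irr.
- exact: lex_lt_trans.
- by apply: lex_lt_total; rewrite (inj_eq P_inj).
Qed.

Lemma tilt_inj : injective tilt.
Proof. by move=> [x y] [x' y'] [/[swap] -> /addrI ->]. Qed.

Lemma tilt_rankE P : injective P ->
  forall i j, (tilt_rank P i < tilt_rank P j)%N = lex_lt (tilt (P i)) (tilt (P j)).
Proof. by move=> P_inj; apply: x_rankE; exact: inj_comp tilt_inj P_inj. Qed.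

Lemma x_rank_perm P (s : {perm 'I_4}) : injective P -> x_rank (P \o s) = (s * x_rank P)%g.
Proof.
move=> P_inj; apply: same_order_perm => i j.
by rewrite !permM !x_rankE //; exact: inj_comp P_inj perm_inj.
Qed.

Definition chart o P : Prop :=
  forall i j, (o i < o j)%N -> (P i).1 < (P j).1 \/ (P i).2 < (P j).2.

Definition chart_step o P Q : B4 := perm_step o (x_rank P) (x_rank Q).

End Config.

(* The braid of a small displacement from [P] to [Q].  A chart is an order such
   that earlier points are on the left of or below later ones, so that a point
   overtaking a later one passes below it; the tilted order is a chart around [P]. *)
HB.lock Definition cross (R : realType) (P Q : 'I_4 -> R * R) : B4 :=
  chart_step (tilt_rank P) P Q.

Section Cocycle.
Variable R : realType.
Implicit Types (P Q S : 'I_4 -> R * R) (o : {perm 'I_4}) (e : R).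

Definition separated e P : Prop :=
  forall i j, i != j -> e <= `|(P i).1 - (P j).1| \/ e <= `|(P i).2 - (P j).2|.

(** Displacements below e / 8 change a difference of coordinates of two points by less than e / 4,
    so a coordinate in which they are e apart keeps its order. *)
Definition close e P Q : Prop :=
  forall i, `|(P i).1 - (Q i).1| < e / 8 /\ `|(P i).2 - (Q i).2| < e / 8.

Lemma separated_inj e P : 0 < e -> separated e P -> injective P.
Proof.
move=> e0 sP i j Pij; apply/eqP; apply/negPn/negP => /sP.
by rewrite Pij !subrr normr0; case; rewrite leNgt e0.
Qed.

Lemma chart_tilt_rank e P Q : 0 < e -> separated e P -> close e P Q -> chart (tilt_rank P) Q.
Proof.
move=> e0 sP cPQ i j; rewrite tilt_rankE; last exact: separated_inj sP.
have [->|ij] := eqVneq i j; first by rewrite lex_lt_irr.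
rewrite /lex_lt /= => u; have {u} : (P i).1 + (P i).2 <= (P j).1 + (P j).2.
  by case/orP: u => [/ltW//|/andP[/eqP <- _]].
have [ci1 ci2] := cPQ i; have [cj1 cj2] := cPQ j; have := sP _ _ ij.
rewrite !ler_normr; move: ci1 ci2 cj1 cj2; rewrite !ltr_norml.
move=> /andP[? ?] /andP[? ?] /andP[? ?] /andP[? ?] sij ?.
have [ltx|lex] := ltP (Q i).1 (Q j).1; [by left|right].
by case: sij => /orP[] ?; lra.
Qed.

(** The choice of chart is immaterial: two points on which the charts disagree have distinct
    abscissas that keep their order from [P] to [Q], so this pair is not exchanged and
    [perm_step_eq] applies. *)
Lemma cross_chart e o P Q : 0 < e -> separated e P -> close e P Q -> injective Q ->
  chart o P -> chart o Q -> cross P Q = chart_step o P Q.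
Proof.
move=> e0 sP cPQ Q_inj oP oQ; have P_inj := separated_inj e0 sP.
rewrite cross.unlock; apply: perm_step_eq => i j; rewrite tilt_rankE // !x_rankE //.
have [->|ij] := eqVneq i j; first by rewrite !lex_lt_irr ltnn.
have gap k l : k != l -> (o k < o l)%N -> ~~ lex_lt (tilt (P k)) (tilt (P l)) ->
    lex_lt (P k) (P l) /\ lex_lt (Q k) (Q l) \/ lex_lt (P l) (P k) /\ lex_lt (Q l) (Q k).
  move=> kl okl; have := oP _ _ okl; have := oQ _ _ okl; have := sP _ _ kl.
  have [ck1 ck2] := cPQ k; have [cl1 cl2] := cPQ l.
  move: ck1 ck2 cl1 cl2; rewrite !ler_normr !ltr_norml.
  move=> /andP[? ?] /andP[? ?] /andP[? ?] /andP[? ?] skl oQkl oPkl.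
  rewrite /lex_lt /= negb_or -leNgt => /andP[? _].
  have [Px|Px] := ltP (P k).1 (P l).1.
    left; suff -> : (Q k).1 < (Q l).1 by [].
    by case: oQkl => // ?; case: skl => /orP[] ?; lra.
  have Py : (P k).2 < (P l).2 by case: oPkl => // ?; lra.
  right; suff [-> ->] : (P l).1 < (P k).1 /\ (Q l).1 < (Q k).1 by [].
  by case: skl => /orP[] ?; split; lra.
have lt_asym (z w : R * R) : lex_lt z w -> lex_lt w z = false.
  by move=> zw; apply/negbTE/negP => /(lex_lt_trans zw); rewrite lex_lt_irr.
have [oij|oij] := ltnP (o i) (o j) => tij.
  have {tij} : ~~ lex_lt (tilt (P i)) (tilt (P j)) by move: tij; case: lex_lt.
  by case/(gap _ _ ij oij) => -[Pij Qij]; rewrite ?(lt_asym _ _ Pij) ?(lt_asym _ _ Qij) ?Pij ?Qij.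
have oji : (o j < o i)%N by rewrite ltn_neqAle oij (inj_eq val_inj) (inj_eq perm_inj) eq_sym ij.
have {tij} tij : lex_lt (tilt (P i)) (tilt (P j)) by move: tij; case: lex_lt.
have tji : ~~ lex_lt (tilt (P j)) (tilt (P i)) by rewrite lt_asym.
rewrite eq_sym in ij.
by case/(gap _ _ ij oji): tji => -[Pij Qij];
  rewrite ?(lt_asym _ _ Pij) ?(lt_asym _ _ Qij) ?Pij ?Qij.
Qed.

Lemma chart_stepM o P Q S : (chart_step o P Q * chart_step o Q S)%g = chart_step o P S.
Proof. exact: perm_stepM. Qed.

(** All three crossings can be computed in one chart, the tilted order at [P], where the product
    telescopes. *)
Lemma crossM e P Q S : 0 < e -> separated e P -> separated e Q -> separated e S ->
  close e P Q -> close e P S -> close e Q S -> (cross P Q * cross Q S)%g = cross P S.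
Proof.
move=> e0 sP sQ sS cPQ cPS cQS.
rewrite (@cross_chart e (tilt_rank P) Q S) //; first rewrite cross.unlock.
- exact: chart_stepM.
- exact: separated_inj sS.
- exact: chart_tilt_rank cPQ.
- exact: chart_tilt_rank cPS.
Qed.

Lemma cross1 P : cross P P = 1%g.
Proof. by rewrite cross.unlock; exact: perm_step1. Qed.

Lemma cross_perm P Q (s : {perm 'I_4}) : injective P -> injective Q ->
  cross (P \o s) (Q \o s) = cross P Q.
Proof.
move=> P_inj Q_inj; rewrite cross.unlock /chart_step /perm_step /tilt_rank.
rewrite (_ : @tilt R \o (P \o s) = (@tilt R \o P) \o s) // !x_rank_perm //; last first.
  exact: inj_comp (@tilt_inj R) P_inj.
by rewrite invgM -!mulgA !(mulgA s^-1%g) mulVg !mul1g.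
Qed.

End Cocycle.

(** * Holonomy of paths of configurations *)

Section Holonomy.
Variable R : realType.
Implicit Types (P Q : 'I_4 -> R * R) (c : R -> 'I_4 -> R * R).
Implicit Types (h : R * R -> 'I_4 -> R * R) (o : {perm 'I_4}).
Local Open Scope classical_set_scope.

Lemma compact_uniform (U V : pseudoMetricType R) (f : U -> V) (K : set U) (e : R) :
  continuous f -> compact K -> 0 < e ->
  exists2 d : R, 0 < d & forall x y, K x -> ball x d y -> ball (f x) e (f y).
Proof.
move=> cf /compact_near_coveringP cK e0.
pose Pr (d : R) (x : U) := forall y, ball x d y -> ball (f x) e (f y).
have /cK : forall x, K x -> \forall x' \near x & d \near 0^'+, Pr d x'.
  move=> x Kx; have e2 : 0 < e / 2 by rewrite divr_gt0.
  have /nbhs_ballP[d /= d0 fd] : nbhs x (f @^-1` ball (f x) (e / 2)).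
    exact: cf (nbhsx_ballx _ _ e2).
  have d2 : 0 < d / 2 by rewrite divr_gt0.
  exists (ball x (d / 2), [set r | r < d / 2]) => /=.
    by split; [exact: nbhsx_ballx|exact: nbhs_right_lt].
  move=> [x' r] /= [xx' rd] y x'y.
  apply: (@ball_split _ _ (f x)).
    by apply/ball_sym/fd; apply: le_ball xx'; rewrite ler_pdivrMr // ler_peMr ?ltW ?ltr1n.
  apply: fd; apply: (@ball_split _ _ x') => //; apply: le_ball x'y; exact: ltW.
move=> near_d.
have : \forall d \near 0^'+, 0 < d /\ (K `<=` Pr d).
  by near=> d; split; [near: d; exact: nbhs_right_gt|near: d; exact: near_d].
by case/filter_ex => d [d0 Kd]; exists d => // x y /Kd; exact.
Unshelve. all: by end_near.
Qed.

Definition unit_interval : set R := [set t | 0 <= t <= 1].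
Definition unit_square : set (R * R) := [set p | unit_interval p.1 /\ unit_interval p.2].

Lemma unit_interval_compact : compact unit_interval.
Proof.
have -> : unit_interval = `[0, 1]%classic by apply/seteqP; split=> t; rewrite /= in_itv.
exact: segment_compact.
Qed.

Lemma unit_square_compact : compact unit_square.
Proof. exact: compact_setX unit_interval_compact unit_interval_compact. Qed.

Lemma config_separated (U : pseudoMetricType R) (h : U -> 'I_4 -> R * R) (K : set U) :
  (forall i, continuous (h ^~ i)) -> compact K -> (forall x, K x -> injective (h x)) ->
  exists2 e : R, 0 < e & forall x, K x -> separated e (h x).
Proof.
move=> ch cK h_inj.
have [->|K0] := eqVneq K set0; first by exists 1.
have {}K0 : K !=set0 by apply/set0P.
pose g i j (x : U) : R := `|(h x i).1 - (h x j).1| + `|(h x i).2 - (h x j).2|.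
have cg i j : continuous (g i j).
  have c1 k : continuous (fun x => (h x k).1).
    by move=> x; apply: (@continuous_comp _ _ _ (h ^~ k) fst); [exact: ch|exact: cvg_fst].
  have c2 k : continuous (fun x => (h x k).2).
    by move=> x; apply: (@continuous_comp _ _ _ (h ^~ k) snd); [exact: ch|exact: cvg_snd].
  move=> x; apply: cvgD; apply: cvg_norm; apply: cvgB;
    by [exact: c1|exact: c2].
have sep_ij i j : \forall e \near 0^'+, i != j -> forall x, K x ->
    e <= `|(h x i).1 - (h x j).1| \/ e <= `|(h x i).2 - (h x j).2|.
  have [<-|ij] := eqVneq i j; first exact: nearW.
  have [x0 Kx0 gmin] := compact_EVT_min K0 cK (continuous_subspaceT (cg i j)).
  have g0 : 0 < g i j x0.
    rewrite lt_neqAle addr_ge0 ?normr_ge0 // andbT eq_sym paddr_eq0 ?normr_ge0 //.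
    rewrite !normr_eq0 !subr_eq0; apply: contra ij => /andP[/eqP e1 /eqP e2].
    rewrite inE in Kx0; apply/eqP/(h_inj _ Kx0).
    by rewrite [LHS]surjective_pairing [RHS]surjective_pairing e1 e2.
  have g2 : 0 < g i j x0 / 2 by rewrite divr_gt0.
  apply: filterS (nbhs_right_lt g2) => e eg _ x Kx.
  have := gmin x (mem_set Kx); rewrite {2}/g => gx.
  have [|lt1] := leP e `|(h x i).1 - (h x j).1|; [by left|right].
  have [//|lt2] := leP e `|(h x i).2 - (h x j).2|.
  exfalso; lra.
have : \forall e \near 0^'+, 0 < e /\ forall ij : 'I_4 * 'I_4, ij.1 != ij.2 ->
    forall x, K x -> e <= `|(h x ij.1).1 - (h x ij.2).1| \/ e <= `|(h x ij.1).2 - (h x ij.2).2|.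
  apply: filterI; first exact: nbhs_right_gt.
  by apply: (filter_forall _ (fun ij => sep_ij ij.1 ij.2)).
case/filter_ex => e [e0 sep_e].
by exists e => // x Kx i j ij; exact: (sep_e (i, j)).
Qed.

Lemma config_uniform (U : pseudoMetricType R) (h : U -> 'I_4 -> R * R) (K : set U) :
  (forall i, continuous (h ^~ i)) -> compact K -> (forall x, K x -> injective (h x)) ->
  exists e d : R, [/\ 0 < e, 0 < d, forall x, K x -> separated e (h x)
    & forall x y, K x -> ball x d y -> close e (h x) (h y)].
Proof.
move=> ch cK h_inj; have [e e0 sep] := config_separated ch cK h_inj.
have e8 : 0 < e / 8 by rewrite divr_gt0.
have unif_i i : \forall d \near 0^'+, forall x y, K x -> ball x d y ->
    ball (h x i) (e / 8) (h y i).
  have [d d0 hd] := compact_uniform (ch i) cK e8.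
  apply: filterS (nbhs_right_lt d0) => d' d'd x y Kx xy; apply: hd => //.
  by apply: le_ball xy; exact: ltW.
have : \forall d \near 0^'+, 0 < d /\ forall i, forall x y, K x -> ball x d y ->
    ball (h x i) (e / 8) (h y i).
  apply: filterI; first exact: nbhs_right_gt.
  by apply: (filter_forall _ unif_i).
case/filter_ex => d [d0 hd].
exists e, d; split=> // x y Kx xy i.
by have [] := hd i x y Kx xy.
Qed.

(** [L] is a primitive of the cocycle [cross] at small scale. It plays the role of a lift to a
    covering of the configuration space with fibre B_4. *)
Definition lift_on (U : pseudoMetricType R) (K : set U) (h : U -> 'I_4 -> R * R) (L : U -> B4) :
    Prop :=
  exists2 d : R, 0 < d &
    forall x y, K x -> K y -> ball x d y -> L y = (L x * cross (h x) (h y))%g.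

Lemma ball1E (x y d : R) : ball x d y = (`|x - y| < d) :> Prop.
Proof. by []. Qed.

(* The configurations parametrized by the segment from the origin to a point
   are followed step by step; the configuration at the origin is common to all
   segments. *)
Lemma lift_exists h : (forall i, continuous (h ^~ i)) ->
  (forall p, unit_square p -> injective (h p)) -> exists L, lift_on unit_square h L.
Proof.
move=> ch h_inj; have [e [d [e0 d0 sep unif]]] := config_uniform ch unit_square_compact h_inj.
have [N N0 Nd] : exists2 N : nat, (0 < N)%N & N%:R^-1 < d / 2.
  have d2 : 0 < d / 2 by rewrite divr_gt0.
  exists (Num.bound (d / 2)^-1).+1 => //.
  rewrite invf_plt ?posrE ?ltr0Sn //.
  apply: lt_le_trans (archi_boundP _) _; first by rewrite invr_ge0 ltW.
  by rewrite ler_nat.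
pose N' : R := N%:R.
have N'0 : 0 < N' by rewrite ltr0n.
pose pt (k : nat) (p : R * R) : R * R := (k%:R / N' * p.1, k%:R / N' * p.2).
pose L n p := (\prod_(k <- iota 0 n) cross (h (pt k p)) (h (pt k.+1 p)))%g.
have kN k : (k <= N)%N -> 0 <= k%:R / N' <= 1.
  by move=> kN; rewrite divr_ge0 ?ler0n ?ler_pdivrMr ?mul1r ?ler_nat // ltW.
have sq k p : (k <= N)%N -> unit_square p -> unit_square (pt k p).
  move=> /kN /andP[k0 k1] [/andP[p0 p1] /andP[q0 q1]].
  by split; rewrite /unit_interval /=; apply/andP; split; nra.
have near_pt k p q : (k <= N)%N -> ball p (d / 2) q -> ball (pt k p) (d / 2) (pt k q).
  move=> /kN /andP[k0 k1] [] /=; rewrite !ball1E => pq1 pq2.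
  split; rewrite /= ball1E -mulrBr normrM (ger0_norm k0).
    by apply: le_lt_trans pq1; rewrite ler_piMl.
  by apply: le_lt_trans pq2; rewrite ler_piMl.
have step k p : unit_square p -> ball (pt k p) (d / 2) (pt k.+1 p).
  have E (x : R) : 0 <= x <= 1 -> `|k%:R / N' * x - k.+1%:R / N' * x| < d / 2.
    move=> /andP[x0 x1]; rewrite -mulrBl -mulrBl -addn1 natrD opprD addrA subrr add0r.
    have Ni : 0 < N'^-1 by rewrite invr_gt0.
    rewrite mulN1r normrM normrN (gtr0_norm Ni) (ger0_norm x0).
    by apply: le_lt_trans Nd; rewrite ler_piMr // ltW.
  by move=> [p1 p2]; split; [exact: E p1|exact: E p2].
exists (L N), (d / 2); first by rewrite divr_gt0.
move=> p q Kp Kq pq.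
(* The two chains of configurations leading to [p] and [q] are joined by rungs; each cell of the
   ladder is cut by a diagonal into two triangles, to which [crossM] applies. *)
have ladder n : (n <= N)%N -> (L n p * cross (h (pt n p)) (h (pt n q)))%g = L n q.
  elim: n => [|n IH] nN.
    have pt0 x : pt 0%N x = (0, 0) by rewrite /pt !mul0r.
    by rewrite /L !big_nil !pt0 cross1 mulg1.
  have LS x : L n.+1 x = (L n x * cross (h (pt n x)) (h (pt n.+1 x)))%g.
    by rewrite /L -[X in iota 0 X]addn1 iotaD big_cat /= big_seq1.
  have nN' := ltnW nN.
  have cl x y : unit_square x -> ball x (d / 2) y -> close e (h x) (h y).
    move=> Kx xy; apply: unif => //; apply: le_ball xy.
    by rewrite ler_pdivrMr // ler_peMr ?ltW ?ltr1n.
  rewrite !LS -(IH nN') -!mulgA; congr (_ * _)%g.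
  have cl2 : close e (h (pt n p)) (h (pt n.+1 q)).
    apply: unif; first exact: sq.
    by apply: (ball_split (near_pt _ _ _ nN' pq)); exact: step.
  have sap := sep _ (sq _ _ nN' Kp); have sap' := sep _ (sq _ _ nN Kp).
  have saq := sep _ (sq _ _ nN' Kq); have saq' := sep _ (sq _ _ nN Kq).
  have -> := crossM e0 sap sap' saq' (cl _ _ (sq _ _ nN' Kp) (step n p Kp)) cl2
    (cl _ _ (sq _ _ nN Kp) (near_pt _ _ _ nN pq)).
  by have -> := crossM e0 sap saq saq' (cl _ _ (sq _ _ nN' Kp) (near_pt _ _ _ nN' pq)) cl2
    (cl _ _ (sq _ _ nN' Kq) (step n q Kq)).
rewrite -(ladder N) //; congr (_ * cross (h _) (h _))%g;
  by rewrite /pt divff ?gt_eqF // !mul1r -surjective_pairing.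
Qed.

End Holonomy.

Section Paths.
Variable R : realType.
Implicit Types (P Q : 'I_4 -> R * R) (c : R -> 'I_4 -> R * R).
Implicit Types (h : R * R -> 'I_4 -> R * R) (o : {perm 'I_4}).
Local Open Scope classical_set_scope.
Local Notation I := (@unit_interval R).

(** Connectedness of an interval, for maps to a type without topology and with a uniform scale: the
    interval is cut into steps shorter than [d]. *)
Lemma locally_constant (T : Type) (D : R -> T) (a b d : R) : 0 < d -> a <= b ->
  (forall s t, a <= s <= b -> a <= t <= b -> `|s - t| < d -> D s = D t) -> D a = D b.
Proof.
move=> d0 ab Dloc.
have [N N0 Nd] : exists2 N : nat, (0 < N)%N & (b - a) / N%:R < d.
  exists (Num.bound ((b - a) / d)).+1 => //.
  rewrite ltr_pdivrMr ?ltr0Sn // mulrC -ltr_pdivrMr //.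
  apply: lt_le_trans (archi_boundP _) _; last by rewrite ler_nat.
  by rewrite divr_ge0 ?subr_ge0 // ltW.
pose pt (k : nat) : R := a + (b - a) * (k%:R / N%:R).
have N'0 : 0 < N%:R :> R by rewrite ltr0n.
have pt_ab k : (k <= N)%N -> a <= pt k <= b.
  move=> kN; have k0 : 0 <= k%:R / N%:R :> R by rewrite divr_ge0.
  have k1 : k%:R / N%:R <= 1 :> R by rewrite ler_pdivrMr // mul1r ler_nat.
  by rewrite /pt; apply/andP; split; nra.
have E k : (k <= N)%N -> D a = D (pt k).
  elim: k => [|k IH] kN; first by rewrite /pt mul0r mulr0 addr0.
  rewrite (IH (ltnW kN)); apply: Dloc; [exact/pt_ab/ltnW|exact: pt_ab|].
  have -> : pt k - pt k.+1 = - ((b - a) / N%:R) by rewrite /pt -addn1 natrD; field; rewrite gt_eqF.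
  by rewrite normrN ger0_norm // divr_ge0 ?subr_ge0 // ltW.
by rewrite (E N) // /pt divff ?gt_eqF // mulr1 addrC subrK.
Qed.

Definition config_path c : Prop :=
  (forall i, continuous (c ^~ i)) /\ forall t, I t -> injective (c t).

(** Two lifts differ by a constant left factor, so the value does not depend on the lift; the
    default 1 is taken only when no lift exists, which [path_lift_exists] excludes for configuration
    paths. *)
Definition hol c : B4 :=
  xget 1%g [set g : B4 | exists2 L, lift_on I c L & g = ((L 0%R)^-1 * L 1%R)%g].

Lemma in_unit_interval0 : I 0. Proof. by rewrite /unit_interval /= lexx ler01. Qed.
Lemma in_unit_interval1 : I 1. Proof. by rewrite /unit_interval /= lexx ler01. Qed.

Lemma lift_unique c L L' (a b : R) : lift_on I c L -> lift_on I c L' ->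
  0 <= a -> a <= b -> b <= 1 -> ((L a)^-1 * L b = (L' a)^-1 * L' b)%g.
Proof.
move=> [d d0 Ld] [d' d'0 L'd] a0 ab b1.
have dd0 : 0 < Num.min d d' by rewrite lt_min d0.
have : (L a * (L' a)^-1 = L b * (L' b)^-1)%g.
  apply: (@locally_constant _ (fun t => L t * (L' t)^-1)%g _ _ _ dd0 ab) => s t /andP[sa sb]
    /andP[ta tb].
  rewrite lt_min => /andP[st st'].
  have Is : I s by rewrite /unit_interval /= (le_trans a0) ?(le_trans _ b1).
  have It : I t by rewrite /unit_interval /= (le_trans a0) ?(le_trans _ b1).
  by rewrite (Ld s t) // (L'd s t) // invgM mulgA mulgK.
by move=> E'; rewrite -[in LHS](mulgVK (L' b) (L b)) -E' !mulgA mulVg mul1g.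
Qed.

Lemma holE c L : lift_on I c L -> hol c = ((L 0%R)^-1 * L 1%R)%g.
Proof.
move=> cL; rewrite /hol; case: xgetP => [g _ [L' cL' ->]|/(_ _)/(_ (ex_intro2 _ _ L cL erefl)) []].
by apply: (lift_unique cL' cL); rewrite ?lexx ?ler01.
Qed.

Lemma path_lift_exists c : config_path c -> exists L, lift_on I c L.
Proof.
move=> [cc c_inj].
have [||L [d d0 Ld]] := @lift_exists R (fun p => c p.1).
- move=> i p; apply: (@continuous_comp _ _ _ fst (c ^~ i)); [exact: cvg_fst|exact: cc].
- by move=> p [p1 _]; exact: c_inj.
exists (fun t => L (t, 0)), d => // s t Is It st.
apply: (Ld (s, 0) (t, 0)); first by split=> //; exact: in_unit_interval0.
  by split=> //; exact: in_unit_interval0.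
by split=> //=; exact: ballxx.
Qed.

(** Homotopy invariance with moving ends: one lift over the whole square restricts to lifts on all
    four sides. *)
Lemma hol_square h : (forall i, continuous (h ^~ i)) ->
  (forall p, unit_square p -> injective (h p)) ->
  (hol (fun r => h (0%R, r)) * hol (fun s => h (s, 1%R)) =
   hol (fun s => h (s, 0%R)) * hol (fun r => h (1%R, r)))%g.
Proof.
move=> ch h_inj; have [L [d d0 Ld]] := lift_exists ch h_inj.
have lift_l a : I a -> lift_on I (fun r => h (a, r)) (fun r => L (a, r)).
  move=> Ia; exists d => // s t Is It st; apply: Ld => //.
  by split=> //=; exact: ballxx.
have lift_r a : I a -> lift_on I (fun s => h (s, a)) (fun s => L (s, a)).
  move=> Ia; exists d => // s t Is It st; apply: Ld => //.
  by split=> //=; exact: ballxx.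
rewrite (holE (lift_l 0 in_unit_interval0)) (holE (lift_l 1 in_unit_interval1)).
rewrite (holE (lift_r 0 in_unit_interval0)) (holE (lift_r 1 in_unit_interval1)).
by rewrite !mulgA !mulgK.
Qed.

Lemma hol_perm c (s : {perm 'I_4}) : config_path c -> hol (fun t => c t \o s) = hol c.
Proof.
move=> cc; have [L cL] := path_lift_exists cc; have [_ c_inj] := cc.
rewrite (holE cL); apply: holE; case: cL => d d0 Ld; exists d => // x y Ix Iy xy.
by rewrite cross_perm; [exact: Ld|exact: c_inj|exact: c_inj].
Qed.

Lemma lift_comp c L (f : R -> R) : lift_on I c L -> continuous f ->
  (forall t, I t -> I (f t)) -> lift_on I (c \o f) (L \o f).
Proof.
move=> [d d0 Ld] cf If.
have [d' d'0 fd'] := compact_uniform cf (@unit_interval_compact R) d0.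
by exists d' => // x y Ix Iy xy; apply: Ld; [exact: If|exact: If|exact: fd'].
Qed.

(** As long as one chart is valid the steps telescope, so only the two end configurations matter,
    however far the points travel. *)
Lemma lift_chart c L o (a b : R) : config_path c -> lift_on I c L -> 0 <= a -> a <= b -> b <= 1 ->
  (forall t, a <= t <= b -> chart o (c t)) -> L b = (L a * chart_step o (c a) (c b))%g.
Proof.
move=> [cc c_inj] [d d0 Ld] a0 ab b1 oc.
have [e [d' [e0 d'0 sep unif]]] := config_uniform cc (@unit_interval_compact R) c_inj.
have dd0 : 0 < Num.min d d' by rewrite lt_min d0.
have {}E : (L a * chart_step o (c a) (c a) = L b * chart_step o (c b) (c a))%g.
  apply: (@locally_constant _ (fun t => L t * chart_step o (c t) (c a))%g _ _ _ dd0 ab) => s t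
    sab tab.
  rewrite lt_min => /andP[st st']; case/andP: (sab) => sa sb; case/andP: (tab) => ta tb.
  have Is : I s by rewrite /unit_interval /= (le_trans a0) ?(le_trans _ b1).
  have It : I t by rewrite /unit_interval /= (le_trans a0) ?(le_trans _ b1).
  have cst := cross_chart e0 (sep _ Is) (unif _ _ Is st') (c_inj _ It) (oc _ sab) (oc _ tab).
  by rewrite (Ld s t) // cst -mulgA chart_stepM.
apply: (mulIg (chart_step o (c b) (c a))); rewrite -E -mulgA chart_stepM //.
Qed.

Lemma hol_charts c o o' (m : R) : config_path c -> 0 <= m -> m <= 1 ->
  (forall t, 0 <= t <= m -> chart o (c t)) -> (forall t, m <= t <= 1 -> chart o' (c t)) ->
  hol c = (chart_step o (c 0%R) (c m) * chart_step o' (c m) (c 1%R))%g.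
Proof.
move=> cc m0 m1 oc oc'; have [L cL] := path_lift_exists cc.
rewrite (holE cL) (lift_chart cc cL m0 m1 _ oc') // (lift_chart cc cL _ m0 m1 oc) //.
by rewrite !mulgA mulVg mul1g.
Qed.

Lemma hol_prop c (X : set B4) : config_path c -> X 1%g ->
  (forall g g', X g -> X g' -> X (g * g')%g) ->
  (forall s t, I s -> I t -> X (cross (c s) (c t))) -> X (hol c).
Proof.
move=> cc X1 XM Xc; have [L cL] := path_lift_exists cc; rewrite (holE cL).
case: cL => d d0 Ld.
suff <- : X ((L 0%R)^-1 * L 0%R)%g = X ((L 0%R)^-1 * L 1%R)%g by rewrite mulVg.
apply: (@locally_constant _ (fun t => X ((L 0%R)^-1 * L t)%g) _ _ _ d0 ler01) => s t Is It st.
have sym : `|t - s| < d by rewrite distrC.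
by apply/propext; split=> XL; [rewrite (Ld s t)|rewrite (Ld t s)] => //; rewrite mulgA; exact/XM/Xc.
Qed.

End Paths.

(** * Half twists of the punctured disc *)

Section HalfTwists.
Variable R : realType.
Implicit Types (c z : R * R) (a b e : R).

Lemma elliptic_twist_continuous c a b :
  continuous (fun p : R * (R * R) => elliptic_twist c a b p.1 p.2).
Proof.
pose T := (R * (R * R))%type.
have c1 : continuous (fun p : T => p.1) by move=> p; exact: cvg_fst.
have c2 : continuous (fun p : T => p.2) by move=> p; exact: cvg_snd.
have c21 : continuous (fun p : T => p.2.1).
  by move=> p; apply: (@continuous_comp _ _ _ snd fst); [exact: cvg_snd|exact: cvg_fst].
have c22 : continuous (fun p : T => p.2.2).
  by move=> p; apply: (@continuous_comp _ _ _ snd snd); [exact: cvg_snd|exact: cvg_snd].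
have cc (k : R) : continuous (fun _ : T => k) by move=> p; exact: cvg_cst.
have cD (f g : T -> R) : continuous f -> continuous g -> continuous (fun p => f p + g p).
  by move=> cf cg p; apply: cvgD; [exact: cf|exact: cg].
have cB (f g : T -> R) : continuous f -> continuous g -> continuous (fun p => f p - g p).
  by move=> cf cg p; apply: cvgB; [exact: cf|exact: cg].
have cM (f g : T -> R) : continuous f -> continuous g -> continuous (fun p => f p * g p).
  by move=> cf cg p; apply: cvgM; [exact: cf|exact: cg].
pose u (p : T) := a * (p.2.1 - c.1); pose v (p : T) := b * (p.2.2 - c.2).
pose w (p : T) := Num.min 1 (Num.max 0 (2 - 4 * (u p ^+ 2 + v p ^+ 2))).
pose th (p : T) := pi * p.1 * w p.
have cu : continuous u by apply: (cM) => //; exact: (cB).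
have cv : continuous v by apply: (cM) => //; exact: (cB).
have cw : continuous w.
  move=> p; apply: (@continuous_min R T (fun=> 1) (fun p => Num.max 0 (2 - 4 * (u p ^+ 2 + v p ^+
    2))) p); first exact: cc.
  apply: (@continuous_max R T (fun=> 0) (fun p => 2 - 4 * (u p ^+ 2 + v p ^+ 2)) p);
    first exact: cc.
  by apply: (cB) => //; apply: (cM) => //; apply: (cD); apply: (cM).
have cth : continuous th by apply: (cM) => //; apply: (cM).
have ccos : continuous (fun p => cos (th p)).
  by move=> p; apply: continuous_comp; [exact: cth|exact: continuous_cos].
have csin : continuous (fun p => sin (th p)).
  by move=> p; apply: continuous_comp; [exact: cth|exact: continuous_sin].
have cx : continuous (fun p => c.1 + (cos (th p) * u p - sin (th p) * v p) / a).
  by apply: (cD) => //; apply: (cM) => //; apply: (cB); apply: (cM).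
have cy : continuous (fun p => c.2 + (sin (th p) * u p + cos (th p) * v p) / b).
  by apply: (cD) => //; apply: (cM) => //; apply: (cD); apply: (cM).
by move=> p; exact: (cvg_pair (cx p) (cy p)).
Qed.

(* The twist preserves the quadratic form u^2 + v^2, on which its angle depends. *)
Lemma elliptic_twist_inj c a b e : a != 0 -> b != 0 -> injective (elliptic_twist c a b e).
Proof.
move=> a0 b0 [x y] [x' y']; rewrite /elliptic_twist /=.
set u := a * (x - _); set v := b * (y - _); set u' := a * (x' - _); set v' := b * (y' - _).
pose th (r : R) := pi * e * Num.min 1 (Num.max 0 (2 - 4 * r)).
rewrite -!/(th _).
have norm_th r p q : (cos (th r) * p - sin (th r) * q) ^+ 2 +
    (sin (th r) * p + cos (th r) * q) ^+ 2 = p ^+ 2 + q ^+ 2.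
  rewrite -[RHS]mul1r -(cos2Dsin2 (th r)); ring.
case=> /addrI /(divIf a0) E1 /addrI /(divIf b0) E2.
have rE : u ^+ 2 + v ^+ 2 = u' ^+ 2 + v' ^+ 2.
  by rewrite -(norm_th (u ^+ 2 + v ^+ 2)) E1 E2 norm_th.
move: E1 E2; rewrite -rE; set C := cos _; set S := sin _ => E1 E2.
have CS : C ^+ 2 + S ^+ 2 = 1 by exact: cos2Dsin2.
have uu : u = u'.
  have : C * (C * u - S * v) + S * (S * u + C * v) = C * (C * u' - S * v') + S * (S * u' + C * v').
    by rewrite E1 E2.
  have rot p q : C * (C * p - S * q) + S * (S * p + C * q) = p.
    by rewrite -[RHS]mul1r -CS; ring.
  by rewrite !rot.
have vv : v = v'.
  have : C * (S * u + C * v) - S * (C * u - S * v) = C * (S * u' + C * v') - S * (C * u' - S * v').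
    by rewrite E1 E2.
  have rot p q : C * (S * p + C * q) - S * (C * p - S * q) = q.
    by rewrite -[RHS]mul1r -CS; ring.
  by rewrite !rot.
by move: uu vv; rewrite /u /v => /(mulfI a0) /addIr -> /(mulfI b0) /addIr ->.
Qed.

Lemma elliptic_twist0 c a b z : a != 0 -> b != 0 -> elliptic_twist c a b 0 z = z.
Proof.
move=> a0 b0; rewrite /elliptic_twist !mulr0 !mul0r cos0 sin0 !mul1r !mul0r subr0 add0r.
by case: z => x y /=; congr (_, _); rewrite mulrC mulKf // addrC subrK.
Qed.

Lemma half_twist_continuous i : continuous (fun p : R * (R * R) => half_twist i p.1 p.2).
Proof.
by rewrite /half_twist; case: (val i) => [|[|?]]; exact: elliptic_twist_continuous.
Qed.

Lemma half_twist_inj i e : injective (@half_twist R i e).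
Proof.
by rewrite /half_twist; case: (val i) => [|[|?]]; apply: elliptic_twist_inj;
  rewrite ?oner_eq0 ?pnatr_eq0.
Qed.

Lemma half_twist0 i z : half_twist i 0 z = z.
Proof.
by rewrite /half_twist; case: (val i) => [|[|?]]; apply: elliptic_twist0;
  rewrite ?oner_eq0 ?pnatr_eq0.
Qed.

Lemma elliptic_twist_in c a b e z : (a * (z.1 - c.1)) ^+ 2 + (b * (z.2 - c.2)) ^+ 2 <= 4^-1 ->
  elliptic_twist c a b e z =
  (c.1 + (cos (pi * e) * (a * (z.1 - c.1)) - sin (pi * e) * (b * (z.2 - c.2))) / a,
   c.2 + (sin (pi * e) * (a * (z.1 - c.1)) + cos (pi * e) * (b * (z.2 - c.2))) / b).
Proof.
move=> r4; rewrite /elliptic_twist; set r := _ + _ in r4 *.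
rewrite (_ : Num.min 1 _ = 1) ?mulr1 //; apply/min_idPl.
by rewrite le_max; apply/orP; right; lra.
Qed.

Lemma elliptic_twist_out c a b e z : a != 0 -> b != 0 ->
  2^-1 <= (a * (z.1 - c.1)) ^+ 2 + (b * (z.2 - c.2)) ^+ 2 -> elliptic_twist c a b e z = z.
Proof.
move=> a0 b0 r2; rewrite -[RHS](elliptic_twist0 c z a0 b0) /elliptic_twist.
set r := _ + _ in r2 *; rewrite (_ : Num.min 1 _ = 0) ?mulr0 ?mul0r //.
by rewrite (max_idPl _) ?(min_idPr _) ?ler01 //; lra.
Qed.

Definition puncture (k : 'I_4) : R * R :=
  match nat_of_ord k with 0 => p1 R | 1 => p2 R | 2 => p3 R | _ => p4 R end.

(* The punctures moved by the rotation of angle [th] around the midpoint of T_i,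
   where [C = cos th] and [S = sin th]. *)
Definition twisted_puncture (i : 'I_3) (C S : R) (k : 'I_4) : R * R :=
  match val i, nat_of_ord k with
  | 0, 0 => (- C / 2, 2^-1 - S / 4)
  | 0, 1 => (C / 2, 2^-1 + S / 4)
  | 1, 1 => (2^-1 - S / 4, C / 2)
  | 1, 2 => (2^-1 + S / 4, - C / 2)
  | 2, 2 => (C / 2, - 2^-1 + S / 4)
  | 2, 3 => (- C / 2, - 2^-1 - S / 4)
  | _, _ => puncture k
  end.

Lemma half_twist_puncture i e k :
  half_twist i e (puncture k) = twisted_puncture i (cos (pi * e)) (sin (pi * e)) k.
Proof.
have n1 : (1 : R) != 0 by rewrite oner_eq0.
have n2 : (2 : R) != 0 by rewrite pnatr_eq0.
rewrite /half_twist /twisted_puncture.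
case: i k => [[|[|[|//]]] ilt] [[|[|[|[|//]]]] klt];
  rewrite /puncture /p1 /p2 /p3 /p4 /=.
(* The goals run over the pairs (i, k) in lexicographic order; the selected ones are those where the
   puncture is an end point of T_i, and there the twist is a rotation. The other punctures lie
   outside its support. *)
1,2,6,7,11,12: by rewrite elliptic_twist_in /=; [congr (_, _); field|lra].
all: by rewrite elliptic_twist_out //=; lra.
Qed.

Lemma letter_map_puncture (l : letter) k :
  letter_map l (puncture k) = puncture (transposition l.1 k).
Proof.
have CE : cos (pi * (if l.2 then -1 else 1)) = -1 :> R.
  by case: l.2; rewrite ?mulrN1 ?mulr1 ?cosN cospi.
have SE : sin (pi * (if l.2 then -1 else 1)) = 0 :> R.
  by case: l.2; rewrite ?mulrN1 ?mulr1 ?sinN sinpi ?oppr0.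
rewrite /letter_map half_twist_puncture CE SE /puncture transpositionE /twisted_puncture.
by case: l {CE SE} k => [[[|[|[|//]]] ?] b] [[|[|[|[|//]]]] ?];
  rewrite /= /puncture /p1 /p2 /p3 /p4 /=; congr (_, _); field.
Qed.

End HalfTwists.

(** * The holonomy of a half twist *)

Definition lists_order (s : seq 'I_4) (o : {perm 'I_4}) : Prop :=
  forall i, o i = index i s :> nat.

Section ListsOrder.
Variable s : seq 'I_4.
Hypotheses (s_uniq : uniq s) (s_size : size s = 4).

Lemma mem_lists_order i : i \in s.
Proof.
have /(uniq_min_size s_uniq)[] : {subset s <= enum 'I_4} by move=> k _; rewrite mem_enum.
  by rewrite size_enum_ord s_size.
by move=> _ ->; rewrite mem_enum.
Qed.

Lemma lists_order_exists : exists o, lists_order s o.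
Proof.
have lt4 i : (index i s < 4)%N by have := mem_lists_order i; rewrite -index_mem s_size.
have f_inj : injective (fun i => Ordinal (lt4 i)).
  move=> i j [] ij; rewrite -(nth_index i (mem_lists_order i)) ij nth_index //.
  exact: mem_lists_order.
by exists (perm f_inj) => i; rewrite permE.
Qed.

Lemma lists_order_nth o (k : 'I_4) i0 : lists_order s o -> (o^-1)%g k = nth i0 s k.
Proof.
move=> so; apply: (canLR (permK o)); apply/ord_inj.
by rewrite so index_uniq // s_size.
Qed.

End ListsOrder.

Section ListsConfig.
Variable R : realType.
Implicit Types (P Q : 'I_4 -> R * R).

Lemma x_rank_lists s P : injective P -> uniq s -> size s = 4 ->
  sorted (fun i j => lex_lt (P i) (P j)) s -> lists_order s (x_rank P).
Proof.
move=> P_inj us s4 s_sorted; have [p sp] := lists_order_exists us s4.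
suff -> : x_rank P = p by [].
have r_trans : transitive (fun i j => lex_lt (P i) (P j)) by move=> ? ? ?; exact: lex_lt_trans.
have lt_p i j : (p i < p j)%N -> lex_lt (P i) (P j).
  rewrite !sp; apply: (sorted_ltn_index r_trans s_sorted); exact: mem_lists_order.
apply: same_order_perm => i j; rewrite x_rankE //; apply/idP/idP => [ij|/lt_p //].
rewrite ltnNge; apply/negP; rewrite leq_eqVlt (inj_eq val_inj) (inj_eq perm_inj).
case/orP => [/eqP ji|/lt_p ji]; first by rewrite ji lex_lt_irr in ij.
by have := lex_lt_trans ij ji; rewrite lex_lt_irr.
Qed.

Lemma chart_lists s o P : lists_order s o -> uniq s -> size s = 4 ->
  pairwise (fun i j => ((P i).1 < (P j).1) || ((P i).2 < (P j).2)) s -> chart o P.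
Proof.
move=> so us s4 /(pairwiseP ord0) sP i j; rewrite !so => ij.
have im := mem_lists_order us s4 i; have jm := mem_lists_order us s4 j.
have := sP (index i s) (index j s); rewrite !inE !index_mem !nth_index //.
by move=> /(_ im jm ij) /orP.
Qed.

Lemma chart_step_lists so sP sQ o P Q : uniq so -> size so = 4 ->
  lists_order so o -> lists_order sP (x_rank P) -> lists_order sQ (x_rank Q) ->
  chart_step o P Q = ((braid (sorting_word 6 [seq index k sP | k <- so]))^-1 *
    braid (sorting_word 6 [seq index k sQ | k <- so]))%g.
Proof.
move=> us s4 oo oP oQ; rewrite /chart_step /perm_step perm_braid.unlock.
have values s p : lists_order s p -> perm_values (o^-1 * p)%g = [seq index k s | k <- so].
  move=> sp; apply: (@eq_from_nth _ 0%N); first by rewrite !size_map s4.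
  move=> k; rewrite size_map /= => k4.
  rewrite -[k in LHS]/(nat_of_ord (Ordinal k4)) perm_valuesE permM sp.
  by rewrite (lists_order_nth us s4 _ ord0 oo) (nth_map ord0) ?s4.
by rewrite (values _ _ oP) (values _ _ oQ).
Qed.

Lemma lex_lt_x (z w : R * R) : z.1 < w.1 -> lex_lt z w.
Proof. by rewrite /lex_lt => ->. Qed.

Lemma lex_lt_y (z w : R * R) : z.1 = w.1 -> z.2 < w.2 -> lex_lt z w.
Proof. by rewrite /lex_lt => -> ->; rewrite eqxx orbT. Qed.

End ListsConfig.

Ltac order_pair :=
  first [ done | by apply/orP; left; lra | by apply/orP; right; lra
        | by apply/orP; right; apply/andP; split; [apply/eqP; lra|lra] ].

Ltac order_pairs :=
  rewrite /twisted_puncture /lex_lt /p1 /p2 /p3 /p4 /=; repeat (apply/andP; split).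

Local Notation l0 := (@Ordinal 4 0 isT).
Local Notation l1 := (@Ordinal 4 1 isT).
Local Notation l2 := (@Ordinal 4 2 isT).
Local Notation l3 := (@Ordinal 4 3 isT).

Section LetterHolonomy.
Variable R : realType.
Local Notation I := (@unit_interval R).

Definition order_word (so s : seq 'I_4) : word := sorting_word 6 [seq index k s | k <- so].

Definition is_order (s : seq 'I_4) : bool := uniq s && (size s == 4).

(* [so] and [so'] list charts over [0, m] and [m, 1]; [s0], [sm] and [s1] list
   the points from left to right at the times 0, m and 1. *)
Lemma hol_lists (c : R -> 'I_4 -> R * R) (m : R) (so so' s0 sm s1 : seq 'I_4) :
  config_path c -> 0 <= m -> m <= 1 -> all is_order [:: so; so'; s0; sm; s1] ->
  (forall t, 0 <= t -> t <= m -> pairwise (fun i j =>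
    ((c t i).1 < (c t j).1) || ((c t i).2 < (c t j).2)) so) ->
  (forall t, m <= t -> t <= 1 -> pairwise (fun i j =>
    ((c t i).1 < (c t j).1) || ((c t i).2 < (c t j).2)) so') ->
  sorted (fun i j => lex_lt (c 0 i) (c 0 j)) s0 ->
  sorted (fun i j => lex_lt (c m i) (c m j)) sm ->
  sorted (fun i j => lex_lt (c 1 i) (c 1 j)) s1 ->
  hol c = braid ((inv_word (order_word so s0) ++ order_word so sm) ++
    inv_word (order_word so' sm) ++ order_word so' s1).
Proof.
move=> cc m0 m1 /and5P[/andP[uo /eqP zo] /andP[uo' /eqP zo'] /andP[u0 /eqP z0]
  /andP[um /eqP zm] /andP[/andP[u1 /eqP z1] _]] ch ch' st0 stm st1.
have [p oo] := lists_order_exists uo zo; have [p' oo'] := lists_order_exists uo' zo'.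
have [_ c_inj] := cc.
have r0 := x_rank_lists (c_inj _ (in_unit_interval0 R)) u0 z0 st0.
have r1 := x_rank_lists (c_inj _ (in_unit_interval1 R)) u1 z1 st1.
have Im : I m by rewrite /unit_interval /= m0.
have rm := x_rank_lists (c_inj _ Im) um zm stm.
rewrite !braid_cat_mul !braidV (@hol_charts _ _ p p' m cc m0 m1).
- by rewrite (chart_step_lists uo zo oo r0 rm) (chart_step_lists uo' zo' oo' rm r1).
- by move=> t /andP[t0 tm]; apply: (chart_lists oo uo zo); exact: ch.
- by move=> t /andP[mt t1]; apply: (chart_lists oo' uo' zo'); exact: ch'.
Qed.

(** What the comparisons of coordinates have to know of cos and sin, in a form open to linear
    arithmetic. The times 1/4 and 3/4 are safe sides of 1/2, where the cosine changes its sign. *)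
Lemma trig_half_turn (s : R) : 0 <= s <= 1 ->
  [/\ -1 <= cos (pi * s) <= 1, 0 <= sin (pi * s) <= 1,
      4^-1 < s \/ 0 < cos (pi * s), s < 3 / 4 \/ cos (pi * s) < 0
    & [\/ -1 < cos (pi * s) < 1 /\ 0 < sin (pi * s), s = 0 /\ cos (pi * s) = 1
        | s = 1 /\ cos (pi * s) = -1]].
Proof.
move=> /andP[s0 s1]; have pi0 := pi_gt0 R; split.
- by rewrite cos_geN1 cos_le1.
- by rewrite sin_le1 andbT; apply: sin_ge0_pi; apply/andP; split; nra.
- case: (ltP 4^-1 s) => [?|?]; [by left|right].
  by apply: cos_gt0_pihalf; apply/andP; split; nra.
- case: (ltP s (3 / 4)) => [?|?]; [by left|right].
  rewrite -(subrK (pi / 2) (pi * s)) cosDpihalf oppr_lt0.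
  by apply: sin_gt0_pi; apply/andP; split; nra.
- have [->|s0'] := eqVneq s 0; first by rewrite mulr0 cos0; constructor 2.
  have [->|s1'] := eqVneq s 1; first by rewrite mulr1 cospi; constructor 3.
  have {s0 s0'}s0 : 0 < s by rewrite lt_def s0'.
  have {s1 s1'}s1 : s < 1 by rewrite lt_neqAle s1'.
  have S0 : 0 < sin (pi * s) by apply: sin_gt0_pi; apply/andP; split; nra.
  have := cos2Dsin2 (pi * s); constructor 1; split=> //; apply/andP; split; nra.
Qed.

Lemma half_twist_path i (P : 'I_4 -> R * R) (f : R -> R) : continuous f -> injective P ->
  config_path (fun s k => half_twist i (f s) (P k)).
Proof.
move=> cf P_inj; split=> [k s|s _].
  have cfk : continuous (fun s => (f s, P k)) by move=> t; exact: (cvg_pair (cf t) (cvg_cst _)).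
  by apply: (@continuous_comp _ _ _ (fun s => (f s, P k)) (fun p => half_twist i p.1 p.2));
    [exact: cfk|exact: half_twist_continuous].
exact: inj_comp (@half_twist_inj R i (f s)) P_inj.
Qed.

Lemma puncture_inj : injective (@puncture R).
Proof.
move=> [[|[|[|[|//]]]] ?] [[|[|[|[|//]]]] ?] E; move: (congr1 fst E) (congr1 snd E) => {E};
  rewrite /puncture /p1 /p2 /p3 /p4 /= => ? ?; try (by apply/val_inj); exfalso; lra.
Qed.

(* It relates the numbering of the punctures around the square to their order
   by abscissa. *)
Definition position_braid : B4 := ((sigma i3 * sigma i2)^-1 * Delta)%g.

Lemma position_braidJ (i j : 'I_3) : (Delta * sigma i = sigma j * Delta)%g ->
  (position_braid * sigma i * position_braid^-1 =
   braid [:: (i2, true); (i3, true); (j, false); (i3, false); (i2, false)])%g.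
Proof.
rewrite !braid_cons (_ : braid [::] = 1%g) // mulg1 /= /position_braid.
move: Delta (sigma i) (sigma j) (sigma i2) (sigma i3) => D x y u v Dx.
by rewrite (invgM _ D) invgK (invgM v) -(mulgA _ D) Dx !mulgA (mulgK D).
Qed.

Lemma Delta_sigma : [/\ Delta * sigma i1 = sigma i3 * Delta, Delta * sigma i2 = sigma i2 * Delta
  & Delta * sigma i3 = sigma i1 * Delta]%g.
Proof. by rewrite /Delta; split; braid_decide 4%N. Qed.

Ltac twist_order t :=
  order_pairs; (have [|] := @trig_half_turn t; [by apply/andP; split; lra|];
  move: (cos _) (sin _) => ? ? ? ?;
  first [ by move=> _ _ _; order_pair
        | by move=> [?|?] [?|?] [[? ?]|[? ?]|[? ?]]; solve [order_pair | exfalso; lra] ]).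

Local Notation twisted i t := (twisted_puncture i (cos (pi * t)) (sin (pi * t)) : 'I_4 -> R * R).
Local Notation twist_chart i t :=
  (pairwise (fun j k => ((twisted i t j).1 < (twisted i t k).1) ||
                        ((twisted i t j).2 < (twisted i t k).2))).
Local Notation twist_sorted i t := (sorted (fun j k => lex_lt (twisted i t j) (twisted i t k))).

(** The exchanged points finish in the opposite order, so a half twist needs two charts. On a
    horizontal side the left end point passes below the right one and may precede it until they are
    level again; the reversed order is valid once the cosine is negative, hence a change at 3/4. On
    the vertical side the lower point may come first only while it is the lower one, hence a change
    at 1/4. *)
Lemma twist_chart1_low (t : R) : 0 <= t -> t <= 3 / 4 -> twist_chart i1 t [:: l3; l2; l0; l1].
Proof. by move=> t0 t1; twist_order t. Qed.

Lemma twist_chart1_high (t : R) : 3 / 4 <= t -> t <= 1 -> twist_chart i1 t [:: l3; l2; l1; l0].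
Proof. by move=> t0 t1; twist_order t. Qed.

Lemma twist_start1 : twist_sorted i1 (0 : R) [:: l3; l0; l2; l1].
Proof. by rewrite mulr0 cos0 sin0; order_pairs; order_pair. Qed.

Lemma twist_middle1 : twist_sorted i1 (3 / 4 : R) [:: l3; l1; l0; l2].
Proof. by twist_order (3 / 4 : R). Qed.

Lemma twist_end1 : twist_sorted i1 (1 : R) [:: l3; l1; l2; l0].
Proof. by rewrite mulr1 cospi sinpi; order_pairs; order_pair. Qed.

Lemma twist_chart2_low (t : R) : 0 <= t -> t <= 4^-1 -> twist_chart i2 t [:: l3; l0; l2; l1].
Proof. by move=> t0 t1; twist_order t. Qed.

Lemma twist_chart2_high (t : R) : 4^-1 <= t -> t <= 1 -> twist_chart i2 t [:: l3; l0; l1; l2].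
Proof. by move=> t0 t1; twist_order t. Qed.

Lemma twist_start2 : twist_sorted i2 (0 : R) [:: l3; l0; l2; l1].
Proof. by rewrite mulr0 cos0 sin0; order_pairs; order_pair. Qed.

Lemma twist_middle2 : twist_sorted i2 (4^-1 : R) [:: l3; l0; l1; l2].
Proof. by twist_order (4^-1 : R). Qed.

Lemma twist_end2 : twist_sorted i2 (1 : R) [:: l3; l0; l1; l2].
Proof. by rewrite mulr1 cospi sinpi; order_pairs; order_pair. Qed.

Lemma twist_chart3_low (t : R) : 0 <= t -> t <= 3 / 4 -> twist_chart i3 t [:: l3; l2; l0; l1].
Proof. by move=> t0 t1; twist_order t. Qed.

Lemma twist_chart3_high (t : R) : 3 / 4 <= t -> t <= 1 -> twist_chart i3 t [:: l2; l3; l0; l1].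
Proof. by move=> t0 t1; twist_order t. Qed.

Lemma twist_start3 : twist_sorted i3 (0 : R) [:: l3; l0; l2; l1].
Proof. by rewrite mulr0 cos0 sin0; order_pairs; order_pair. Qed.

Lemma twist_middle3 : twist_sorted i3 (3 / 4 : R) [:: l0; l2; l3; l1].
Proof. by twist_order (3 / 4 : R). Qed.

Lemma twist_end3 : twist_sorted i3 (1 : R) [:: l2; l0; l3; l1].
Proof. by rewrite mulr1 cospi sinpi; order_pairs; order_pair. Qed.

Lemma half_twist_hol i :
  hol (fun s : R => fun k => half_twist i s (puncture R k)) =
  (position_braid * sigma i * position_braid^-1)%g.
Proof.
have cE : (fun s k => half_twist i s (puncture R k)) =
    fun s k => twisted_puncture i (cos (pi * s)) (sin (pi * s)) k.
  by apply/funext => s; apply/funext => k; exact: half_twist_puncture.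
have : config_path (fun s k => half_twist i s (puncture R k)).
  by apply: half_twist_path puncture_inj => s; exact: cvg_id.
rewrite cE => cP {cE}; have [D1 D2 D3] := Delta_sigma.
have [Ei|Ei|Ei] := ord3P i; rewrite {}Ei in cP *.
- rewrite (hol_lists cP _ _ _ (@twist_chart1_low) (@twist_chart1_high) twist_start1
    twist_middle1 twist_end1); [|lra|lra|by []].
  by rewrite (position_braidJ D1); apply: (@braid_checkP 4); vm_compute.
- rewrite (hol_lists cP _ _ _ (@twist_chart2_low) (@twist_chart2_high) twist_start2
    twist_middle2 twist_end2); [|lra|lra|by []].
  by rewrite (position_braidJ D2); apply: (@braid_checkP 4); vm_compute.
- rewrite (hol_lists cP _ _ _ (@twist_chart3_low) (@twist_chart3_high) twist_start3
    twist_middle3 twist_end3); [|lra|lra|by []].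
  by rewrite (position_braidJ D3); apply: (@braid_checkP 4); vm_compute.
Qed.

End LetterHolonomy.

(** * The holonomy of a braid word *)

Section WordHolonomy.
Variable R : realType.
Implicit Types (P Q : 'I_4 -> R * R) (c : R -> 'I_4 -> R * R) (l : letter) (w : word).
Local Notation I := (@unit_interval R).

Lemma hol_rev c : config_path c -> hol (fun s => c (1 - s)) = (hol c)^-1%g.
Proof.
move=> /path_lift_exists[L cL].
have crev : continuous (fun s : R => 1 - s).
  by move=> s; apply: cvgB; [exact: cvg_cst|exact: cvg_id].
have Irev t : I t -> I (1 - t) by rewrite /unit_interval /=; lra.
rewrite (holE (lift_comp cL crev Irev)) (holE cL) /= subr0 subrr.
by rewrite (invgM (L 0%R)^-1%g) invgK.
Qed.

Definition letter_sign l : R := if l.2 then -1 else 1.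

Lemma letter_hol l : hol (fun (s : R) k => half_twist l.1 (letter_sign l * s) (puncture R k)) =
  (position_braid * braid [:: l] * position_braid^-1)%g.
Proof.
case: l => i []; rewrite /letter_sign /= braid_letter; last first.
  rewrite -(half_twist_hol R); congr hol; apply/funext => s; apply/funext => k.
  by rewrite mul1r.
have cP : config_path (fun s : R => fun k => half_twist i s (puncture R k)).
  by apply: half_twist_path (@puncture_inj R) => s; exact: cvg_id.
have crev : config_path (fun s : R => fun k => half_twist i (1 - s) (puncture R k)).
  apply: half_twist_path (@puncture_inj R) => s.
  by apply: cvgB; [exact: cvg_cst|exact: cvg_id].
(* A clockwise half twist is the counterclockwise one run backwards, up to renaming the two
   exchanged punctures. *)
rewrite (_ : (fun s k => _) = fun s => (fun k => half_twist i (1 - s) (puncture R k)) \o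
  transposition i).
  rewrite (hol_perm _ crev) (hol_rev cP) half_twist_hol.
  by move: position_braid (sigma i) => x y; rewrite (invgM (x * y)%g) invgK invgM mulgA.
apply/funext => s; apply/funext => k /=; rewrite !half_twist_puncture mulN1r mulrN mulrBr mulr1.
rewrite cosN sinN [pi - _]addrC cosDpi sinDpi cosN sinN opprK.
rewrite /twisted_puncture /puncture transpositionE.
by case: i {cP crev} k => [[|[|[|//]]] ?] [[|[|[|[|//]]]] ?];
  rewrite /= /puncture /p1 /p2 /p3 /p4 /=; congr (_, _); field.
Qed.

Lemma letter_map_continuous l : continuous (@letter_map R l).
Proof.
move=> z; pose f (z : R * R) := ((if l.2 then -1 else 1 : R), z).
have cf : {for z, continuous f} by exact: (cvg_pair (cvg_cst _) cvg_id).
exact: (@continuous_comp _ _ _ f (fun p => half_twist l.1 p.1 p.2) z cf (@half_twist_continuous R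
  l.1 _)).
Qed.

Lemma word_map_continuous w : continuous (@word_map R w).
Proof.
elim: w => [|l w IH] z; first exact: cvg_id.
exact: (@continuous_comp _ _ _ (letter_map l) (word_map w) z (@letter_map_continuous l z) (IH _)).
Qed.

Lemma word_map_inj w : injective (@word_map R w).
Proof.
elim: w => [|l w IH] x y //; rewrite -/(word_map w (letter_map l x)) => /IH.
exact: half_twist_inj.
Qed.

Lemma word_map_puncture w k : word_map w (puncture R k) = puncture R (braid_perm (braid w) k).
Proof.
elim: w k => [|l w IH] k.
  by rewrite [braid_perm _](braid_liftE transposition_relations) /eval_word big_nil perm1.
rewrite -[LHS]/(word_map w (letter_map l (puncture R k))) letter_map_puncture IH {IH}.
case: l => i b; rewrite braid_cons [braid_perm (_ * _)%g](braid_liftM transposition_relations)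
  permM.
congr (puncture R (_ _)); case: b => /=.
  rewrite (morphV (braid_liftM transposition_relations)) (braid_lift_sigma transposition_relations).
  by rewrite tpermV.
by rewrite (braid_lift_sigma transposition_relations).
Qed.

(** The holonomy swept out by [Q] while the half twists of the word are performed one after the
    other. *)
Fixpoint word_hol w Q : B4 :=
  if w is l :: w' then
    (hol (fun (s : R) k => half_twist l.1 (letter_sign l * s) (Q k)) *
     word_hol w' (fun k => letter_map l (Q k)))%g
  else 1%g.

Lemma letter_path l Q : injective Q ->
  config_path (fun (s : R) k => half_twist l.1 (letter_sign l * s) (Q k)).
Proof.
by apply: half_twist_path => s; apply: cvgM; [exact: cvg_cst|exact: cvg_id].
Qed.

Lemma letter_map_path l c : config_path c -> config_path (fun t k => letter_map l (c t k)).
Proof.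
move=> [cc c_inj]; split=> [k t|t It].
  exact: (@continuous_comp _ _ _ (c ^~ k) (letter_map l) t (cc k t) (@letter_map_continuous l _)).
exact: inj_comp (@half_twist_inj R _ _) (c_inj _ It).
Qed.

Lemma word_hol_perm w Q (s : {perm 'I_4}) : injective Q -> word_hol w (Q \o s) = word_hol w Q.
Proof.
elim: w Q => [//|l w IH] Q Q_inj /=; congr (_ * _)%g.
  exact: (hol_perm s (letter_path l Q_inj)).
by apply: (IH (fun k => letter_map l (Q k))); apply: inj_comp Q_inj; exact: half_twist_inj.
Qed.

(** For one letter, let the twist grow with one parameter and run along [c] with the other: the
    sides of this square are [c], its image, and the tracks of the two end configurations.
    [hol_square] relates the four holonomies. *)
Lemma word_map_hol w c : config_path c ->
  hol (fun t k => word_map w (c t k)) = ((word_hol w (c 0%R))^-1 * hol c * word_hol w (c 1%R))%g.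
Proof.
elim: w c => [|l w IH] c cc; first by rewrite /= invg1 mul1g mulg1.
rewrite (IH _ (letter_map_path l cc)) /=.
pose h (p : R * R) k := half_twist l.1 (letter_sign l * p.1) (c p.2 k).
have ch k : continuous (h ^~ k).
  pose g (p : R * R) := (letter_sign l * p.1, c p.2 k).
  have cg : continuous g.
    move=> p; have c1 : {for p, continuous (fun p : R * R => letter_sign l * p.1)}.
      by apply: cvgM; [exact: cvg_cst|exact: cvg_fst].
    have c2 : {for p, continuous (fun p : R * R => c p.2 k)}.
      exact: (@continuous_comp _ _ _ snd (c ^~ k) p cvg_snd (proj1 cc k _)).
    exact: (cvg_pair c1 c2).
  move=> p; exact: (@continuous_comp _ _ _ g (fun q => half_twist l.1 q.1 q.2) p (cg p)
    (@half_twist_continuous R l.1 _)).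
have h_inj p : unit_square p -> injective (h p).
  by move=> [_ p1]; apply: inj_comp (proj2 cc _ p1); exact: half_twist_inj.
have := hol_square ch h_inj; rewrite /h /=.
have E0 : (fun r : R => [eta fun k => half_twist l.1 (letter_sign l * 0) (c r k)]) = c.
  by apply/funext => r; apply/funext => k; rewrite mulr0 half_twist0.
have E1 : (fun r : R => [eta fun k => half_twist l.1 (letter_sign l * 1) (c r k)]) =
    fun r k => letter_map l (c r k).
  by apply/funext => r; apply/funext => k; rewrite mulr1.
rewrite E0 E1.
move: (hol (fun t k => letter_map l (c t k))) => x.
move: (hol _) (hol _) (hol _) (word_hol _ _) (word_hol _ _) => y z t u v E.
by rewrite invgM -!mulgA (mulgA _ z) E -(mulgA y) mulKg.
Qed.

Lemma word_hol_puncture w :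
  word_hol w (puncture R) = (position_braid * braid w * position_braid^-1)%g.
Proof.
elim: w => [|l w IH]; first by rewrite /= (_ : braid [::] = 1%g) // mulg1 mulgV.
rewrite /= (_ : (fun k => _) = puncture R \o transposition l.1).
  rewrite (word_hol_perm w _ (@puncture_inj R)) IH letter_hol.
  rewrite -[l :: w]/([:: l] ++ w) (braid_cat_mul [:: l]).
  by move: (braid [:: l]) (braid w) position_braid => x y z; rewrite !mulgA mulgKV.
by apply/funext => k; rewrite letter_map_puncture.
Qed.

End WordHolonomy.

(** * Configurations with two points on the left *)

Definition sigma1_power (x : B4) : Prop := exists m n : nat, (x * sigma i1 ^+ n = sigma i1 ^+ m)%g.

Lemma sigma1_power1 : sigma1_power 1%g.
Proof. by exists 0%N, 0%N; rewrite mulg1. Qed.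

Lemma sigma1_powerM x y : sigma1_power x -> sigma1_power y -> sigma1_power (x * y)%g.
Proof.
move=> [m [n xE]] [m' [n' yE]]; exists (m + m')%N, (n' + n)%N.
by rewrite (expgnDr _ n' n) mulgA -(mulgA x) yE -mulgA -expgnDr addnC !expgnDr mulgA xE.
Qed.

Lemma sigma1_powerV x : sigma1_power x -> sigma1_power x^-1%g.
Proof. by move=> [m [n xE]]; exists n, m; rewrite -xE mulKg. Qed.

Lemma sigma1_power_commute x : sigma1_power x -> commute x (sigma i1).
Proof.
move=> [m [n xE]]; have -> : x = (sigma i1 ^+ m * (sigma i1 ^+ n)^-1)%g by rewrite -xE mulgK.
by apply/commute_sym/commuteM; [exact: commuteX|exact/commuteV/commuteX].
Qed.

Lemma sigma1_power_det x : sigma1_power x -> rho_det x = rho_det (sigma i1) -> x = sigma i1.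
Proof.
move=> [m [n xE]] dx; have := congr1 (fun y => rho_det y ^+ 2) xE.
rewrite rho_detM !rho_detX dx -exprS -!exprM ![(_ * 2)%N]mulnC !exprM rho_det_sigma sqrrN.
rewrite -!exprM !exprVn => /laurent_t_exp_inj mn; apply: (mulIg (sigma i1 ^+ n)%g).
by rewrite xE (_ : m = n.+1) ?expgS //; lia.
Qed.

Section LeftConfigurations.
Variable R : realType.
Implicit Types (P Q : 'I_4 -> R * R) (c : R -> 'I_4 -> R * R).
Local Notation I := (@unit_interval R).

Definition left_config Q : Prop :=
  [/\ injective Q, Q l1 = p2 R, Q l2 = p3 R, (Q l0).1 < 2^-1 & (Q l3).1 < 2^-1].

Lemma left_config_rank Q : left_config Q ->
  lists_order [:: l3; l0; l2; l1] (x_rank Q) \/ lists_order [:: l0; l3; l2; l1] (x_rank Q).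
Proof.
move=> [Q_inj Q1 Q2 Q0 Q3].
have ltp : lex_lt (p3 R) (p2 R) by apply: lex_lt_y => //; rewrite /p3 /p2 /=; lra.
have [lt03|lt30] := boolP (lex_lt (Q l0) (Q l3)); [right|left].
  by apply: x_rank_lists => //; rewrite /= lt03 Q1 Q2 ltp lex_lt_x.
have {}lt30 : lex_lt (Q l3) (Q l0).
  have : Q l0 != Q l3 by rewrite (inj_eq Q_inj).
  by move/lex_lt_total; rewrite (negbTE lt30).
by apply: x_rank_lists => //; rewrite /= lt30 Q1 Q2 ltp lex_lt_x.
Qed.

(** The points 0 and 3 always occupy the two leftmost places and the other two points are fixed, so
    the only possible exchange is the one recorded by sigma_1 or its inverse. *)
Lemma left_cross P Q : left_config P -> left_config Q -> sigma1_power (cross P Q).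
Proof.
move=> lP lQ; rewrite cross.unlock /chart_step; set o := tilt_rank P.
have lists_inj s p q : lists_order s p -> lists_order s q -> p = q.
  by move=> sp sq; apply/permP => k; apply/ord_inj; rewrite sp sq.
have step (a b : 'I_4) p q : lists_order [:: a; b; l2; l1] p -> lists_order [:: b; a; l2; l1] q ->
    [|| (a == l0) && (b == l3) | (a == l3) && (b == l0)] -> sigma1_power (perm_step o p q).
  move=> sp sq ab; have -> : q = (p * transposition i1)%g.
    apply/permP => k; apply/ord_inj; rewrite permM transpositionE sp sq.
    by case/orP: ab => /andP[/eqP -> /eqP ->]; case: k => [[|[|[|[|//]]]] ?].
  rewrite (@perm_step_transposition o p i1 a b).
  - case: ifP => _; last first.
      by apply: sigma1_powerV; exists 1%N, 0%N; rewrite expg0 expg1 mulg1.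
    by exists 1%N, 0%N; rewrite expg0 expg1 mulg1.
  - by rewrite sp /= eqxx.
  - by rewrite sp /=; case/orP: ab => /andP[/eqP -> /eqP ->].
have [sP|sP] := left_config_rank lP; have [sQ|sQ] := left_config_rank lQ.
- by rewrite (lists_inj _ _ _ sP sQ) perm_step1; exact: sigma1_power1.
- exact: step sP sQ _.
- exact: step sP sQ _.
- by rewrite (lists_inj _ _ _ sP sQ) perm_step1; exact: sigma1_power1.
Qed.

Lemma left_hol c : config_path c -> (forall t, I t -> left_config (c t)) -> sigma1_power (hol c).
Proof.
move=> cc lc; apply: (hol_prop cc sigma1_power1).
  exact: sigma1_powerM.
by move=> s t Is It; apply: left_cross; exact: lc.
Qed.

(* The points 0 and 3 exchanged by a half turn along the circle with diameter
   of end points p4 and p4 + (0, e). *)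
Definition exchange (e t : R) (k : 'I_4) : R * R :=
  let C := cos (pi * t) in let S := sin (pi * t) in
  match nat_of_ord k with
  | 0 => (- 2^-1 - e / 2 * S, - 2^-1 + e / 2 + e / 2 * C)
  | 3 => (- 2^-1 + e / 2 * S, - 2^-1 + e / 2 - e / 2 * C)
  | _ => puncture R k
  end.

Lemma exchange_bounds (e t : R) : 0 < e -> e <= 2^-1 -> I t ->
  [/\ 0 <= e / 2 * sin (pi * t) <= 4^-1, - 4^-1 <= e / 2 * cos (pi * t) <= 4^-1,
      4^-1 < t \/ 0 < e / 2 * cos (pi * t)
    & 0 < e / 2 * sin (pi * t) \/ [/\ e / 2 * sin (pi * t) = 0, 4^-1 <= t -> e / 2 * cos (pi * t)
      < 0
      & e / 2 * cos (pi * t) != 0]].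
Proof.
move=> e0 e1 It; have [/andP[? ?] /andP[? ?] ct _ st] := trig_half_turn It; split.
- by apply/andP; split; nra.
- by apply/andP; split; nra.
- by case: ct => ?; [left|right; nra].
case: st => [[_ ?]|[t0 c1]|[t1 c1]]; first by left; nra.
  by right; rewrite t0 mulr0 sin0 cos0 mulr0; split=> [//|?|]; [lra|rewrite mulr1 gt_eqF //; lra].
by right; rewrite t1 mulr1 sinpi cospi mulr0; split=> [//|?|]; [lra|rewrite lt_eqF //; lra].
Qed.

Lemma exchange_path (e : R) : 0 < e -> e <= 2^-1 -> config_path (exchange e).
Proof.
move=> e0 e1; split.
  have cpi : continuous (fun t : R => pi * t).
    by move=> t; apply: cvgM; [exact: cvg_cst|exact: cvg_id].
  have cS : continuous (fun t : R => e / 2 * sin (pi * t)).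
    move=> t; apply: cvgM; first exact: cvg_cst.
    exact: (@continuous_comp _ _ _ _ sin t (cpi t) (@continuous_sin R _)).
  have cC : continuous (fun t : R => e / 2 * cos (pi * t)).
    move=> t; apply: cvgM; first exact: cvg_cst.
    exact: (@continuous_comp _ _ _ _ cos t (cpi t) (@continuous_cos R _)).
  move=> [[|[|[|[|//]]]] klt] t; rewrite /exchange /=; try exact: cvg_cst.
    have a : {for t, continuous (fun t : R => - 2^-1 - e / 2 * sin (pi * t))}.
      by apply: cvgB; [exact: cvg_cst|exact: cS].
    have b : {for t, continuous (fun t : R => - 2^-1 + e / 2 + e / 2 * cos (pi * t))}.
      by apply: cvgD; [exact: cvg_cst|exact: cC].
    exact: (cvg_pair a b).
  have a : {for t, continuous (fun t : R => - 2^-1 + e / 2 * sin (pi * t))}.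
    by apply: cvgD; [exact: cvg_cst|exact: cS].
  have b : {for t, continuous (fun t : R => - 2^-1 + e / 2 - e / 2 * cos (pi * t))}.
    by apply: cvgB; [exact: cvg_cst|exact: cC].
  exact: (cvg_pair a b).
move=> t /(exchange_bounds e0 e1); rewrite /exchange.
move: (_ * sin _) (_ * cos _) => S C [/andP[? ?] /andP[? ?] _ SC].
have S0 : S = 0 -> C = 0 -> False.
  by move=> S0 C0; case: SC => [|[_ _]]; rewrite ?S0 ?ltxx // C0 eqxx.
move=> [[|[|[|[|//]]]] ?] [[|[|[|[|//]]]] ?] E; move: (congr1 fst E) (congr1 snd E) => {E SC};
  rewrite /puncture /p1 /p2 /p3 /p4 /= => ? ?; try (by apply/val_inj); exfalso;
  try (by apply: S0; lra); clear S0; lra.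
Qed.

Lemma exchange_hol (e : R) : 0 < e -> e <= 2^-1 -> hol (exchange e) = sigma i1.
Proof.
move=> e0 e1; have m0 : 0 <= (4^-1 : R) by lra.
have m1 : (4^-1 : R) <= 1 by lra.
have ends0 : sorted (fun i j => lex_lt (exchange e 0 i) (exchange e 0 j)) [:: l3; l0; l2; l1].
  rewrite /exchange mulr0 sin0 cos0; order_pairs; order_pair.
have ends1 : sorted (fun i j => lex_lt (exchange e 1 i) (exchange e 1 j)) [:: l0; l3; l2; l1].
  rewrite /exchange mulr1 sinpi cospi; order_pairs; order_pair.
have I4 : I 4^-1 by rewrite /unit_interval /= m0.
have middle : sorted (fun i j => lex_lt (exchange e 4^-1 i) (exchange e 4^-1 j)) [:: l0; l3; l2;
  l1].
  have := exchange_bounds e0 e1 I4; rewrite /exchange.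
  move: (_ * sin _) (_ * cos _) => S C [/andP[? ?] /andP[? ?] _ [?|[? /(_ (lexx _)) ? _]]];
    order_pairs; order_pair.
rewrite (@hol_lists _ _ _ [:: l3; l0; l2; l1] [:: l0; l3; l2; l1] _ _ _ (exchange_path e0 e1)
  m0 m1 _ _ _ ends0 middle ends1).
- by rewrite sigmaE; apply: (@braid_checkP 4); vm_compute.
- by [].
- move=> t t0 t4; have It : I t by rewrite /unit_interval /= t0; lra.
  have := exchange_bounds e0 e1 It; rewrite /exchange.
  move: (_ * sin _) (_ * cos _) => S C [/andP[? ?] /andP[? ?] SC _].
  have {}SC : 0 < C by case: SC => // ?; exfalso; lra.
  order_pairs; order_pair.
- move=> t t0 t1; have It : I t by rewrite /unit_interval /= t1 andbT; lra.
  have := exchange_bounds e0 e1 It; rewrite /exchange.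
  move: (_ * sin _) (_ * cos _) => S C [/andP[? ?] /andP[? ?] _ [?|[? /(_ t0) ? _]]];
    order_pairs; order_pair.
Qed.

Lemma exchange_ends (e : R) : exchange e 1 = exchange e 0 \o tperm l0 l3.
Proof.
apply/funext => k /=; rewrite /exchange mulr0 mulr1 sin0 cos0 sinpi cospi.
case: tpermP => [->|->|] /=; [congr (_, _); lra|congr (_, _); lra|].
by case: k => [[|[|[|[|//]]]] ?] //= n0 n3; [case: n0|case: n3]; apply/val_inj.
Qed.

End LeftConfigurations.

(** * Continuity on the unit interval *)

Section UnitInterval.
Variable R : realType.
Local Open Scope classical_set_scope.
Local Notation I := (@unit_interval R).

Lemma within_comp_continuous (U V W : topologicalType) (A : set V) (F : V -> W) (g : U -> V) :
  {within A, continuous F} -> continuous g -> (forall x, A (g x)) -> continuous (F \o g).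
Proof.
move=> /subspace_continuousP cF cg Ag x; apply: cvg_trans (cF _ (Ag x)).
move=> B FB; have {}FB : nbhs (g x) [set y | A y -> B (F y)] by exact: FB.
have : nbhs x (g @^-1` [set y | A y -> B (F y)]) by exact: cg FB.
by apply: filterS => y /(_ (Ag y)).
Qed.

(** The retraction of the line onto the unit interval. Precomposition with it turns isotopies that
    are continuous on a closed domain only into maps continuous everywhere. *)
Definition clamp (t : R) : R := Num.max 0 (Num.min 1 t).

Lemma clamp_continuous : continuous clamp.
Proof.
move=> t; apply: (@continuous_max R R (fun=> 0) (fun t => Num.min 1 t) t); first exact: cvg_cst.
by apply: (@continuous_min R R (fun=> 1) id t); [exact: cvg_cst|exact: cvg_id].
Qed.

Lemma clamp_in t : I (clamp t).
Proof.
rewrite /unit_interval /clamp /= le_max lexx /= ge_max ler01 /=.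
by rewrite ge_min lexx.
Qed.

Lemma clamp_id t : I t -> clamp t = t.
Proof. by move=> /andP[t0 t1]; rewrite /clamp (min_idPr t1) (max_idPr t0). Qed.

(** A continuous injection of a compact interval is a homeomorphism onto its image. Explicitly, at
    parameters at distance at least [e] from [f t0] the arc [u] stays away from [v t0], by
    compactness. *)
Lemma arc_reparam (u v : R -> R * R) : continuous u -> {in I &, injective u} -> continuous v ->
  (forall t, exists2 s, I s & u s = v t) ->
  exists f : R -> R, [/\ continuous f, forall t, I (f t) & forall t, u (f t) = v t].
Proof.
move=> cu u_inj cv uv.
have [f fP] : exists f : R -> R, forall t, I (f t) /\ u (f t) = v t.
  have [|f fP] := @boolp.choice R R (fun t s => I s /\ u s = v t); last by exists f.
  by move=> t; have [s ? ?] := uv t; exists s.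
exists f; split=> [t0|t|t]; [|exact: (fP t).1|exact: (fP t).2].
apply/cvgrPdist_lt => e e0.
pose K := I `&` [set s | e <= `|s - f t0|].
have cK : compact K.
  apply: compact_closedI; first exact: unit_interval_compact.
  apply: (preimage_closed _ (@closed_ge R e)) => s _; apply: cvg_norm.
  by apply: cvgB; [exact: cvg_id|exact: cvg_cst].
pose g (s : R) := `|(u s).1 - (v t0).1| + `|(u s).2 - (v t0).2|.
have cg : continuous g.
  have c1 : continuous (fun s => (u s).1).
    by move=> s; apply: (@continuous_comp _ _ _ u fst); [exact: cu|exact: cvg_fst].
  have c2 : continuous (fun s => (u s).2).
    by move=> s; apply: (@continuous_comp _ _ _ u snd); [exact: cu|exact: cvg_snd].
  move=> s; apply: cvgD; apply: cvg_norm; apply: cvgB; by [exact: c1|exact: c2|exact: cvg_cst].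
have [m m0 gm] : exists2 m, 0 < m & forall s, K s -> m <= g s.
  have [->|K0] := eqVneq K set0; first by exists 1.
  have {}K0 : K !=set0 by apply/set0P.
  have [s0 Ks0 gmin] := compact_EVT_min K0 cK (continuous_subspaceT cg).
  exists (g s0); last by move=> s Ks; exact: gmin (mem_set Ks).
  rewrite lt_neqAle addr_ge0 ?normr_ge0 // andbT eq_sym paddr_eq0 ?normr_ge0 //.
  rewrite !normr_eq0 !subr_eq0; apply/negP => /andP[/eqP e1 /eqP e2].
  have [I0 /= f0] := set_mem Ks0.
  have us : u s0 = u (f t0).
    by rewrite (fP t0).2 [LHS]surjective_pairing [RHS]surjective_pairing e1 e2.
  move: f0; rewrite (u_inj s0 (f t0) _ _ us) ?inE //; last exact: (fP t0).1.
  by rewrite subrr normr0 leNgt e0.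
have m2 : 0 < m / 2 by rewrite divr_gt0.
have : \forall t \near t0, ball (v t0) (m / 2) (v t) by exact: cv (nbhsx_ballx _ _ m2).
apply: filterS => t [/= v1 v2].
rewrite ltNge; apply/negP; rewrite distrC => ft.
have := gm (f t) (conj (fP t).1 ft); rewrite /g (fP t).2.
have : `|(v t).1 - (v t0).1| < m / 2 by rewrite distrC.
have : `|(v t).2 - (v t0).2| < m / 2 by rewrite distrC.
lra.
Qed.

Lemma ball_punctures z w : @punctures R z -> @punctures R w -> ball z 2^-1 w -> z = w.
Proof.
by rewrite /punctures /p1 /p2 /p3 /p4 /= => -[[[->|->]|->]|->] [[[->|->]|->]|->] [] //=;
  rewrite !ball1E !ltr_norml => /andP[? ?] /andP[? ?]; exfalso; lra.
Qed.

Lemma puncture_path_constant (c : R -> R * R) : continuous c ->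
  (forall t, I t -> @punctures R (c t)) -> forall t, I t -> c t = c 0.
Proof.
move=> cc pc t It.
have h0 : 0 < 2^-1 :> R by rewrite invr_gt0.
have [d d0 cd] := compact_uniform cc (@unit_interval_compact R) h0.
have /andP[t0 t1] := It.
apply/esym; apply: (@locally_constant _ _ c 0 t d d0 t0) => s r /andP[s0 st] /andP[r0 rt] sr.
have Is : I s by rewrite /unit_interval /= s0 (le_trans st).
have Ir : I r by rewrite /unit_interval /= r0 (le_trans rt).
by apply: ball_punctures; [exact: pc|exact: pc|apply: cd].
Qed.

End UnitInterval.

(** * Braids preserving the segment T4 *)

Section MovingPoint.
Variable R : realType.
Local Open Scope classical_set_scope.
Implicit Types (a : R * R) (k : 'I_4).
Local Notation I := (@unit_interval R).

Definition moving a k : R * R := if k == ord0 then a else puncture R k.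

Definition unoccupied a : Prop := forall k, k != ord0 -> a <> puncture R k.

Lemma moving_p1 : moving (p1 R) = puncture R.
Proof. by apply/funext => k; rewrite /moving; case: eqP => [->|]. Qed.

Lemma moving_inj a : unoccupied a -> injective (moving a).
Proof.
move=> oa j k; rewrite /moving; case: eqP => [->|/eqP j0]; case: eqP => [->|/eqP k0] //.
- by move/(oa _ k0).
- by move/esym/(oa _ j0).
- exact: puncture_inj.
Qed.

Lemma moving_continuous (U : topologicalType) (v : U -> R * R) k :
  continuous v -> continuous (fun t => moving (v t) k).
Proof. by move=> cv; rewrite /moving; case: eqP => // _ t; exact: cvg_cst. Qed.

Lemma moving_path (v : R -> R * R) : continuous v -> (forall t, I t -> unoccupied (v t)) ->
  config_path (moving \o v).
Proof. by move=> cv ov; split=> [k|t /ov]; [exact: moving_continuous|exact: moving_inj]. Qed.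

Lemma moving_left a : unoccupied a -> a.1 < 2^-1 -> left_config (moving a).
Proof.
by move=> oa a1; split=> //; [exact: moving_inj|rewrite /moving /puncture /p4 /=; lra].
Qed.

Lemma moving_left_hol (v : R -> R * R) : continuous v ->
  (forall t, I t -> unoccupied (v t) /\ (v t).1 < 2^-1) -> sigma1_power (hol (moving \o v)).
Proof.
move=> cv lv; apply: left_hol => [|t /lv[]]; last exact: moving_left.
by apply: moving_path => // t /lv[].
Qed.

(** On the sides r = 0 and r = 1 the moving point stays on the left, so these contribute powers of
    sigma_1; commutation with sigma_1 then passes from the side s = 1 to the side s = 0. *)
Lemma moving_square (h : R * R -> R * R) : continuous h ->
  (forall s r, I s -> I r -> unoccupied (h (s, r))) ->
  (forall s, I s -> (h (s, 0)).1 < 2^-1) -> (forall s, I s -> (h (s, 1)).1 < 2^-1) ->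
  commute (hol (fun r => moving (h (1, r)))) (sigma i1) ->
  commute (hol (fun r => moving (h (0, r)))) (sigma i1).
Proof.
move=> ch oh l0 l1 com.
have ch' k : continuous (fun p => moving (h p) k) by exact: moving_continuous.
have edge b : I b -> continuous (fun s => h (s, b)).
  move=> _ s; apply: (@continuous_comp _ _ _ (fun s => (s, b)) h); last exact: ch.
  exact: (cvg_pair cvg_id (cvg_cst _)).
have h_inj p : unit_square p -> injective (moving (h p)).
  by case: p => s r [/= Is Ir]; apply: moving_inj; exact: oh.
have I0 := in_unit_interval0 R; have I1 := in_unit_interval1 R.
have left0 : sigma1_power (hol (fun s => moving (h (s, 0)))).
  by apply: (moving_left_hol (edge _ I0)) => t It; split; [exact: oh|exact: l0].
have left1 : sigma1_power (hol (fun s => moving (h (s, 1)))).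
  by apply: (moving_left_hol (edge _ I1)) => t It; split; [exact: oh|exact: l1].
have /= E := hol_square ch' h_inj.
have {E} -> : hol (fun r => moving (h (0, r))) =
    (hol (fun s => moving (h (s, 0%R))) * hol (fun r => moving (h (1%R, r))) *
     (hol (fun s => moving (h (s, 1%R))))^-1)%g.
  by rewrite -E mulgK.
apply/commute_sym/commuteM; last exact/commuteV/commute_sym/sigma1_power_commute.
by apply/commuteM; [exact/commute_sym/sigma1_power_commute|exact/commute_sym].
Qed.

Definition T4_point (r : R) : R * R := (- 2^-1, - 2^-1 + r).

Lemma T4_point_continuous : continuous T4_point.
Proof.
move=> r; have c : {for r, continuous (fun r : R => - 2^-1 + r)}.
  by apply: cvgD; [exact: cvg_cst|exact: cvg_id].
exact: (cvg_pair (cvg_cst _) c).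
Qed.

Lemma T4_pointP z : T4 z <-> exists2 r, I r & T4_point r = z.
Proof.
rewrite /T4 /segment /T4_point /p4 /p1 /=.
split=> [[r]|[r Ir <-]]; first by rewrite in_itv /= => Ir <-; exists r => //; congr (_, _); lra.
by exists r; [rewrite /= in_itv|congr (_, _); lra].
Qed.

Lemma T4_point_disc r : I r -> disc (T4_point r).
Proof. by move=> /andP[r0 r1]; rewrite /disc /T4_point /=; nra. Qed.

Lemma T4_point_unoccupied r : r != 0 -> unoccupied (T4_point r).
Proof.
move=> r0; have {}r0 : r < 0 \/ 0 < r by apply/orP; rewrite -neq_lt.
move=> [[|[|[|[|//]]]] ?] //= _ E; move: (congr1 fst E) (congr1 snd E) => {E};
  rewrite /puncture /p2 /p3 /p4 /= => ? ?; case: r0 => ?; lra.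
Qed.

Lemma puncture_disc k : disc (puncture R k).
Proof.
by case: k => [[|[|[|[|//]]]] ?]; rewrite /disc /puncture /p1 /p2 /p3 /p4 /=; nra.
Qed.

Lemma puncturesP z : punctures z <-> exists k, z = puncture R k.
Proof.
split=> [[[[->|->]|->]|->]|[k ->]].
- by exists (inord 0); rewrite /puncture inordK.
- by exists (inord 1); rewrite /puncture inordK.
- by exists (inord 2); rewrite /puncture inordK.
- by exists (inord 3); rewrite /puncture inordK.
by case: k => [[|[|[|[|//]]]] ?]; rewrite /punctures /puncture /=;
  [left;left;left|left;left;right|left;right|right].
Qed.

Lemma near_p4 (N : R * R -> R * R) : continuous N -> (forall s, I s -> N (s, 0) = p4 R) ->
  exists2 d, 0 < d & forall s r, I s -> `|r| < d -> (N (s, r)).1 < 2^-1.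
Proof.
move=> cN N0; have h0 : 0 < 1 :> R by [].
have [d d0 Nd] := compact_uniform cN (@unit_square_compact R) h0.
exists d => // s r Is rd; have := Nd (s, 0) (s, r) (conj Is (in_unit_interval0 R)).
rewrite N0 // => -[|/= b1 _].
  by split; [exact: ballxx|rewrite ball1E sub0r normrN].
by move: b1; rewrite ball1E /p4 /= ltr_norml => /andP[? ?]; lra.
Qed.

End MovingPoint.

Section FixedArc.
Variable R : realType.
Local Open Scope classical_set_scope.
Local Notation I := (@unit_interval R).

Lemma in_unit_intervalE (r : R) : `[0, 1]%classic r = I r.
Proof. by rewrite /= in_itv. Qed.

Lemma unoccupiedP (a : R * R) : (punctures a -> a = p1 R) -> unoccupied a.
Proof.
move=> pa k k0 ak; have /puncture_inj kE : puncture R k = puncture R l0.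
  by rewrite -ak pa // puncturesP; exists k.
by rewrite kE in k0.
Qed.

(* An isotopy from the arc [A] to T4 in which all arcs are oriented from p4 to p1. *)
Lemma isotopy_to_T4 (A : set (R * R)) : isotopic_arcs A (@T4 R) -> A (p4 R) -> A (p1 R) ->
  exists K : R * R -> R * R,
    [/\ continuous K, (forall s r, I r -> r != 0 -> unoccupied (K (s, r))) /\
          {in I &, injective (fun r => K (0, r))},
        (forall s, K (s, 0) = p4 R) /\ (forall s, K (s, 1) = p1 R),
        forall r, I r -> (K (1, r)).1 < 2^-1
      & forall a, A a -> exists2 r, I r & K (0, r) = a].
Proof.
move=> [H [cH aH H0 H1]] A4 A1.
have I0 := in_unit_interval0 R; have I1 := in_unit_interval1 R.
have pu (z : R * R) : z = p1 R \/ z = p4 R -> punctures z.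
  by move=> [->|->]; rewrite /punctures /=; [left; left; left|right].
have ends r : I r -> punctures (H (0, r)) -> r = 0 \/ r = 1.
  by move=> Ir; have [_ _ _ /(_ r)[]] := aH 0 ltac:(by rewrite in_unit_intervalE);
    rewrite ?in_unit_intervalE.
have inI (a : R * R) : A a -> exists2 r, I r & H (0, r) = a.
  by rewrite -H0 => -[r Ir <-]; exists r => //; rewrite -in_unit_intervalE.
have p14 : p1 R <> p4 R by move=> /(congr1 snd); rewrite /p1 /p4 /=; lra.
(* [b] records whether the given arcs run from p1 to p4; in that case the reparametrisation [o]
   reverses them. *)
have [b [b0 b1]] : exists b : bool, H (0, if b then 1 else 0) = p4 R /\
    H (0, if b then 0 else 1) = p1 R.
  have [r4 Ir4 E4] := inI _ A4; have [r1 Ir1 E1] := inI _ A1.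
  have e4 : r4 = 0 \/ r4 = 1 by apply: ends => //; rewrite E4; apply: pu; right.
  have e1 : r1 = 0 \/ r1 = 1 by apply: ends => //; rewrite E1; apply: pu; left.
  case: e4 e1 => re4 [] re1; rewrite re4 in E4; rewrite re1 in E1.
  - by case: p14; rewrite -E1 -E4.
  - by exists false.
  - by exists true.
  - by case: p14; rewrite -E1 -E4.
pose o r : R := if b then 1 - r else r.
have co : continuous o.
  by rewrite /o; case: b {b0 b1 o} => r; [apply: cvgB;
    [exact: cvg_cst|exact: cvg_id]|exact: cvg_id].
have oK r : o (o r) = r by rewrite /o; case: (b) => //; lra.
have Io r : I r -> I (o r) by rewrite /o /unit_interval /=; case: (b) => //; lra.
pose g (p : R * R) := (clamp p.1, o (clamp p.2)).
have cg : continuous g.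
  move=> [s r]; have c1 : {for (s, r), continuous (fun p : R * R => clamp p.1)}.
    by apply: (@continuous_comp _ _ _ fst (@clamp R)); [exact: cvg_fst|exact: clamp_continuous].
  have c2 : {for (s, r), continuous (fun p : R * R => o (clamp p.2))}.
    apply: (@continuous_comp _ _ _ (fun p : R * R => clamp p.2) o); last exact: co.
    by apply: (@continuous_comp _ _ _ snd (@clamp R)); [exact: cvg_snd|exact: clamp_continuous].
  exact: (cvg_pair c1 c2).
have cK : continuous (H \o g).
  apply: (within_comp_continuous cH cg) => p.
  by split; rewrite in_unit_intervalE; [exact: clamp_in|apply/Io/clamp_in].
have arcs s : is_arc (fun r => H (clamp s, r)).
  by apply: aH; rewrite in_unit_intervalE; exact: clamp_in.
have oE r : o r = 0 \/ o r = 1 -> r = 0 \/ r = 1.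
  by rewrite /o; case: (b) => // -[?|?]; [right|left]; lra.
have arcP s r : I r -> punctures (H (clamp s, o r)) -> r = 0 \/ r = 1.
  move=> Ir; have [_ _ _ arc] := arcs s.
  by rewrite arc ?in_unit_intervalE //; [exact: oE|exact: Io].
have const r : I r -> r = 0 \/ r = 1 -> forall s, H (clamp s, o r) = H (0, o r).
  move=> Ir or s.
  have cr : continuous (fun s => H (clamp s, o r)).
    rewrite (_ : (fun s => _) = (H \o g) \o (fun s => (s, r))); last first.
      by apply/funext => t; rewrite /= /g /= (clamp_id Ir).
    move=> t; apply: continuous_comp; last exact: cK.
    exact: (cvg_pair cvg_id (cvg_cst _)).
  have pr t : I t -> punctures (H (clamp t, o r)).
    move=> It; have [_ _ _ arc] := arcs t.
    apply/arc; rewrite ?in_unit_intervalE //; first exact: Io.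
    by case: or => ->; rewrite /o; case: (b); rewrite ?subr0 ?subrr; [right|left|left|right].
  have := puncture_path_constant cr pr (clamp_in s).
  by rewrite (clamp_id (clamp_in s)) (clamp_id I0).
have K0 s : H (clamp s, o 0) = p4 R.
  by rewrite const //; [rewrite -b0 /o; case: (b); rewrite ?subr0|left].
have K1 s : H (clamp s, o 1) = p1 R.
  by rewrite const //; [rewrite -b1 /o; case: (b); rewrite ?subrr|right].
exists (H \o g); rewrite /comp /g /=; split=> //.
- split=> [s r Ir r0|r r' ir ir'] /=.
    rewrite (clamp_id Ir); apply: unoccupiedP => /(arcP _ _ Ir)[rE|->]; last exact: K1.
    by rewrite rE eqxx in r0.
  rewrite !inE in ir ir'; rewrite (clamp_id ir) (clamp_id ir') => E.
  have [_ inj _ _] := arcs 0; apply: (can_inj oK).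
  by apply: inj E; rewrite inE in_unit_intervalE; exact: Io.
- by split=> s /=; [rewrite (clamp_id I0)|rewrite (clamp_id I1)].
- move=> r Ir /=; rewrite (clamp_id I1) (clamp_id Ir).
  have : T4 (H (1, o r)) by rewrite -H1; exists (o r) => //; rewrite in_unit_intervalE; exact: Io.
  by case/T4_pointP => t _ <-; rewrite /T4_point /=; lra.
- move=> a /inI[r Ir <-]; exists (o r); first exact: Io.
  by rewrite /= (clamp_id I0) (clamp_id (Io _ Ir)) oK.
Qed.

End FixedArc.

Section FixedSegment.
Variable R : realType.
Local Open Scope classical_set_scope.
Variables (w : word) (f : R * R -> R * R).
Hypotheses (w_pure : pure (braid w)) (wf : isotopic_homeo (word_map w) f)
  (f_T4 : isotopic_arcs (f @` @T4 R) (@T4 R)).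
Local Notation I := (@unit_interval R).

Lemma pure_word_map k : word_map w (puncture R k) = puncture R k.
Proof. by rewrite word_map_puncture w_pure perm1. Qed.

Lemma word_map_path (c : R -> 'I_4 -> R * R) : config_path c ->
  config_path (fun t k => word_map w (c t k)).
Proof.
move=> [cc c_inj]; split=> [k t|t It].
  apply: (@continuous_comp _ _ _ (c ^~ k) (word_map w) t (cc k t)).
  exact: word_map_continuous.
exact: inj_comp (@word_map_inj R w) (c_inj _ It).
Qed.

Lemma exchange0 (e : R) : exchange e 0 = moving (T4_point e).
Proof.
apply/funext => -[[|[|[|[|//]]]] ?]; rewrite /exchange /moving -?val_eqE /= ?(mulr0, sin0, cos0) //.
  by rewrite /T4_point; congr (_, _); lra.
by rewrite /puncture /p4 /=; congr (_, _); lra.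
Qed.

(* The half twist exchanging the end point p4 with a nearby point of T4 is
   mapped to a path in the half-plane x < 1/2; its holonomy is a power of
   sigma_1, of exponent 1 by the determinant. *)
Lemma word_hol_commute (e : R) : 0 < e -> e <= 2^-1 ->
  (forall z, ball (p4 R) (2 * e) z -> (word_map w z).1 < 2^-1) ->
  commute (word_hol w (moving (T4_point e))) (sigma i1).
Proof.
move=> e0 e1 we; have ep := exchange_path e0 e1.
have [_ ex_inj] := word_map_path ep.
have /left_hol : config_path (fun t k => word_map w (exchange e t k)) by exact: word_map_path.
have pE k : k \in [:: @Ordinal 4 1 isT; @Ordinal 4 2 isT] -> forall t,
    word_map w (exchange e t k) = puncture R k.
  by rewrite !inE => /orP[]/eqP -> t; rewrite /exchange /= pure_word_map.
have near k t : k \in [:: l0; l3] -> I t -> ball (p4 R) (2 * e) (exchange e t k).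
  rewrite !inE => k03 /trig_half_turn[/andP[c0 c1] /andP[s0 s1] _ _ _].
  rewrite /exchange; move: (cos _) (sin _) c0 c1 s0 s1 => C S ????.
  by case/orP: k03 => /eqP -> /=; split; rewrite ball1E ltr_norml /p4 /=; apply/andP; split; nra.
move=> H1; have : sigma1_power (hol (fun t k => word_map w (exchange e t k))).
  apply: H1 => t It; split; first exact: ex_inj.
  - exact: pE.
  - exact: pE.
  - by apply/we/near.
  - by apply/we/near.
(* The exchange ends in a relabelling of its initial configuration, so both ends contribute the same
   braid x and the holonomy is x^-1 sigma_1 x. *)
rewrite (word_map_hol w ep) (exchange_hol e0 e1) exchange_ends.
rewrite (word_hol_perm w (tperm l0 l3) (ep.2 _ (in_unit_interval0 R))) exchange0.
move: (word_hol w _) => x x_power; rewrite /commute -{1}(sigma1_power_det x_power).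
  by rewrite !mulgA mulgV mul1g.
by rewrite !rho_detM mulrAC rho_detV mul1r.
Qed.

(** The path [q] brings p1 back along T4 from a point near p4, and [word_map_hol] writes the
    conjugated braid as a product of three factors: the inverse of the holonomy of [q], a power of
    sigma_1; the contribution of the configuration near p4, settled by [word_hol_commute]; and the
    holonomy of the image of [q]. For the last one the image arc is slid by [F] to the image of T4
    under [f], and by [K] to T4 itself, [moving_square] being applied to each slide. *)
Lemma fixed_T4_commute :
  commute (position_braid * braid w * position_braid^-1)%g (sigma i1).
Proof.
have [F [cF hF F0 F1]] := wf.
have I0 := in_unit_interval0 R; have I1 := in_unit_interval1 R.
have hF' s : disc_homeo (fun z => F (clamp s, z)).
  by apply: hF; rewrite in_unit_intervalE; exact: clamp_in.
have F_inj s y z : disc y -> disc z -> F (clamp s, y) = F (clamp s, z) -> y = z.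
  move=> Dy Dz; have [[_ inj _] _ _ _] := hF' s; apply: inj; exact/mem_set.
have cFp (g : R * R -> R * R) : continuous g -> (forall p, disc (g p)) ->
    continuous (fun p : R * R => F (clamp p.1, g p)).
  move=> cg Dg; pose gg (p : R * R) := (clamp p.1, g p).
  have cgg : continuous gg.
    move=> p; have c1 : {for p, continuous (fun p : R * R => clamp p.1)}.
      by apply: (@continuous_comp _ _ _ fst (@clamp R)); [exact: cvg_fst|exact: clamp_continuous].
    exact: (cvg_pair c1 (cg p)).
  apply: (within_comp_continuous cF cgg) => p.
  by split; [rewrite in_unit_intervalE; exact: clamp_in|exact: Dg].
have Fp s k : F (clamp s, puncture R k) = puncture R k.
  have cp : continuous (fun t => F (clamp t, puncture R k)).
    have c : continuous (fun p : R * R => F (clamp p.1, puncture R k)).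
      by apply: (cFp (fun=> puncture R k)) => p; [exact: cvg_cst|exact: puncture_disc].
    pose g (t : R) := (t, 0 : R); have cg : continuous g.
      by move=> t; exact: (cvg_pair cvg_id (cvg_cst _)).
    by move=> t; exact (@continuous_comp _ _ _ g (fun p : R * R => F (clamp p.1, puncture R k)) t
      (cg t) (c _)).
  have pp t : I t -> punctures (F (clamp t, puncture R k)).
    move=> _; have [_ _ _ <-] := hF' t; exists (puncture R k) => //.
    by rewrite puncturesP; exists k.
  have := puncture_path_constant cp pp (clamp_in s).
  by rewrite (clamp_id (clamp_in s)) (clamp_id I0) F0 ?pure_word_map //; exact: puncture_disc.
pose arc (p : R * R) := F (clamp p.1, T4_point (clamp p.2)).
have c_arc : continuous arc.
  apply: (cFp (fun p => T4_point (clamp p.2))) => p; last exact/T4_point_disc/clamp_in.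
  apply: (@continuous_comp _ _ _ (fun p : R * R => clamp p.2) (@T4_point R)).
    by apply: (@continuous_comp _ _ _ snd (@clamp R)); [exact: cvg_snd|exact: clamp_continuous].
  exact: T4_point_continuous.
have arc0 s : arc (s, 0) = p4 R.
  rewrite /arc /= (clamp_id I0) (_ : T4_point 0 = puncture R l3) ?Fp //.
  by rewrite /T4_point /puncture /p4 /= addr0.
have arc1 s : arc (s, 1) = p1 R.
  rewrite /arc /= (clamp_id I1) (_ : T4_point 1 = puncture R l0) ?Fp //.
  by rewrite /T4_point /puncture /p1 /=; congr (_, _); lra.
have fE z : disc z -> F (clamp 1, z) = f z by move=> /F1; rewrite (clamp_id I1).
have arc_f t : (f @` @T4 R) (arc (1, t)).
  exists (T4_point (clamp t)); first by apply/T4_pointP; exists (clamp t) => //; exact: clamp_in.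
  by rewrite /arc /= fE //; exact/T4_point_disc/clamp_in.
have [||K [cK [K_free K_inj] [K0 K1] K_T4 K_f]] := isotopy_to_T4 f_T4.
- by rewrite -(arc0 1).
- by rewrite -(arc1 1).
(* The end of the first isotopy and the beginning of the second trace the same arc with unrelated
   parametrisations; [phi] reconciles them. *)
have [phi [c_phi I_phi phiE]] : exists phi : R -> R, [/\ continuous phi, forall t, I (phi t)
    & forall t, K (0, phi t) = arc (1, t)].
  apply: (@arc_reparam R (fun r => K (0, r)) (fun t => arc (1, t))) => // [r|r|t].
  - apply: (@continuous_comp _ _ _ (fun r => (0 : R, r)) K); last exact: cK.
    exact: (cvg_pair (cvg_cst _) cvg_id).
  - apply: (@continuous_comp _ _ _ (fun r => (1 : R, r)) arc); last exact: c_arc.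
    exact: (cvg_pair (cvg_cst _) cvg_id).
  exact/K_f/arc_f.
have phi0 : phi 0 = 0.
  by apply: K_inj; rewrite ?inE //= phiE arc0 K0.
have phi_neq0 t : I t -> t != 0 -> phi t != 0.
  move=> It; apply: contra_neq => pt0; have : arc (1, t) = arc (1, 0) by rewrite -!phiE pt0 phi0.
  rewrite /arc /= (clamp_id It) (clamp_id I0) => /F_inj.
  move=> /(_ (T4_point_disc It) (T4_point_disc I0)) /(congr1 snd) /=; lra.
have [d1 d1_gt0 near1] : exists2 d, 0 < d & forall z, ball (p4 R) d z -> (word_map w z).1 < 2^-1.
  have h0 : 0 < 1 :> R by [].
  have : \forall z \near p4 R, ball (word_map w (p4 R)) 1 (word_map w z).
    exact: (@word_map_continuous R w) (nbhsx_ballx _ _ h0).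
  rewrite (pure_word_map l3) => /nbhs_ballP[d /= d0 dw]; exists d => // z /dw [/= + _].
  by rewrite ball1E ltr_norml => /andP[? ?]; lra.
have [d2 d2_gt0 near2] := near_p4 c_arc (fun s _ => arc0 s).
have [d3 d3_gt0 near3] : exists2 d, 0 < d & forall s r, I s -> `|r| < d -> (K (s, phi r)).1 < 2^-1.
  apply: (@near_p4 R (fun p => K (p.1, phi p.2))) => [p|s _ /=]; last by rewrite phi0 K0.
  apply: (@continuous_comp _ _ _ (fun p : R * R => (p.1, phi p.2)) K); last exact: cK.
  have c2 : {for p, continuous (fun p : R * R => phi p.2)}.
    by apply: (@continuous_comp _ _ _ snd phi); [exact: cvg_snd|exact: c_phi].
  exact: (cvg_pair cvg_fst c2).
(* Close enough to p4 for the word map and for both isotopies to keep the moving point at abscissa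
   less than 1/2; the factor 2 makes room for the whole exchange of p4 with the point at distance
   [e]. *)
have [e [e0 e_half e1 e2 e3]] : exists e : R, [/\ 0 < e, e <= 2^-1, 2 * e <= d1, e < d2 & e < d3].
  pose m := Num.min 2^-1 (Num.min (d1 / 2) (Num.min (d2 / 2) (d3 / 2))).
  have m0 : 0 < m by rewrite !lt_min !divr_gt0 // invr_gt0 ltr0n.
  have m2 : m <= 2^-1 by rewrite ge_min lexx.
  have md1 : m <= d1 / 2 by rewrite !ge_min lexx orbT.
  have md2 : m <= d2 / 2 by rewrite !ge_min lexx !orbT.
  have md3 : m <= d3 / 2 by rewrite !ge_min lexx !orbT.
  by exists m; split=> //; lra.
(* The parameters of T4 from [e] to 1: the moving point stops short of p4, which is occupied. *)
pose seg (r : R) := e + (1 - e) * clamp r.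
have c_seg : continuous seg.
  move=> r; apply: cvgD; first exact: cvg_cst.
  by apply: cvgM; [exact: cvg_cst|exact: clamp_continuous].
have I_seg r : I (seg r).
  by have /andP[? ?] := clamp_in r; rewrite /unit_interval /= /seg; apply/andP; split; nra.
have seg_neq0 r : seg r != 0.
  by have /andP[? ?] := clamp_in r; rewrite gt_eqF // /seg; nra.
have seg0 : seg 0 = e.
  by rewrite /seg (clamp_id I0) mulr0 addr0.
have seg1 : seg 1 = 1.
  by rewrite /seg (clamp_id I1) mulr1 subrKC.
pose q (r : R) := moving (T4_point (seg r)).
have cTs : continuous (fun r => T4_point (seg r)).
  by move=> r; apply: (@continuous_comp _ _ _ seg (@T4_point R));
    [exact: c_seg|exact: T4_point_continuous].
have q_path : config_path q.
  by apply: (moving_path cTs) => r _; exact: T4_point_unoccupied.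
have q_power : sigma1_power (hol q).
  apply: (moving_left_hol cTs) => r _; split; first exact: T4_point_unoccupied.
  by rewrite /T4_point /=; lra.
have com_e : commute (word_hol w (moving (T4_point e))) (sigma i1).
  apply: word_hol_commute => // z ez; apply: near1; exact: le_ball ez.
have com_K : commute (hol (fun r => moving (K (0, phi (seg r))))) (sigma i1).
  have phi1 : phi 1 = 1 by apply: K_inj; rewrite ?inE //= phiE arc1 K1.
  apply: (@moving_square R (fun p => K (p.1, phi (seg p.2)))) => /=.
  - move=> p; apply: (@continuous_comp _ _ _ (fun p : R * R => (p.1, phi (seg p.2))) K);
    last exact: cK.
    have c2 : {for p, continuous (fun p : R * R => phi (seg p.2))}.
      apply: (@continuous_comp _ _ _ (fun p : R * R => seg p.2) phi); last exact: c_phi.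
      by apply: (@continuous_comp _ _ _ snd seg); [exact: cvg_snd|exact: c_seg].
    exact: (cvg_pair cvg_fst c2).
  - by move=> s r _ _; apply: K_free => //; exact: phi_neq0.
  - by move=> s Is; rewrite seg0; apply: near3 => //; rewrite gtr0_norm.
  - by move=> s Is; rewrite seg1 phi1 K1 /p1 /=; lra.
  apply: sigma1_power_commute; apply: (@moving_left_hol R (fun r => K (1, phi (seg r)))).
    move=> r; apply: (@continuous_comp _ _ _ (fun r => (1 : R, phi (seg r))) K); last exact: cK.
    have c2 : {for r, continuous (fun r => phi (seg r))}.
      by apply: (@continuous_comp _ _ _ seg phi); [exact: c_seg|exact: c_phi].
    exact: (cvg_pair (cvg_cst _) c2).
  by move=> r _; split; [apply: K_free => //; exact: phi_neq0|exact: K_T4].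
have com_F : commute (hol (fun r => moving (arc (0, seg r)))) (sigma i1).
  apply: (@moving_square R (fun p => arc (p.1, seg p.2))) => /=.
  - move=> p; apply: (@continuous_comp _ _ _ (fun p : R * R => (p.1, seg p.2)) arc);
    last exact: c_arc.
    have c2 : {for p, continuous (fun p : R * R => seg p.2)}.
      by apply: (@continuous_comp _ _ _ snd seg); [exact: cvg_snd|exact: c_seg].
    exact: (cvg_pair cvg_fst c2).
  - move=> s r _ _ k k0; rewrite /arc /= -(Fp s k) => /F_inj.
    rewrite (clamp_id (I_seg r)) => /(_ (T4_point_disc (I_seg r)) (puncture_disc R k)).
    exact: (T4_point_unoccupied (seg_neq0 r) k0).
  - by move=> s Is; rewrite seg0; apply: near2 => //; rewrite gtr0_norm.
  - by move=> s Is; rewrite seg1 arc1 /p1 /=; lra.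
  rewrite (_ : (fun r => _) = fun r => moving (K (0, phi (seg r)))) //.
  by apply/funext => r; rewrite phiE.
rewrite -(word_hol_puncture R).
have E := word_map_hol w q_path.
have q0 : q 0 = moving (T4_point e) by rewrite /q seg0.
have q1 : q 1 = puncture R.
  rewrite /q seg1 -moving_p1; congr moving; rewrite /T4_point /p1; congr (_, _); lra.
have wq : (fun t k => word_map w (q t k)) = fun r => moving (arc (0, seg r)).
  apply/funext => r; apply/funext => k; rewrite /q /moving; case: eqP => _;
    last exact: pure_word_map.
  by rewrite /arc /= (clamp_id I0) (clamp_id (I_seg r)) F0 //; exact: T4_point_disc.
rewrite q0 q1 wq in E.
have -> : word_hol w (puncture R) = ((hol q)^-1 * word_hol w (moving (T4_point e)) *
    hol (fun r => moving (arc (0%R, seg r))))%g.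
  rewrite E.
  by move: (hol q) (word_hol _ _) (word_hol _ _) => x y z; rewrite !mulgA mulgK mulVg mul1g.
apply/commute_sym/commuteM; last exact/commute_sym.
apply/commuteM; last exact/commute_sym.
exact/commuteV/commute_sym/sigma1_power_commute.
Qed.

End FixedSegment.

(** * The kernel of the Burau representation *)

Lemma kernel_commute (R : realType)
  (Hdeg : forall x : B4,
     x <> 1%g -> pure x -> (forall k : nat, x <> (Delta ^+ k)%g) ->
     acts_nontrivially_on_T4 R x ->
     exists l0 m0 : nat, forall m l : nat, (m0 < m)%N -> (l0 <= l)%N ->
       let A := rho (braid_a ^+ m * x * braid_a ^- l)%g in
       [/\ GL3_val A i1 i1 != 0, GL3_val A i3 i1 != 0
         & deg_min (GL3_val A i1 i1) - deg_min (GL3_val A i3 i1) = -1]) (x : B4) :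
  rho x = 1%g -> commute (position_braid * x * position_braid^-1)%g (sigma i1).
Proof.
move=> x1; have [->|/eqP x_neq1] := eqVneq x 1%g; first by rewrite mulg1 mulgV /commute mul1g mulg1.
apply: contrapT => not_com.
have [|l0 [m0 H]] := Hdeg x x_neq1 (kernel_pure x1) (fun k xk => x_neq1 (kernel_Delta x1 xk)).
  move=> f [w wx wf] f_T4; apply: not_com; rewrite -wx.
  by apply: (fixed_T4_commute _ wf f_T4); rewrite wx; exact: kernel_pure.
(* A common exponent satisfying both bounds: the braid is then a conjugate of [x], sent to the
   identity matrix, whose entry in position (3, 1) vanishes. *)
have [||_ + _] := H (maxn m0.+1 l0) (maxn m0.+1 l0); rewrite ?leq_maxl ?leq_maxr //.
rewrite !rhoM x1 mulg1 -rhoM mulgV rho1.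
by rewrite (_ : GL3_val 1%g = 1%:M) // mxE eqxx.
Qed.

Theorem theorem4p3 (R : realType)
  (Hdeg : forall x : B4,
     x <> 1%g -> pure x -> (forall k : nat, x <> (Delta ^+ k)%g) ->
     acts_nontrivially_on_T4 R x ->
     exists l0 m0 : nat, forall m l : nat, (m0 < m)%N -> (l0 <= l)%N ->
       let A := rho (braid_a ^+ m * x * braid_a ^- l)%g in
       [/\ GL3_val A i1 i1 != 0, GL3_val A i3 i1 != 0
         & deg_min (GL3_val A i1 i1) - deg_min (GL3_val A i3 i1) = -1]) :
  injective rho.
Proof.
have kernel_trivial x : rho x = 1%g -> x = 1%g.
  move=> x1; have conj v : rho (v * x * v^-1)%g = 1%g by rewrite !rhoM x1 mulg1 -rhoM mulgV rho1.
  (* Applied to the conjugate of [x] by [position_braid^-1 * u^-1], the previous lemma loses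
     [position_braid] and says that u^-1 x u commutes with sigma_1. *)
  have com u : commute x (u * sigma i1 * u^-1)%g.
    have := kernel_commute Hdeg (conj (position_braid^-1 * u^-1)%g).
    move: position_braid (sigma i1) => p s.
    rewrite (_ : _ * p^-1 = u^-1 * x * u)%g => [C|].
      apply: (mulgI u^-1%g); apply: (mulIg u); rewrite !mulgA mulgKV mulVg mul1g.
      by rewrite [LHS]C !mulgA.
    by rewrite invgM !invgK !mulgA mulgV mul1g mulgK.
  (* All generators are conjugate to sigma_1: sigma_1 sigma_2 conjugates it to sigma_2, and sigma_2
     sigma_3 sigma_1 sigma_2 conjugates it to sigma_3. *)
  have com_sigma i : commute x (sigma i).
    have [->|->|->] := ord3P i.
    - by have := com 1%g; rewrite invg1 mul1g mulg1.
    - have E : (sigma i1 * sigma i2 * sigma i1 = sigma i2 * (sigma i1 * sigma i2))%g.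
        by braid_decide 2%N.
      by have := com (sigma i1 * sigma i2)%g; rewrite E mulgK.
    - have E : (sigma i2 * sigma i3 * sigma i1 * sigma i2 * sigma i1 =
          sigma i3 * (sigma i2 * sigma i3 * sigma i1 * sigma i2))%g by braid_decide 4%N.
      by have := com (sigma i2 * sigma i3 * sigma i1 * sigma i2)%g; rewrite E mulgK.
  apply: central_kernel_trivial; last by rewrite /rho_det x1 det1.
  elim/braid_ind => [|y i yc|y i yc]; first by rewrite /commute mul1g mulg1.
    exact: commuteM.
  exact/commuteM/commuteV.
move=> x y xy; apply: (mulIg y^-1%g); rewrite mulgV; apply: kernel_trivial.
by rewrite rhoM xy -rhoM mulgV rho1.
Qed.
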